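(* Let $\Omega$, $\mathcal{T}_h$, $S_h,V_h,R_h,X_h$, $\Delta t=T/N$, the constants $\nu,\gamma,\lambda>0$ and the functions $b,\psi,f,g,\mathsf{h}$ with their convex splittings be as in the context. Let $\phi_0\in H^1(\Omega)$, $\mathbf{F}_0\in H^1(\Omega;\mathbb{R}^{3\times3})$, and let $\phi_h^0=P_h^S(\phi_0)$, $\mathbf{F}_h^0=P_h^X(\mathbf{F}_0)$ be their $L^2$-projections onto $S_h$ and $X_h$. For all $n=0,\dots,N-1$, given $\phi_h^n\in S_h$, $\mathbf{F}_h^n\in X_h$, there exists $(\mathbf{v}_h^{n+1},s_h^{n+1},\mathbf{F}_h^{n+1},\mathbf{M}_h^{n+1},\phi_h^{n+1},\mu_h^{n+1})\in V_h\times R_h\times X_h\times X_h\times S_h\times S_h$ such that, for all $(\mathbf{u}_h,p_h,\boldsymbol{\Theta}_h,\boldsymbol{\Pi}_h,\xi_h,\chi_h)\in V_h\times R_h\times X_h\times X_h\times S_h\times S_h$, $$\nu\int_\Omega\nabla\mathbf{v}_h^{n+1}:\nabla\mathbf{u}_h-\int_\Omega s_h^{n+1}\operatorname{div}\mathbf{u}_h=\int_\Omega\mu_h^{n+1}\nabla\phi_h^n\cdot\mathbf{u}_h-\int_\Omega(\mathbf{M}_h^{n+1}(\mathbf{F}_h^n)^T):\nabla\mathbf{u}_h+\int_\Omega(\nabla\mathbf{F}_h^n\odot\mathbf{M}_h^{n+1})\cdot\mathbf{u}_h,$$ $$\int_\Omega p_h\operatorname{div}\mathbf{v}_h^{n+1}=0,$$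 $$\int_\Omega(\mathbf{F}_h^{n+1}-\mathbf{F}_h^n):\boldsymbol{\Theta}_h+\Delta t\int_\Omega(\mathbf{v}_h^{n+1}\cdot\nabla)\mathbf{F}_h^n:\boldsymbol{\Theta}_h-\Delta t\int_\Omega(\nabla\mathbf{v}_h^{n+1})\mathbf{F}_h^n:\boldsymbol{\Theta}_h+\Delta t\,\gamma\int_\Omega\mathbf{M}_h^{n+1}:\boldsymbol{\Theta}_h=0,$$ $$\int_\Omega\mathbf{M}_h^{n+1}:\boldsymbol{\Pi}_h=\int_\Omega\left(\mathsf{h}_+'(\mathbf{F}_h^{n+1})+\mathsf{h}_-'(\mathbf{F}_h^n)\right):\boldsymbol{\Pi}_h+\int_\Omega[f(\phi_h^n)]_+\left(g_+'(\mathbf{F}_h^{n+1})+g_-'(\mathbf{F}_h^n)\right):\boldsymbol{\Pi}_h$$ $$\qquad+\int_\Omega\left(f(\phi_h^n)-[f(\phi_h^n)]_+\right)\left(g_+'(\mathbf{F}_h^n)+g_-'(\mathbf{F}_h^{n+1})\right):\boldsymbol{\Pi}_h+\lambda\int_\Omega\sum_{i,j,k=1}^3\partial_k(\mathbf{F}_h^{n+1})_{ij}\,\partial_k(\boldsymbol{\Pi}_h)_{ij},$$ $$\int_\Omega(\phi_h^{n+1}-\phi_h^n)\xi_h+\Delta t\int_\Omega(\mathbf{v}_h^{n+1}\cdot\nabla\phi_h^n)\xi_h+\Delta t\int_\Omega b(\phi_h^n)\nabla\mu_h^{n+1}\cdot\nabla\xi_h=0,$$ $$\int_\Omega\mu_h^{n+1}\chi_h=\int_\Omega\nabla\phi_h^{n+1}\cdot\nabla\chi_h+\int_\Omega\left(\psi_+'(\phi_h^{n+1})+\psi_-'(\phi_h^n)\right)\chi_h+\int_\Omega\left(f_+'(\phi_h^{n+1})g(\mathbf{F}_h^{n+1})+f_-'(\phi_h^n)g(\mathbf{F}_h^{n+1})\right)\chi_h.$$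 The discrete solution satisfies the stability bound $$\max_{n=0,\dots,N-1}\left(\tfrac12\|\nabla\phi_h^{n+1}\|_{L^2}^2+\tfrac\lambda2\|\nabla\mathbf{F}_h^{n+1}\|_{L^2}^2\right)+\frac{(\Delta t)^2}{2}\sum_{n=0}^{N-1}\left\|\frac{\nabla(\phi_h^{n+1}-\phi_h^n)}{\Delta t}\right\|_{L^2}^2+\frac{\lambda(\Delta t)^2}{2}\sum_{n=0}^{N-1}\left\|\frac{\nabla(\mathbf{F}_h^{n+1}-\mathbf{F}_h^n)}{\Delta t}\right\|_{L^2}^2$$ $$+\Delta t\,\nu\sum_{n=0}^{N-1}\|\nabla\mathbf{v}_h^{n+1}\|_{L^2}^2+\Delta t\,\gamma\sum_{n=0}^{N-1}\|\mathbf{M}_h^{n+1}\|_{L^2}^2+\Delta t\sum_{n=0}^{N-1}\int_\Omega b(\phi_h^n)\nabla\mu_h^{n+1}\cdot\nabla\mu_h^{n+1}\le C(\phi_h^0,\mathbf{F}_h^0)+C.$$ Moreover, the functional $$\int_\Omega\left(\psi(\phi_h^{n})+\mathsf{h}(\mathbf{F}_h^{n})+f(\phi_h^{n})g(\mathbf{F}_h^{n})\right)+\tfrac12\|\nabla\phi_h^{n}\|_{L^2}^2+\tfrac\lambda2\|\nabla\mathbf{F}_h^{n}\|_{L^2}^2$$ is decreasing (i.e. non-increasing) in $n$ along the discrete solutions (Lyapunov functional).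
   Context: Notation. $\mathbf{A}:\mathbf{B}=\sum_{i,j}A_{ij}B_{ij}$, $|\mathbf{A}|=(\mathbf{A}:\mathbf{A})^{1/2}$; $(\nabla\mathbf{v})_{ij}=\partial_jv_i$; $(\nabla\mathbf{F})_{ijk}=\partial_kF_{ij}$; $((\mathbf{v}\cdot\nabla)\mathbf{F})_{ij}=\sum_kv_k\partial_kF_{ij}$; $(\nabla\mathbf{F}\odot\mathbf{M})_k=\sum_{i,j}\partial_kF_{ij}M_{ij}$; $[r]_+=\max(0,r)$. For a function of a matrix, a prime denotes the matrix of partial derivatives with respect to the entries. Discretization. $\Omega\subset\mathbb{R}^3$ is a bounded domain with a quasi-uniform conforming decomposition $\mathcal{T}_h$ into tetrahedra (3-simplices) of maximal diameter $h>0$. With $\mathbb{P}_l(K)$ the polynomials of total degree at most $l$ on $K$, $S_h=\{s\in C^0(\bar\Omega):s|_K\in\mathbb{P}_1(K)\ \forall K\in\mathcal{T}_h\}$, $V_h=\{\mathbf{v}\in C^0(\bar\Omega;\mathbb{R}^3)\cap H_0^1(\Omega;\mathbb{R}^3):\mathbf{v}|_K\in[\mathbb{P}_2(K)]^3\ \forall K\in\mathcal{T}_h\}$, $X_h=\{\mathbf{A}\in C^0(\bar\Omega;\mathbb{R}^{3\times3}):\mathbf{A}|_K\in[\mathbb{P}_1(K)]^{3\times3}\ \forall K\in\mathcal{T}_h\}$, $R_h=\{q\in S_h:\int_\Omega q=0\}$. The pair $(V_h,R_h)$ (lowest order Taylor–Hood elements) satisfies the discrete inf-sup (Ladyzhenskaya–Babuška–Brezzi)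 condition. $P_h^S$ and $P_h^X$ are the $L^2$-orthogonal projections onto $S_h$ and $X_h$. $T>0$, $N\in\mathbb{N}$, $\Delta t=T/N$. Assumptions on the functions. - $b\in C^0(\mathbb{R})$ with $0<b_0\le b(r)\le b_1$ for all $r$. - The elastic energy density is $w(\phi,\mathbf{F})=f(\phi)g(\mathbf{F})+\mathsf{h}(\mathbf{F})$ with $f\in C^1(\mathbb{R})$, $-k_{f1}\le f(r)\le k_{f2}$, $|f'(r)|\le k_{f3}$ ($k_{f1},k_{f2},k_{f3}\ge0$); $g,\mathsf{h}\in C^1(\mathbb{R}^{3\times3})$, $0\le g(\mathbf{T})\le k_g(1+|\mathbf{T}|^p)$, $k_g>0$, $-k_{h1}\le\mathsf{h}(\mathbf{T})\le k_{h2}(1+|\mathbf{T}|^p)$, $\mathsf{h}(\mathbf{T})\sim k_{h2}|\mathbf{T}|^p$ as $|\mathbf{T}|\to\infty$, with $k_{h1}\ge0$, $k_{h2}>0$, $k_{h2}\ge k_{f1}k_g$, $p\in[0,6)$. Moreover $w$ satisfies, for some $d_1\ge0$, $d_2,d_3,d_4>0$ and all $r,\mathbf{T}$: $-d_1\le w(r,\mathbf{T})\le d_2(1+|\mathbf{T}|^p)$, $|\partial_{\mathbf{T}}w|\le d_3(1+|\mathbf{T}|^{p-1})$, $|\partial_rw|\le d_4(1+|\mathbf{T}|^p)$. (Any additional summand of $w$ depending on $\phi$ only is absorbed into $\psi$.) - $\psi\in C^1(\mathbb{R})$ with $|\psi'(r)|\le c_1(|r|^l+1)$, $\psi(r)\ge-c_2$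 for all $r$, $c_1>0$, $c_2\ge0$, $l\in[0,6+\frac{8}{\max(2,2p-6)})$, and $\psi=\psi_++\psi_-$ with $\psi_+$ convex, $\psi_-$ concave and $|\psi_-''(r)|\le c_1(|r|^q+1)$, $q\in[0,4)$. - Convex splittings into continuously differentiable convex ($+$) and concave ($-$) parts: $\psi=\psi_++\psi_-$, $f=f_++f_-$, $g=g_++g_-$, $\mathsf{h}=\mathsf{h}_++\mathsf{h}_-$. Constants. $C$ is a positive constant independent of the discrete unknowns and of $\Delta t$, $N$ and $h$; $C(\phi_h^0,\mathbf{F}_h^0)$ is a constant depending additionally only on the discrete initial data (and on the fixed model data $\psi,f,g,\mathsf{h},\lambda,\Omega$). *)

(* Defs.v *)
From HB Require Import structures.
From mathcomp Require Import all_boot all_order all_algebra.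
From mathcomp Require Import all_classical all_reals all_analysis.
(* The notations of mpoly clash with those of the analysis library. *)
From mathcomp Require Import -(notations) mpoly.

Set Implicit Arguments.
Unset Strict Implicit.
Unset Printing Implicit Defensive.

Import Order.TTheory GRing.Theory Num.Theory.
Import numFieldNormedType.Exports.

Local Open Scope classical_set_scope.
Local Open Scope ring_scope.

Reserved Notation "\int3_ ( x 'in' D ) F"
  (at level 36, F at level 36, x, D at level 50,
   format "'[' \int3_ ( x  'in'  D ) '/  '  F ']'").

Section Calculus.
Context {R : realType}.
Local Notation pt := 'rV[R]_3.
Local Notation mx := 'M[R]_3.

(* The norm that MathComp-Analysis puts on matrices is the maximum norm, so the
   Euclidean and Frobenius norms are introduced explicitly. *)
Definition dotv (u v : pt) : R := \sum_k u 0 k * v 0 k.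
Definition ddot (A B : mx) : R := \sum_i \sum_j A i j * B i j.
Definition enorm (u : pt) : R := Num.sqrt (dotv u u).
Definition fnorm (A : mx) : R := Num.sqrt (ddot A A).

Definition pospart (r : R) : R := Num.max 0 r.

(* Classical partial derivatives.  A finite element function is differentiable
   in the interior of every cell, hence almost everywhere; the value taken by
   [pd] on the faces between cells is irrelevant under an integral. *)
Definition pd (k : 'I_3) (f : pt -> R) (x : pt) : R :=
  'D_(delta_mx 0 k : pt) f x.

Definition grad (f : pt -> R) (x : pt) : pt := \row_k pd k f x.

Definition gradv (v : pt -> pt) (x : pt) : mx :=
  \matrix_(i, j) pd j (fun y => v y 0 i) x.

Definition divv (v : pt -> pt) (x : pt) : R :=
  \sum_k pd k (fun y => v y 0 k) x.

Definition pdm (k : 'I_3) (F : pt -> mx) (x : pt) : mx :=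
  \matrix_(i, j) pd k (fun y => F y i j) x.

Definition convect (v : pt -> pt) (F : pt -> mx) (x : pt) : mx :=
  \sum_k v x 0 k *: pdm k F x.

Definition odot (F M : pt -> mx) (x : pt) : pt :=
  \row_k ddot (pdm k F x) (M x).

Definition ddotgrad (F G : pt -> mx) (x : pt) : R :=
  \sum_k ddot (pdm k F x) (pdm k G x).

Definition dmx (g : mx -> R) (A : mx) : mx :=
  \matrix_(i, j) 'D_(delta_mx i j : mx) g A.

Definition C1 (f : R -> R) : Prop :=
  (forall r, derivable f r 1) /\ continuous (f^`()%classic : R -> R).

Definition C1mx (g : mx -> R) : Prop :=
  (forall A, differentiable g A) /\ continuous (dmx g).

Definition convex_fun (V : lmodType R) (f : V -> R) : Prop :=
  convex_function setT f.

Definition concave_fun (V : lmodType R) (f : V -> R) : Prop :=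
  convex_function setT (fun x => - f x).

End Calculus.

Section Integration.
Context {R : realType}.
Local Notation pt := 'rV[R]_3.
Local Notation mx := 'M[R]_3.

(* The library has no measurable structure on row vectors: R^3 is measured
   through the identification of (R * R) * R with ['rV[R]_3]. *)
Definition to_rV (z : R * R * R) : pt :=
  \row_k [:: z.1.1; z.1.2; z.2]`_k.

Definition leb3 : {measure set (measurableTypeR R * measurableTypeR R *
                                measurableTypeR R) -> \bar R} :=
  ((@lebesgue_measure R \x @lebesgue_measure R) \x @lebesgue_measure R)%E.

Definition int3 (D : set pt) (f : pt -> R) : R :=
  \int[leb3]_(z in to_rV @^-1` D) f (to_rV z).

Definition L2fun (D : set pt) (f : pt -> R) : Prop :=
  measurable_fun (to_rV @^-1` D) (f \o to_rV) /\
  leb3.-integrable (to_rV @^-1` D) (fun z => ((f (to_rV z)) ^+ 2)%:E).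

End Integration.

Notation "\int3_ ( x 'in' D ) F" := (int3 D (fun x => F)) : ring_scope.

Section Sobolev.
Context {R : realType}.
Local Notation pt := 'rV[R]_3.
Local Notation mx := 'M[R]_3.
Variable Omega : set pt.

Definition test_function (f : pt -> R) : Prop :=
  (forall (ks : seq 'I_3) (x : pt), differentiable (foldr pd f ks) x) /\
  exists K : set pt,
    [/\ compact K, K `<=` Omega & forall x, ~ K x -> f x = 0].

Definition weak_pd (k : 'I_3) (u g : pt -> R) : Prop :=
  forall f, test_function f ->
    \int3_(x in Omega) (u x * pd k f x) = - \int3_(x in Omega) (g x * f x).

Definition H1 (u : pt -> R) : Prop :=
  L2fun Omega u /\
  forall k, exists g, L2fun Omega g /\ weak_pd k u g.

Definition H1mx (F : pt -> mx) : Prop := forall i j, H1 (fun x => F x i j).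

(* Closure of the test functions in the H^1 norm. *)
Definition H10 (u : pt -> R) : Prop :=
  L2fun Omega u /\
  exists g : 'I_3 -> pt -> R,
    (forall k, L2fun Omega (g k) /\ weak_pd k u (g k)) /\
    exists f : nat -> pt -> R,
      [/\ forall n, test_function (f n),
          \int3_(x in Omega) ((f n x - u x) ^+ 2) @[n --> \oo] --> (0 : R) &
          forall k, \int3_(x in Omega) ((pd k (f n) x - g k x) ^+ 2)
                      @[n --> \oo] --> (0 : R)].

End Sobolev.

Section Meshes.
Context {R : realType}.
Local Notation pt := 'rV[R]_3.
Local Notation mx := 'M[R]_3.

Definition bounded_domain (Omega : set pt) : Prop :=
  [/\ open Omega, connected Omega, Omega !=set0 & bounded_set Omega].

Record tetrahedron := Tetrahedron {
  vertex : 'I_4 -> pt;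
  vertex_free : row_free (\matrix_(i < 3) (vertex (lift ord0 i) - vertex ord0))
}.

Definition bary (K : tetrahedron) (t : 'I_4 -> R) (x : pt) : Prop :=
  [/\ forall i, 0 <= t i, \sum_i t i = 1 & x = \sum_i t i *: vertex K i].

Definition hull (K : tetrahedron) : set pt := [set x | exists t, bary K t x].

(* The face of K spanned by the vertices it shares with K'. *)
Definition common_face (K K' : tetrahedron) : set pt :=
  [set x | exists2 t, bary K t x &
    forall i, t i != 0 -> exists j, vertex K i = vertex K' j].

Record mesh := Mesh { ncells : nat; cell : 'I_ncells -> tetrahedron }.

Definition conforming_decomposition (Omega : set pt) (Th : mesh) : Prop :=
  [/\ closure Omega = \bigcup_i hull (cell (m := Th) i),
      (forall i j : 'I_(ncells Th), i != j ->
         interior (hull (cell i)) `&` interior (hull (cell j)) = set0) &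
      forall i j : 'I_(ncells Th), i != j ->
        hull (cell i) `&` hull (cell j) = common_face (cell i) (cell j)].

Definition diam (A : set pt) : R :=
  sup [set r | exists x y, [/\ A x, A y & r = enorm (x - y)]].

Definition mesh_size (Th : mesh) : R :=
  \big[Num.max/0]_(i < ncells Th) diam (hull (cell i)).

(* Meshes with the same rho form a quasi-uniform family. *)
Definition quasi_uniform (rho : R) (Th : mesh) : Prop :=
  forall i : 'I_(ncells Th), exists c : pt,
    [set x | enorm (x - c) <= rho * mesh_size Th] `<=` hull (cell i).

Definition polynomial_on (l : nat) (K : tetrahedron) (s : pt -> R) : Prop :=
  exists2 q : mpoly 3 R, (mmeasure mdeg q <= l.+1)%N &
    forall x, hull K x -> s x = meval (fun i => x 0 i) q.

Section Spaces.
Variables (Omega : set pt) (Th : mesh).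

Definition Sh (s : pt -> R) : Prop :=
  {within closure Omega, continuous s} /\
  forall i : 'I_(ncells Th), polynomial_on 1 (cell i) s.

Definition Vh (v : pt -> pt) : Prop :=
  [/\ {within closure Omega, continuous v},
      forall k, H10 Omega (fun x => v x 0 k) &
      forall (i : 'I_(ncells Th)) k,
        polynomial_on 2 (cell i) (fun x => v x 0 k)].

Definition Xh (A : pt -> mx) : Prop :=
  {within closure Omega, continuous A} /\
  forall (c : 'I_(ncells Th)) i j,
    polynomial_on 1 (cell c) (fun x => A x i j).

Definition Rh (q : pt -> R) : Prop := Sh q /\ \int3_(x in Omega) q x = 0.

Definition inf_sup (beta : R) : Prop :=
  forall q, Rh q ->
    beta * Num.sqrt (\int3_(x in Omega) (q x ^+ 2)) <=
    sup [set r | exists v, [/\ Vh v,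
      \int3_(x in Omega) (dotv (v x) (v x)) +
        \int3_(x in Omega) (ddot (gradv v x) (gradv v x)) != 0 &
      r = \int3_(x in Omega) (q x * divv v x) /
          Num.sqrt (\int3_(x in Omega) (dotv (v x) (v x)) +
            \int3_(x in Omega) (ddot (gradv v x) (gradv v x)))]].

Definition projS (u uh : pt -> R) : Prop :=
  Sh uh /\
  forall chi, Sh chi -> \int3_(x in Omega) ((uh x - u x) * chi x) = 0.

Definition projX (F Fh : pt -> mx) : Prop :=
  Xh Fh /\
  forall Theta, Xh Theta ->
    \int3_(x in Omega) (ddot (Fh x - F x) (Theta x)) = 0.

End Spaces.
End Meshes.

Arguments tetrahedron : clear implicits.
Arguments mesh : clear implicits.

Section Model.
Context {R : realType}.
Local Notation pt := 'rV[R]_3.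
Local Notation mx := 'M[R]_3.

Record energy := Energy {
  psi : R -> R;
  ef : R -> R;
  eg : mx -> R;
  eh : mx -> R;
  lambda : R
}.

Record splitting := Splitting {
  psip : R -> R; psim : R -> R;
  fp : R -> R; fm : R -> R;
  gp : mx -> R; gm : mx -> R;
  hp : mx -> R; hm : mx -> R
}.

Definition convex_splitting (E : energy) (S : splitting) : Prop :=
  [/\ [/\ C1 (psip S), C1 (psim S), convex_fun (psip S : R^o -> R),
          concave_fun (psim S : R^o -> R) &
          forall r, psi E r = psip S r + psim S r],
      [/\ C1 (fp S), C1 (fm S), convex_fun (fp S : R^o -> R),
          concave_fun (fm S : R^o -> R) &
          forall r, ef E r = fp S r + fm S r],
      [/\ C1mx (gp S), C1mx (gm S), convex_fun (gp S), concave_fun (gm S) &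
          forall A, eg E A = gp S A + gm S A] &
      [/\ C1mx (hp S), C1mx (hm S), convex_fun (hp S), concave_fun (hm S) &
          forall A, eh E A = hp S A + hm S A]].

Definition wdens (E : energy) (r : R) (A : mx) : R := ef E r * eg E A + eh E A.

Definition mobility_assumption (b : R -> R) : Prop :=
  continuous b /\
  exists b0 b1, 0 < b0 /\ forall r, b0 <= b r /\ b r <= b1.

Definition elastic_assumptions (E : energy) (p : R) : Prop :=
  [/\ 0 <= p < 6, C1 (ef E), C1mx (eg E), C1mx (eh E) &
  (exists kf1 kf2 kf3 kg kh1 kh2 : R,
    [/\ [/\ 0 <= kf1, 0 <= kf2, 0 <= kf3, 0 < kg & 0 <= kh1],
        0 < kh2 /\ kf1 * kg <= kh2,
        (forall r, [/\ - kf1 <= ef E r, ef E r <= kf2 &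
                       `|(ef E)^`()%classic r| <= kf3]),
        (forall A, 0 <= eg E A <= kg * (1 + fnorm A `^ p)) &
        (forall A, - kh1 <= eh E A <= kh2 * (1 + fnorm A `^ p)) /\
        (* h(T) ~ kh2 |T|^p as |T| -> oo *)
        forall eps, 0 < eps -> \forall a \near +oo, forall A, a <= fnorm A ->
          `|eh E A - kh2 * fnorm A `^ p| <= eps * (kh2 * fnorm A `^ p)]) /\
  (exists d1 d2 d3 d4 : R,
    [/\ [/\ 0 <= d1, 0 < d2, 0 < d3 & 0 < d4],
        (forall r A, - d1 <= wdens E r A <= d2 * (1 + fnorm A `^ p)),
        (* For p < 1 the right-hand side is infinite at A = 0, where the library
           sets 0 `^ (p - 1) = 0: that case is no constraint and is excluded. *)
        (forall r A, (1 <= p) || (A != 0) ->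
           fnorm (dmx (wdens E r) A) <= d3 * (1 + fnorm A `^ (p - 1))) &
        (forall r A, `|(fun r' => wdens E r' A)^`()%classic r| <=
           d4 * (1 + fnorm A `^ p))])].

Definition potential_assumptions (E : energy) (S : splitting) (p : R) : Prop :=
  C1 (psi E) /\
  exists c1 c2 l q : R,
    [/\ 0 < c1 /\ 0 <= c2,
        0 <= l < 6 + 8 / Num.max 2 (2 * p - 6) /\ 0 <= q < 4,
        (forall r, `|(psi E)^`()%classic r| <= c1 * (`|r| `^ l + 1)),
        (forall r, - c2 <= psi E r) &
        (forall r, derivable (psim S)^`()%classic r 1 /\
                   `|(psim S)^`(2)%classic r| <= c1 * (`|r| `^ q + 1))].

Section Scheme.
Variables (Omega : set pt) (Th : mesh R).
Variables (E : energy) (S : splitting) (b : R -> R) (nu gamma dt : R).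
Variables (phin : pt -> R) (Fn : pt -> mx).

Definition in_spaces (v : pt -> pt) (s : pt -> R) (F M : pt -> mx)
    (phi mu : pt -> R) : Prop :=
  [/\ Vh Omega Th v, Rh Omega Th s, Xh Omega Th F, Xh Omega Th M &
      Sh Omega Th phi /\ Sh Omega Th mu].

(* (v, s, F, M, phi, mu) are the unknowns at the new time level,
   (phin, Fn) the data at the old one. *)
Definition scheme_step (v : pt -> pt) (s : pt -> R) (F M : pt -> mx)
    (phi mu : pt -> R) : Prop :=
  in_spaces v s F M phi mu /\
  forall u p Theta Pi xi chi, in_spaces u p Theta Pi xi chi ->
  [/\ nu * \int3_(x in Omega) (ddot (gradv v x) (gradv u x))
        - \int3_(x in Omega) (s x * divv u x)
      = \int3_(x in Omega) (mu x * dotv (grad phin x) (u x))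
        - \int3_(x in Omega) (ddot (M x *m (Fn x)^T) (gradv u x))
        + \int3_(x in Omega) (dotv (odot Fn M x) (u x)),
      \int3_(x in Omega) (p x * divv v x) = 0,
      \int3_(x in Omega) (ddot (F x - Fn x) (Theta x))
        + dt * \int3_(x in Omega) (ddot (convect v Fn x) (Theta x))
        - dt * \int3_(x in Omega) (ddot (gradv v x *m Fn x) (Theta x))
        + dt * gamma * \int3_(x in Omega) (ddot (M x) (Theta x)) = 0,
      \int3_(x in Omega) (ddot (M x) (Pi x))
      = \int3_(x in Omega)
          (ddot (dmx (hp S) (F x) + dmx (hm S) (Fn x)) (Pi x))
        + \int3_(x in Omega) (pospart (ef E (phin x)) *
            ddot (dmx (gp S) (F x) + dmx (gm S) (Fn x)) (Pi x))
        + \int3_(x in Omega) ((ef E (phin x) - pospart (ef E (phin x))) *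
            ddot (dmx (gp S) (Fn x) + dmx (gm S) (F x)) (Pi x))
        + lambda E * \int3_(x in Omega) (ddotgrad F Pi x) &
      \int3_(x in Omega) ((phi x - phin x) * xi x)
        + dt * \int3_(x in Omega) (dotv (v x) (grad phin x) * xi x)
        + dt * \int3_(x in Omega)
            (b (phin x) * dotv (grad mu x) (grad xi x)) = 0
      /\
      \int3_(x in Omega) (mu x * chi x)
      = \int3_(x in Omega) (dotv (grad phi x) (grad chi x))
        + \int3_(x in Omega)
            (((psip S)^`()%classic (phi x) + (psim S)^`()%classic (phin x)) * chi x)
        + \int3_(x in Omega)
            (((fp S)^`()%classic (phi x) * eg E (F x)
              + (fm S)^`()%classic (phin x) * eg E (F x)) * chi x)].

End Scheme.

Section Norms.
Variable Omega : set pt.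

Definition sqnorm_mx (M : pt -> mx) : R := \int3_(x in Omega) (ddot (M x) (M x)).

Definition sqnorm_grad (u : pt -> R) : R :=
  \int3_(x in Omega) (dotv (grad u x) (grad u x)).

Definition sqnorm_gradv (v : pt -> pt) : R :=
  \int3_(x in Omega) (ddot (gradv v x) (gradv v x)).

Definition sqnorm_gradmx (F : pt -> mx) : R :=
  \int3_(x in Omega) (ddotgrad F F x).

Definition total_energy (E : energy) (phi : pt -> R) (F : pt -> mx) : R :=
  \int3_(x in Omega) (psi E (phi x) + eh E (F x) + ef E (phi x) * eg E (F x))
    + 1 / 2 * sqnorm_grad phi + lambda E / 2 * sqnorm_gradmx F.

End Norms.
End Model.

Arguments energy : clear implicits.
Arguments splitting : clear implicits.

(* Main.v *)
Require Import Defs.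
From HB Require Import structures.
From mathcomp Require Import all_boot all_order all_algebra zify.

Set Implicit Arguments.
Unset Strict Implicit.
Unset Printing Implicit Defensive.

Import Order.TTheory GRing.Theory Num.Theory.

(** In orthonormal bases of X_h x S_h (for the L^2 product) and of the discretely
    divergence-free velocities (for nu (grad, grad)), eliminating M, mu and v turns
    one step of the scheme into a finite system X = - dt G(X) A.  Here X is the
    increment of (F, phi), G(X) the coordinates of (M, mu), and A = B B^T + D is
    symmetric and positive semidefinite, B coming from the transport terms and D
    from the two dissipations.  The convex splitting bounds X . G(X) from below by
    an energy difference, hence by a constant, and Brouwer's theorem (from a cubical
    Sperner lemma) applied to a truncation of the system gives a solution.  The
    basis of velocities exists because a velocity with zero gradient is constant,
    and nonzero constants are not in H^1_0; the pressure is a Lagrange multiplier,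
    obtained by linear algebra.  Testing the scheme with (v, s, M, F - F^n, mu,
    phi - phi^n) makes the transport terms cancel, and the splitting inequality
    becomes the energy law, from which the bound follows by telescoping. *)

(** Finite element gradients exist only inside the cells, and [pd] takes uncontrolled values on the
    faces. Every integral over [Omega] is therefore replaced by one over [cells], an open set that
    differs from [Omega] by a null set and on which all integrands are continuous and bounded;
    integrability is then automatic. For the same reason discrete functions are only compared on
    [cells]: a basis expansion leaves a remainder that vanishes there, and every functional in play
    has to ignore such a remainder.

    No restriction on the time step arises. Positivity of A gives |zA|^2 <= c (zA . z), so X = - dt
    G A yields |X|^2 = dt^2 |GA|^2 <= - c dt (X . G) <= c dt C, where C depends on the old time
    level only. The truncation merely replaces dt by a smaller number, for which the same estimate
    holds, so it is never active.

    The term f(phi) g(F) is not a sum of a convex and a concave function. Its increment is written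
    as (f(phi) - f(phi^n)) g(F) + f(phi^n) (g(F) - g(F^n)); the first product uses the sign of g,
    the second the decomposition of f(phi^n) by sign, which explains the two stress terms of the
    scheme. *)

Local Open Scope ring_scope.

(** * A cubical Sperner lemma *)

Section CubicalSperner.
Variables (d n : nat).
Local Notation gridpt := {ffun 'I_d -> nat}.
Local Notation F2 := 'F_2.
Implicit Types (x y z : gridpt) (I J : {set 'I_d}) (i j : 'I_d).
Implicit Types (v w : {set 'I_d} -> F2) (f u : gridpt -> F2).
Implicit Types (fs gs : seq (gridpt -> F2)).

Definition corner x I : gridpt := [ffun j => (x j + (j \in I))%N].

Definition shift i x : gridpt := [ffun j => (x j + (j == i))%N].

(* A function of [I] is a cochain on the cube with lowest corner [x], and [top] is
   the fundamental cochain.  As [coboundary] commutes with each [dmul f] and squares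
   to zero, the sum over the grid of [dmuls fs x top set0] depends on the labels [fs]
   only through their values on the boundary. *)
Definition coboundary v I : F2 := \sum_(i | i \notin I) v (i |: I).

Definition mulf f x v I : F2 := f (corner x I) * v I.

Definition dmul f x v I : F2 :=
  \sum_(i | i \notin I) (f (corner x (i |: I)) + f (corner x I)) * v (i |: I).

(** At [top] and [set0], for a list of d labels, this is a sum over the monotone lattice paths from
    [x] to the opposite corner of its cube: each path contributes the product of the increments of
    the successive labels along its successive edges. *)
Definition dmuls fs x v := foldr (fun f => dmul f x) v fs.

Definition top I : F2 := (I == setT)%:R.

Lemma addF2 (a : F2) : a + a = 0.
Proof. by case: a => [[|[|]]] // ?; exact: val_inj. Qed.

Lemma sum_sym_F2 (b : 'I_d -> 'I_d -> F2) :
  (forall i j, b i j = b j i) -> (forall i, b i i = 0) ->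
  \sum_i \sum_j b i j = 0.
Proof.
move=> bC b0.
have -> : \sum_i \sum_j b i j =
   \sum_(i : 'I_d) \sum_(j : 'I_d | (i < j)%N) b i j +
   \sum_(i : 'I_d) \sum_(j : 'I_d | (j < i)%N) b i j.
  rewrite -big_split; apply: eq_bigr => i _ /=.
  rewrite (bigD1 i) //= b0 add0r (bigID (fun j : 'I_d => (i < j)%N)) /=.
  congr (_ + _); apply: eq_bigl => j; rewrite -val_eqE /=; lia.
rewrite [X in _ + X](exchange_big_dep predT) //=.
rewrite -big_split big1 // => i _; rewrite -big_split big1 // => j _ /=.
by rewrite bC addF2.
Qed.

Lemma coboundaryK v I : coboundary (coboundary v) I = 0.
Proof.
rewrite /coboundary -[RHS](@sum_sym_F2 (fun i j =>
  if [&& i \notin I, j \notin I & i != j] then v (i |: (j |: I)) else 0)).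
- rewrite big_mkcond; apply: eq_bigr => i _; case: ifP => iI; last by rewrite big1.
  rewrite big_mkcond; apply: eq_bigr => j _.
  by rewrite in_setU1 negb_or [j == i]eq_sym andbC setUCA.
- by move=> i j; rewrite [i == j]eq_sym setUCA andbCA.
- by move=> i; rewrite eqxx !andbF.
Qed.

(** So [dmul f] is the commutator of [coboundary] with multiplication by [f], signs being invisible
    modulo 2. Commutation with [coboundary] follows from [coboundaryK]. *)
Lemma dmulE f x v I :
  dmul f x v I = coboundary (mulf f x v) I + mulf f x (coboundary v) I.
Proof.
rewrite /dmul /mulf /coboundary mulr_sumr -big_split; apply: eq_bigr => i _.
by rewrite mulrDl.
Qed.

Lemma eq_coboundary v w : v =1 w -> coboundary v =1 coboundary w.
Proof. by move=> vw I; apply: eq_bigr => i _; rewrite vw. Qed.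

Lemma eq_dmul f x v w : v =1 w -> dmul f x v =1 dmul f x w.
Proof. by move=> vw I; apply: eq_bigr => i _; rewrite vw. Qed.

Lemma eq_dmuls fs x v w : v =1 w -> dmuls fs x v =1 dmuls fs x w.
Proof. by move=> vw; elim: fs => //= f fs IH; exact: eq_dmul. Qed.

Lemma coboundaryD v w I :
  coboundary (fun J => v J + w J) I = coboundary v I + coboundary w I.
Proof. by rewrite /coboundary big_split. Qed.

Lemma dmulsD fs x v w :
  dmuls fs x (fun J => v J + w J) =1 (fun J => dmuls fs x v J + dmuls fs x w J).
Proof.
elim: fs => //= f fs IH I; rewrite (eq_dmul _ _ IH) /dmul -big_split /=.
by apply: eq_bigr => i _; rewrite mulrDr.
Qed.

Lemma dmuls0 fs x v : v =1 (fun=> 0) -> dmuls fs x v =1 (fun=> 0).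
Proof.
move=> v0; elim: fs => //= f fs IH I; rewrite /dmul big1 // => i _.
by rewrite IH mulr0.
Qed.

Lemma coboundary_dmul f x v : coboundary (dmul f x v) =1 dmul f x (coboundary v).
Proof.
move=> I; rewrite (eq_coboundary (dmulE f x v)) coboundaryD coboundaryK add0r.
by rewrite dmulE /mulf coboundaryK mulr0 addr0.
Qed.

Lemma coboundary_dmuls fs x v :
  coboundary (dmuls fs x v) =1 dmuls fs x (coboundary v).
Proof.
elim: fs => //= f fs IH I.
by rewrite coboundary_dmul; apply: eq_dmul.
Qed.

Lemma dmuls_cat fs gs x v : dmuls (fs ++ gs) x v = dmuls fs x (dmuls gs x v).
Proof. exact: foldr_cat. Qed.

(** The fundamental cochain of the near facet orthogonal to direction [i]: its paths never step in
    that direction. *)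
Definition facet_top i I : F2 := (I == ~: [set i])%:R.

Lemma coboundary_top : coboundary top =1 (fun I => \sum_i facet_top i I).
Proof.
move=> I; rewrite /coboundary /top /facet_top big_mkcond /=; apply: eq_bigr => i _.
case: ifPn => iI.
  congr ((nat_of_bool _)%:R); apply/eqP/eqP => [iIT|->]; last by rewrite setUCr.
  apply/setP => j; rewrite !inE; have := in_setT j; rewrite -iIT !inE.
  by case: eqVneq => [->|_] //= _; rewrite (negbTE iI).
by rewrite negbK in iI; case: eqP => // IE; move: iI; rewrite IE !inE eqxx.
Qed.

Lemma dmuls_sum fs x (vs : 'I_d -> {set 'I_d} -> F2) :
  dmuls fs x (fun I => \sum_i vs i I) =1 (fun I => \sum_i dmuls fs x (vs i) I).
Proof.
elim: fs => //= f fs IH I; rewrite (eq_dmul _ _ IH) /dmul exchange_big /=.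
by apply: eq_bigr => i _; rewrite mulr_sumr.
Qed.

Definition middle fs u gs x v := dmuls fs x (mulf u x (dmuls gs x v)).

(** A discrete Stokes formula on one cube. The factor [u] is expanded as a commutator and the
    coboundary is pushed outwards in one term and inwards in the other; in each direction [i] this
    leaves a far facet and a near facet. *)
Lemma dmuls_middle fs u gs x :
  dmuls (fs ++ u :: gs) x top set0 =
  \sum_i (middle fs u gs x top (i |: set0) + middle fs u gs x (facet_top i) set0).
Proof.
rewrite dmuls_cat /= (eq_dmuls _ _ (dmulE _ _ _)) dmulsD big_split; congr (_ + _).
  by rewrite -coboundary_dmuls /coboundary; apply: eq_bigl => i; rewrite inE.
have E : mulf u x (coboundary (dmuls gs x top)) =1
    (fun I => \sum_i mulf u x (dmuls gs x (facet_top i)) I).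
  move=> I; rewrite /mulf coboundary_dmuls (eq_dmuls _ _ coboundary_top).
  by rewrite dmuls_sum mulr_sumr.
by rewrite (eq_dmuls _ _ E) dmuls_sum.
Qed.

Lemma corner_shift i x I : i \notin I -> corner x (i |: I) = corner (shift i x) I.
Proof.
move=> iI; apply/ffunP => j; rewrite !ffunE in_setU1.
case: eqVneq => [->|_] /=; first by rewrite (negbTE iI) addn0.
by rewrite addn0.
Qed.

(** Restriction to the far facet in direction [i], reread as a cochain on the near facet of the
    neighbouring cube. It identifies the contributions of a facet to the two cubes that share it. *)
Definition facet_of i v w :=
  forall I, if i \in I then w I = 0 else v (i |: I) = w I.

Lemma facet_dmul i f x v w :
  facet_of i v w -> facet_of i (dmul f x v) (dmul f (shift i x) w).
Proof.
move=> vw I; case: ifPn => iI.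
  by rewrite /dmul big1 // => j jI; have := vw (j |: I); rewrite in_setU1 iI orbT => ->; rewrite mulr0.
rewrite /dmul [RHS](bigD1 i) //=.
have := vw (i |: I); rewrite setU11 => ->; rewrite mulr0 add0r.
apply: eq_big => [j|j]; rewrite in_setU1 negb_or andbC // => /andP[jI ji].
have iJ : i \notin j |: I by rewrite in_setU1 negb_or iI andbT eq_sym.
have := vw (j |: I); rewrite (negbTE iJ) => <-.
by rewrite [j |: (i |: I)]setUCA -!corner_shift.
Qed.

Lemma facet_dmuls i fs x v w :
  facet_of i v w -> facet_of i (dmuls fs x v) (dmuls fs (shift i x) w).
Proof. by move=> vw; elim: fs => //= f fs IH; apply: facet_dmul. Qed.

Lemma facet_middle i fs u gs x v w :
  facet_of i v w -> facet_of i (middle fs u gs x v) (middle fs u gs (shift i x) w).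
Proof.
move=> vw; apply: facet_dmuls => I.
have := facet_dmuls gs x vw I; rewrite /mulf; case: ifPn => iI; first by move->; rewrite mulr0.
by move=> ->; rewrite corner_shift.
Qed.

Lemma facet_topP i : facet_of i top (facet_top i).
Proof.
move=> I; rewrite /top /facet_top; case: ifPn => iI.
  by case: eqP => // E; move: iI; rewrite E !inE eqxx.
congr ((nat_of_bool _)%:R); apply/eqP/eqP => [E|->]; last by rewrite setUCr.
apply/setP => j; have := in_setT j; rewrite -E !inE.
by case: eqVneq => [->|] //=; rewrite (negbTE iI).
Qed.

Definition flat f i (a : nat) := forall y z, y i = a -> z i = a -> f y = f z.

Definition null_on i w := forall I, i \in I -> w I = 0.

Lemma null_dmul i f x w : null_on i w -> null_on i (dmul f x w).
Proof.
move=> w0 I iI; rewrite /dmul big1 // => j jI.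
by rewrite w0 ?mulr0 // in_setU1 iI orbT.
Qed.

Lemma null_dmuls i fs x w : null_on i w -> null_on i (dmuls fs x w).
Proof. by move=> w0; elim: fs => //= f fs IH; apply: null_dmul. Qed.

Lemma dmul_flat i f x w : flat f i (x i) -> null_on i w -> dmul f x w =1 (fun=> 0).
Proof.
move=> ff w0 I; have [iI|iI] := boolP (i \in I); first exact: (null_dmul _ _ w0).
rewrite /dmul big1 // => j jI; have [<-|ji] := eqVneq i j.
  by rewrite w0 ?mulr0 // setU11.
rewrite (ff _ (corner x I)) ?addF2 ?mul0r // ffunE ?in_setU1 ?(negbTE ji) (negbTE iI) /=; exact: addn0.
Qed.

Lemma dmuls_flat i f fs x w :
  List.In f fs -> flat f i (x i) -> null_on i w -> dmuls fs x w =1 (fun=> 0).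
Proof.
move=> + ff w0; elim: fs => //= g fs IH [->|/IH{}IH].
  by apply: dmul_flat ff _; apply: null_dmuls.
by apply: (@dmuls0 [:: g]).
Qed.

(** Either [u] vanishes at all corners met inside the facet, or some differentiated label has no
    increment along it. *)
Lemma middle_face i fs u gs x :
  (forall y, y i = x i -> u y = 0) \/
    (exists2 f, List.In f (fs ++ gs) & flat f i (x i)) ->
  middle fs u gs x (facet_top i) set0 = 0.
Proof.
have t0 : null_on i (facet_top i).
  by move=> I iI; have := facet_topP i I; rewrite iI.
have mg : null_on i (mulf u x (dmuls gs x (facet_top i))).
  by move=> I iI; rewrite /mulf (null_dmuls _ _ t0) ?mulr0.
case=> [u0|[f /List.in_app_iff[] fI ff]]; rewrite /middle.
- apply: dmuls0 => I; rewrite /mulf; have [iI|iI] := boolP (i \in I).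
    by rewrite (null_dmuls _ _ t0) ?mulr0.
  by rewrite u0 ?mul0r // ffunE (negbTE iI) addn0.
- exact: dmuls_flat fI ff mg _.
- apply: dmuls0 => I; rewrite /mulf (dmuls_flat fI ff) ?mulr0 //.
Qed.

Definition natpt (x : {ffun 'I_d -> 'I_n.+1}) : gridpt := [ffun j => nat_of_ord (x j)].

(** The lowest corners range over 0..n while the facets orthogonal to [i] range over 0..n+1; the two
    extreme layers are those removed by the hypotheses. *)
Lemma sum_shift i (A : gridpt -> F2) :
  (forall y, y i = 0%N -> A y = 0) -> (forall y, y i = n.+1 -> A y = 0) ->
  \sum_x A (shift i (natpt x)) = \sum_x A (natpt x).
Proof.
move=> A0 A1.
rewrite (bigID (fun x : {ffun 'I_d -> 'I_n.+1} => (x i < n)%N)) /= addrC big1 ?add0r; last first.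
  move=> x; rewrite -leqNgt => xi; apply: A1; rewrite !ffunE eqxx addn1; congr _.+1.
  by apply/eqP; rewrite eqn_leq xi -ltnS ltn_ord.
rewrite [RHS](bigID (fun x : {ffun 'I_d -> 'I_n.+1} => (0 < x i)%N)) /=.
rewrite [X in _ = _ + X]big1 ?addr0; last first.
  by move=> x; rewrite -leqNgt leqn0 => /eqP xi; apply: A0; rewrite !ffunE.
pose up (x : {ffun 'I_d -> 'I_n.+1}) : {ffun 'I_d -> 'I_n.+1} :=
  [ffun j => inord (x j + (j == i))].
pose dn (x : {ffun 'I_d -> 'I_n.+1}) : {ffun 'I_d -> 'I_n.+1} :=
  [ffun j => inord (x j - (j == i))].
rewrite [RHS](reindex_onto up dn); last first.
  move=> x xi; apply/ffunP => j; rewrite !ffunE; apply: val_inj => /=.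
  have xn := ltn_ord (x j).
  case: (eqVneq j i) => [ji|_] /=; last by rewrite subn0 addn0 !inordK.
  by rewrite -ji in xi; move: (nat_of_ord (x j)) xn xi => k kn k0; rewrite inordK inordK; lia.
apply: eq_big => [x|x xi].
  rewrite !ffunE eqxx; apply/idP/andP => [xi|[+ _]].
    split; first by rewrite inordK //=; lia.
    apply/eqP/ffunP => j; rewrite !ffunE; apply: val_inj => /=.
    have xn := ltn_ord (x j).
    case: (eqVneq j i) => [ji|_] /=; last by rewrite subn0 addn0 !inordK.
    by rewrite -ji in xi; move: (nat_of_ord (x j)) xn xi => k kn k0; rewrite inordK inordK; lia.
  have xn := ltn_ord (x i); have [//|nx] := ltnP (x i) n.
  by rewrite /inord /insubd insubN //= addn1 ltnS -leqNgt.
congr A; apply/ffunP => j; rewrite !ffunE.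
have xn := ltn_ord (x j); case: (eqVneq j i) => [ji|_] /=.
  by rewrite -ji in xi; move: (nat_of_ord (x j)) xn xi => k kn k0; rewrite inordK //; lia.
by rewrite addn0 inordK.
Qed.

(** An interior facet belongs to two cubes, so its contributions cancel modulo 2. The facets on the
    boundary of the grid vanish by [middle_face]. *)
Lemma sum_dmuls_face fs u gs :
  (forall i a, a = 0%N \/ a = n.+1 ->
    (forall y, y i = a -> u y = 0) \/
    (exists2 f, List.In f (fs ++ gs) & flat f i a)) ->
  \sum_x dmuls (fs ++ u :: gs) (natpt x) top set0 = 0.
Proof.
move=> H; under eq_bigr do rewrite dmuls_middle.
rewrite exchange_big big1 // => i _; rewrite big_split /=.
pose A y := middle fs u gs y (facet_top i) set0.
have -> : \sum_x middle fs u gs (natpt x) top (i |: set0) = \sum_x A (shift i (natpt x)).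
  apply: eq_bigr => x _; have := facet_middle fs u gs (natpt x) (@facet_topP i) set0.
  by rewrite inE.
rewrite sum_shift ?addF2 // => y yi; apply: middle_face; rewrite yi; apply: H; by [left|right].
Qed.

(** Additivity in each label, arranged for exchanging [s] for [t]: modulo 2 the error is the same
    expression with the label [s + t]. *)
Lemma dmuls_replace fs s t gs x v I :
  dmuls (fs ++ s :: gs) x v I =
  dmuls (fs ++ t :: gs) x v I + dmuls (fs ++ (fun y => s y + t y) :: gs) x v I.
Proof.
rewrite !dmuls_cat -dmulsD; apply: eq_dmuls => J /=.
rewrite /dmul -big_split; apply: eq_bigr => i _ /=; rewrite -mulrDl; congr (_ * _).
by rewrite [RHS]addrC [X in _ = X + _]addrACA -[RHS]addrA addF2 addr0.
Qed.

(** A reference labelling with the required boundary values that jumps only next to the face at 0,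
    so that its sum over the grid can be computed: only the cube at the origin contributes. *)
Definition step_fun i y : F2 := (0 < y i)%:R.

Lemma dmul_step i x v I :
  dmul (step_fun i) x v I = if (i \notin I) && (x i == 0%N) then v (i |: I) else 0.
Proof.
have [iI|iI] := boolP (i \in I); rewrite /= /dmul.
  rewrite big1 // => j jI; suff -> : step_fun i (corner x (j |: I)) = step_fun i (corner x I).
    by rewrite addF2 mul0r.
  by rewrite /step_fun !ffunE in_setU1 iI orbT.
rewrite (bigD1 i) //= big1 ?addr0 => [|j /andP[jI ji]].
  rewrite /step_fun !ffunE setU11 (negbTE iI) addn1 addn0 /=; case: (x i) => [|k] /=.
    by rewrite addr0 mul1r.
  by rewrite addF2 mul0r.
suff -> : step_fun i (corner x (j |: I)) = step_fun i (corner x I) by rewrite addF2 mul0r.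
by rewrite /step_fun !ffunE in_setU1 eq_sym (negbTE ji).
Qed.

Lemma dmuls_step (l : seq 'I_d) x I : uniq l -> (forall i, (i \in l) = (i \notin I)) ->
  dmuls (map step_fun l) x top I = (all (fun i => x i == 0%N) l)%:R.
Proof.
elim: l I => [|i l IH] I /=.
  move=> _ H; rewrite /top; suff -> : I = setT by rewrite eqxx.
  by apply/setP => j; rewrite inE; apply/negPn; rewrite -H.
move=> /andP[il ul] H; rewrite dmul_step -H inE eqxx /=.
case: ifP => //= _; apply: IH => // j; rewrite in_setU1 negb_or -H inE.
by case: eqVneq => [->|_] //=; rewrite ?(negbTE il) ?andbT.
Qed.

Lemma sum_step : \sum_x dmuls (map step_fun (enum 'I_d)) (natpt x) top set0 = 1.
Proof.
under eq_bigr => x _.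
  rewrite dmuls_step ?enum_uniq //; last by move=> i; rewrite mem_enum !inE.
  over.
rewrite (bigD1 [ffun=> ord0]) //= big1 => [|x].
  rewrite addr0; suff -> : all (fun i => natpt [ffun=> ord0] i == 0%N) (enum 'I_d) by [].
  by apply/allP => i _; rewrite !ffunE.
move=> x0; suff /negbTE -> : ~~ all (fun i => natpt x i == 0%N) (enum 'I_d) by [].
apply: contra x0 => /allP H; apply/eqP/ffunP => j; apply: val_inj; rewrite !ffunE /=.
by have := H j; rewrite mem_enum => /(_ isT); rewrite ffunE => /eqP.
Qed.

Section Labels.
Variable s : 'I_d -> gridpt -> F2.
Hypothesis s0 : forall i y, y i = 0%N -> s i y = 0.
Hypothesis s1 : forall i y, y i = n.+1 -> s i y = 1.

(** The labels are exchanged one at a time for the step functions. The error label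
    [step_fun j + s j] vanishes on the two faces orthogonal to [j], and every other label is
    constant on the two faces orthogonal to its own direction, so [sum_dmuls_face] discards the
    error. *)
Lemma sum_labels : \sum_x dmuls (map s (enum 'I_d)) (natpt x) top set0 = 1.
Proof.
pose e := enum 'I_d.
suff H k : (k <= size e)%N ->
   \sum_x dmuls (map step_fun (take k e) ++ map s (drop k e)) (natpt x) top set0 = 1.
  by have := H 0%N isT; rewrite take0 drop0.
(* Downward induction on [k]: at [k = size e] only step functions are left, at [k = 0] only the
   labels. *)
move=> kd; rewrite -(subKn kd); elim: (size e - k)%N (leq_subr k (size e)) => {k kd} [|k IH] kd.
  by rewrite subn0 take_size drop_size cats0 sum_step.
rewrite -(IH (ltnW kd)); set m := (size e - k.+1)%N.
have mE : (size e - k)%N = m.+1 by rewrite /m; lia.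
have me : (m < size e)%N by rewrite /m; lia.
have [i0 _] : exists i : 'I_d, True by move: me; rewrite size_enum_ord => me; exists (Ordinal me).
rewrite mE (drop_nth i0 me) (take_nth i0 me) map_rcons cat_rcons /=.
set j := nth i0 e m.
under eq_bigr do rewrite (dmuls_replace _ _ (step_fun j)).
rewrite big_split /= [X in _ + X]sum_dmuls_face ?addr0 // => i a aE.
have [->|ij] := eqVneq i j.
  left=> y yj; case: aE yj => -> yj; first by rewrite s0 // /step_fun yj addr0.
  by rewrite s1 // /step_fun yj addF2.
right; have : i \in e by rewrite mem_enum.
rewrite -{1}(cat_take_drop m e) mem_cat (drop_nth i0 me) inE -/j (negbTE ij) /=.
have InI (T : eqType) (z : T) l : z \in l -> List.In z l.
  by elim: l => //= b l IHl; rewrite inE => /orP[/eqP->|/IHl]; [left|right].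
case/orP => /InI iI.
- exists (step_fun i); first by apply/List.in_app_iff; left; apply: List.in_map.
  by move=> y z yi zi; rewrite /step_fun yi zi.
- exists (s i); first by apply/List.in_app_iff; right; apply: List.in_map.
  by case: aE => -> y z yi zi; rewrite ?(s0 yi) ?(s0 zi) ?(s1 yi) ?(s1 zi).
Qed.

(** The sum is odd, so some cube contributes. A label constant on the corners of that cube would
    make its factor [dmul] zero. *)
Lemma cubical_sperner : exists x : {ffun 'I_d -> 'I_n.+1},
  forall i, exists I J, s i (corner (natpt x) I) != s i (corner (natpt x) J).
Proof.
have [x Hx] : exists x : {ffun 'I_d -> 'I_n.+1}, dmuls (map s (enum 'I_d)) (natpt x) top set0 != 0.
  apply/existsP; apply: contraT => /existsPn H; have := sum_labels.
  rewrite big1 => [/eqP|x _]; first by rewrite eq_sym oner_eq0.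
  by have := H x; rewrite negbK => /eqP.
exists x => // i.
have [/existsP[I /existsP[J]]|H] := boolP [exists I, exists J, s i (corner (natpt x) I) != s i (corner (natpt x) J)].
  by exists I, J.
have ff I J : s i (corner (natpt x) I) = s i (corner (natpt x) J).
  by move: H => /existsPn/(_ I)/existsPn/(_ J); rewrite negbK => /eqP.
have i_in : i \in enum 'I_d by rewrite mem_enum.
suff E : dmuls (map s (enum 'I_d)) (natpt x) top =1 (fun=> 0) by rewrite E eqxx in Hx.
elim: (enum _) i_in => //= j l IH; rewrite inE => /orP[/eqP<-|/IH H'].
  by move=> I; rewrite /dmul big1 // => k _; rewrite (ff _ I) addF2 mul0r.
exact: (@dmuls0 [:: s j]).
Qed.

End Labels.
End CubicalSperner.

From mathcomp Require Import all_classical all_reals all_analysis.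
From mathcomp Require Import interval_inference measurable_realfun ring lra.
From mathcomp Require Import -(notations) mpoly.

Import Order.TTheory GRing.Theory Num.Theory.
Import numFieldNormedType.Exports.

Local Open Scope classical_set_scope.
Local Open Scope ring_scope.

(** * Brouwer's theorem and a solvability criterion *)

Section Brouwer.
Variables (R : realType) (d : nat).
Local Notation vec := 'rV[R]_d.

(** The label [j] records whether [K] decreases the coordinate [j]. Sperner gives arbitrarily small
    cubes on which every coordinate of [K z - z] fails to keep a strict sign, whereas without a
    fixed point compactness yields a scale at which some coordinate keeps it. *)
Lemma brouwer_bounded (K : vec -> vec) (r : R) :
  continuous K -> (forall x j, `|K x 0 j| <= r) -> exists x, K x = x.
Proof.
move=> Kc Kr; apply: contrapT => nofix.
(* Strictly above [r], so that [K] points inwards on the faces of the cube of half-side [a] and the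
   labels there are forced. *)
pose a := `|r| + 1.
have a0 : 0 < a by rewrite ltr_wpDl.
have ra : r < a by rewrite (le_lt_trans (ler_norm r)) // ltrDl.
pose Q := [set y : vec | forall j, `[-a, a]%classic (y 0 j)].
have cQ : compact Q by apply: (@rV_compact _ _ (fun=> `[-a, a]%classic)) => _; exact: segment_compact.
(* The radius exceeds the grid spacing [2 * a / n.+1], so the ball around the lowest corner of a
   grid cube contains all its corners. *)
pose P (n : nat) (y : vec) := exists j,
  (forall z, ball y (3 * a / n.+1%:R) z -> K z 0 j < z 0 j) \/
  (forall z, ball y (3 * a / n.+1%:R) z -> z 0 j < K z 0 j).
have Kjc j : continuous (fun z : vec => K z 0 j - z 0 j).
  move=> z; apply: (@continuousB R R^o vec (fun z : vec => K z 0 j) (fun z : vec => z 0 j)).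
    exact: (@continuous_comp _ _ _ K (fun M : vec => M 0 j) z (Kc z) (@coord_continuous _ _ _ _ _ _)).
  exact: coord_continuous.
have smalln (e : R) : 0 < e -> \forall n \near \oo, 3 * a / n.+1%:R < e.
  move=> e0; near=> n; rewrite ltr_pdivrMr ?ltr0n // -ltr_pdivrMl // .
  rewrite mulrC; apply: lt_trans (_ : n%:R < _); last by rewrite ltr_nat.
  near: n; exact: nbhs_infty_gtr.
(* A single [n] serves all points of [Q]: the local statement is uniform in a neighbourhood of each
   point and [Q] is compact. *)
have [n _ /(_ n (leqnn n))] : \forall n \near \oo, Q `<=` P n.
  apply: (iffLR (compact_near_coveringP Q)) => // y Qy.
  have [j Kj] : exists j, K y 0 j != y 0 j.
    apply: contrapT => H; apply: nofix; exists y; apply/rowP => j.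
    by apply/eqP; apply: contrapT => /negP Kj; apply: H; exists j.
  have loc (B : set R) : open B -> B (K y 0 j - y 0 j) ->
      \forall y' \near y & n \near \oo, forall z, ball y' (3 * a / n.+1%:R) z -> B (K z 0 j - z 0 j).
    move=> oB By; have /nbhs_ballP[e /= e0 He] : nbhs y [set z | B (K z 0 j - z 0 j)].
      by apply: Kjc; exact: open_nbhs_nbhs.
    exists (ball y (e / 2), [set n | 3 * a / n.+1%:R < e / 2]) => /=.
      by split; [apply: nbhsx_ballx; rewrite divr_gt0|apply: smalln; rewrite divr_gt0].
    move=> [y' n] [/= yy' ne] z y'z; apply: He; rewrite [e]splitr.
    by apply: ball_triangle yy' _; apply: le_ball y'z; exact: ltW.
  case: (ltgtP (K y 0 j) (y 0 j)) Kj => // Kj _.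
    have := loc [set t | t < 0] (@open_lt _ _) ; rewrite /= subr_lt0 => /(_ Kj).
    apply: filterS => -[y' n] /= H; exists j; left => z /H; by rewrite subr_lt0.
  have := loc [set t | t > 0] (@open_gt _ _) ; rewrite /= subr_gt0 => /(_ Kj).
  apply: filterS => -[y' n] /= H; exists j; right => z /H; by rewrite subr_gt0.
move=> QP.
pose Y (p : {ffun 'I_d -> nat}) : vec := \row_j (- a + 2 * a * (p j)%:R / n.+1%:R).
pose s j (p : {ffun 'I_d -> nat}) : 'F_2 := (K (Y p) 0 j < Y p 0 j)%R%:R.
have s0 j (p : {ffun 'I_d -> nat}) : p j = 0%N -> s j p = 0.
  move=> pj; rewrite /s [in X in (_ < X)]mxE pj mulr0 mul0r addr0.
  have := Kr (Y p) j; rewrite ler_norml => /andP[H _].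
  suff -> : (K (Y p) 0 j < - a) = false by [].
  apply/negbTE; rewrite -leNgt; lra.
have s1 j (p : {ffun 'I_d -> nat}) : p j = n.+1 -> s j p = 1.
  move=> pj; rewrite /s [in X in (_ < X)]mxE pj mulfK ?pnatr_eq0 //.
  have := Kr (Y p) j; rewrite ler_norml => /andP[_ H].
  suff -> : (K (Y p) 0 j < - a + 2 * a) = true by [].
  lra.
have [x Hx] := cubical_sperner s0 s1.
have n0 : (0 : R) < n.+1%:R by rewrite ltr0n.
have [|j Hj] := QP (Y (natpt x)).
  move=> j /=; rewrite in_itv /= mxE ffunE; have := ltn_ord (x j); rewrite -(ler_nat R) => xn.
  have x0 : 0 <= 2 * a * (x j)%:R / n.+1%:R by rewrite divr_ge0 ?mulr_ge0 // ltW.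
  have {}xn : (x j)%:R <= n.+1%:R :> R by apply: le_trans xn; rewrite ler_nat.
  rewrite lerDl x0 /= -lerBrDl opprK ler_pdivrMr //.
  by rewrite -mulr2n -(mulr_natl a) ler_pM2l // mulr_gt0.
have near_corner I : ball (Y (natpt x)) (3 * a / n.+1%:R) (Y (corner (natpt x) I)).
  split; first by rewrite divr_gt0 ?mulr_gt0.
  move=> i k; rewrite ord1 !mxE /ball /= !ffunE natrD.
  have -> : - a + 2 * a * (x k)%:R / n.+1%:R - (- a + 2 * a * ((x k)%:R + (k \in I)%:R) / n.+1%:R) =
    - (2 * a * (k \in I)%:R / n.+1%:R).
    by move: (n.+1%:R : R) n0 => m /lt0r_neq0 m0; field.
  rewrite normrN ger0_norm; last by rewrite divr_ge0 ?mulr_ge0 ?ler0n // ltW.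
  rewrite (@ltr_pM2r _ n.+1%:R^-1) ?invr_gt0 //.
  by case: (k \in I); rewrite ?mulr1 ?mulr0; lra.
have [I [J]] := Hx j; rewrite /s.
case: Hj => Hj.
  by rewrite !Hj ?eqxx.
by rewrite !ltNge !ltW ?eqxx //; apply: Hj.
Unshelve. all: by end_near. Qed.

End Brouwer.

Section MatrixLimits.
Variable R : realType.

Lemma cvg_mx (T : Type) (F : set_system T) (m n : nat) (f : T -> 'M[R]_(m, n)) (l : 'M[R]_(m, n)) :
  Filter F -> (forall i j, f x i j @[x --> F] --> l i j) -> f @ F --> l.
Proof.
move=> FF H; apply/cvg_ballP => e e0.
have : \forall x \near F, forall i, forall j, ball (l i j) e (f x i j).
  apply: filter_forall => i; apply: filter_forall => j.
  exact: (cvg_ball (H i j) e0).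
by apply: filterS => x Hx; split.
Qed.

Lemma eq_continuous_at (T U : topologicalType) (f g : T -> U) x :
  f =1 g -> continuous_at x f -> continuous_at x g.
Proof. by move=> /funext ->. Qed.

Lemma continuous_at_cst (T U : topologicalType) (a : U) (x : T) :
  continuous_at x (fun=> a).
Proof. exact: cst_continuous. Qed.

Lemma continuous_at_comp (T U V : topologicalType) (f : T -> U) (g : U -> V) x :
  continuous_at x f -> continuous_at (f x) g -> continuous_at x (fun y => g (f y)).
Proof. by move=> fx gfx; exact: (continuous_comp fx gfx). Qed.

Lemma continuous_at_mx (T : topologicalType) (m n : nat) (f : T -> 'M[R]_(m, n)) x :
  (forall i j, continuous_at x (fun y => f y i j)) -> continuous_at x f.
Proof. by move=> H; apply: cvg_mx => i j; exact: H. Qed.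

Lemma continuous_at_coord (T : topologicalType) (m n : nat) (f : T -> 'M[R]_(m, n)) i j x :
  continuous_at x f -> continuous_at x (fun y => f y i j).
Proof.
move=> H; exact: (@continuous_comp _ _ _ f (fun M : 'M[R]_(m, n) => M i j) x H (@coord_continuous _ _ _ _ _ _)).
Qed.

Lemma continuous_atD (T : topologicalType) (f g : T -> R) x :
  continuous_at x f -> continuous_at x g -> continuous_at x (fun y => f y + g y).
Proof. exact: (@continuousD R R^o). Qed.

Lemma continuous_atM (T : topologicalType) (f g : T -> R) x :
  continuous_at x f -> continuous_at x g -> continuous_at x (fun y => f y * g y).
Proof. exact: continuousM. Qed.

Lemma continuous_at_sum (T : topologicalType) (I : Type) (r : seq I) (P : pred I) (f : I -> T -> R) x :
  (forall i, P i -> continuous_at x (f i)) ->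
  continuous_at x (fun y => \sum_(i <- r | P i) f i y).
Proof.
move=> H; elim: r => [|i r IH].
  apply: (@eq_continuous_at _ _ (fun=> 0)); last exact: continuous_at_cst.
  by move=> y; rewrite big_nil.
apply: (@eq_continuous_at _ _ (fun y => if P i then f i y + \sum_(j <- r | P j) f j y
    else \sum_(j <- r | P j) f j y)); first by move=> y; rewrite big_cons.
by case: (P i) (H i) => // Hi; apply: continuous_atD => //; exact: Hi.
Qed.

Lemma continuous_at_max (T : topologicalType) (f g : T -> R) x :
  continuous_at x f -> continuous_at x g ->
  continuous_at x (fun y => Num.max (f y) (g y)).
Proof.
move=> fc gc.
apply: (@eq_continuous_at _ _ (fun y => (f y + g y + `|f y - g y|) / 2)).
  by move=> y; rewrite maxr_absE.
apply: continuous_atM; last exact: continuous_at_cst.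
apply: continuous_atD; first exact: continuous_atD.
apply: (@continuous_comp _ _ _ (fun y => f y - g y) Num.norm); first exact: (@continuousB R R^o).
exact: (@norm_continuous R R^o).
Qed.

End MatrixLimits.

(** * Solvability of X = - tau G(X) A for a positive semidefinite A *)

Section GradientSystem.
Variables (R : realType) (d : nat).
Local Notation vec := 'rV[R]_d.

Definition dot (u v : vec) : R := \sum_i u 0 i * v 0 i.

Lemma dotZl a u v : dot (a *: u) v = a * dot u v.
Proof. by rewrite mulr_sumr; apply: eq_bigr => i _; rewrite mxE mulrA. Qed.

Lemma dotC u v : dot u v = dot v u.
Proof. by apply: eq_bigr => i _; rewrite mulrC. Qed.

Lemma dotZr a u v : dot u (a *: v) = a * dot u v.
Proof. by rewrite dotC dotZl dotC. Qed.

Lemma dot_ge0 u : 0 <= dot u u.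
Proof. by apply: sumr_ge0 => i _; rewrite -expr2 sqr_ge0. Qed.

Lemma coord_le_dot (u : vec) i : `|u 0 i| <= Num.sqrt (dot u u).
Proof.
rewrite -[`|_|]sqrtr_sqr ler_wsqrtr //.
rewrite /dot (bigD1 i) //= -expr2 lerDl.
by apply: sumr_ge0 => j _; rewrite -expr2 sqr_ge0.
Qed.

Lemma dot_continuous : continuous (fun u : vec => dot u u).
Proof.
move=> u; apply: continuous_at_sum => i _.
by apply: continuous_atM; exact: coord_continuous.
Qed.

(* Truncating [x |-> - tau G(x) A] to a ball and applying Brouwer, the fixed
   point is a solution for some smaller [tau]; the hypotheses bound it by less
   than the radius of the ball. *)
Lemma gradient_system_solvable (A : 'M[R]_d) (G : vec -> vec) (tau c C : R) :
  0 <= tau -> 0 <= c -> 0 <= C -> continuous G ->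
  (forall z, dot (z *m A) (z *m A) <= c * dot (z *m A) z) ->
  (forall x, - C <= dot x (G x)) ->
  exists x, x = - tau *: (G x *m A).
Proof.
move=> tau0 c0 C0 Gc Ac Gb.
(* The estimate bounds the square of the norm by [t = tau * c * C], and (t + 1)^2 > t, so its norm
   is below [rho]. *)
pose rho : R := tau * c * C + 1.
have tcC : 0 <= tau * c * C by rewrite !mulr_ge0.
have rho0 : 0 < rho by rewrite ltr_wpDl.
pose k x := - tau *: (G x *m A).
have kc : continuous k.
  move=> x; apply: continuous_at_mx => i j.
  apply: (@eq_continuous_at _ _ (fun x => - tau * \sum_l G x i l * A l j)).
    by move=> y; rewrite !mxE.
  apply: continuous_atM; first exact: continuous_at_cst.
  apply: continuous_at_sum => l _; apply: continuous_atM; last exact: continuous_at_cst.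
  exact/continuous_at_coord/Gc.
pose N (u : vec) := Num.sqrt (dot u u).
pose s (u : vec) := rho / Num.max rho (N u).
have m0 u : 0 < Num.max rho (N u) by rewrite lt_max rho0.
have s0 u : 0 < s u by rewrite divr_gt0.
have s1 u : s u <= 1 by rewrite ler_pdivrMr // mul1r le_max lexx.
have NZ a u : 0 <= a -> N (a *: u) = a * N u.
  by move=> a0; rewrite /N dotZl dotZr mulrA sqrtrM ?mulr_ge0 // -expr2 sqrtr_sqr ger0_norm.
have sN u : s u * N u <= rho.
  rewrite /s mulrAC ler_pdivrMr // ler_pM2l // le_max lexx orbT //.
have sc : continuous s.
  move=> u; apply: continuous_atM; first exact: continuous_at_cst.
  apply: (@continuousV _ _ (fun u => Num.max rho (N u))); first by rewrite gt_eqF.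
  apply: continuous_at_max; first exact: continuous_at_cst.
  apply: (@continuous_comp _ _ _ (fun u : vec => dot u u) (@Num.sqrt R)); first exact: dot_continuous.
  exact: sqrt_continuous.
have [||x xE] := @brouwer_bounded R d (fun x => s (k x) *: k x) rho.
- move=> x; apply: continuous_at_mx => i j.
  apply: (@eq_continuous_at _ _ (fun x => s (k x) * k x i j)); first by move=> y; rewrite [RHS]mxE.
  apply: continuous_atM; last exact/continuous_at_coord/kc.
  exact: (@continuous_comp _ _ _ k s x (kc x) (sc _)).
- move=> x j; apply: le_trans (coord_le_dot _ _) _.
  by rewrite -/(N _) NZ ?(ltW (s0 _)).
(* A fixed point solves the system with [t * tau] in place of [tau], where [t <= 1]. One factor
   [t * tau] is absorbed by the lower bound on [dot x (G x)], the other is at most [tau]. *)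
have Nx2 : dot x x <= tau * c * C.
  set t := s (k x) in xE *; pose w := G x *m A.
  have t0 : 0 < t := s0 _.
  have t1 : t <= 1 := s1 _.
  have xE' : x = - (t * tau) *: w by rewrite -{1}xE /k scalerA mulrN.
  have tw : t * tau * dot w (G x) <= C.
    by have := Gb x; rewrite {1}xE' dotZl -/w mulNr lerN2.
  have w0 : 0 <= dot w w := dot_ge0 w.
  have cw := Ac (G x); rewrite -/w in cw.
  rewrite xE' dotZl dotZr.
  have -> : - (t * tau) * (- (t * tau) * dot w w) = (t * tau) * (t * tau * dot w w) by ring.
  have tt0 : 0 <= t * tau by rewrite mulr_ge0 // ltW.
  apply: (@le_trans _ _ (t * tau * (c * C))).
    by rewrite ler_wpM2l // (le_trans (ler_wpM2l tt0 cw)) // mulrCA ler_wpM2l.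
  by rewrite -[leRHS]mulrA -[leRHS]mul1r -[leLHS]mulrA ler_wpM2r // !mulr_ge0.
have Nlt : N x < rho.
  rewrite -(ger0_norm (ltW rho0)) -sqrtr_sqr ltr_sqrt ?exprn_gt0 //.
  apply: le_lt_trans Nx2 _; rewrite /rho; nra.
exists x; rewrite -/(k x) -{1}xE.
(* An active truncation would put the fixed point on the sphere of radius [rho], against [Nlt]. *)
suff -> : s (k x) = 1 by rewrite scale1r.
move: Nlt; rewrite -{1}xE NZ ?(ltW (s0 _)) // /s.
case: (leP (N (k x)) rho) => H; first by rewrite divff ?gt_eqF.
by rewrite divfK ?ltxx // gt_eqF // (lt_trans rho0 H).
Qed.

End GradientSystem.

(** * Integrals of bounded continuous functions on open sets *)

Section NullSets.
Context d (T : measurableType d) (R : realType) (mu : {measure set T -> \bar R}).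
Import HBNNSimple.
Local Open Scope ereal_scope.

(** Here [f] and [D] are arbitrary, since nothing is known about the values of [pd] on the faces.
    The argument therefore works on the suprema of simple functions that define the integral:
    cutting a simple function off on [Z] does not change its integral. *)
Lemma integral_setD_null (D Z : set T) (f : T -> \bar R) :
  measurable Z -> mu Z = 0 -> \int[mu]_(x in D `\` Z) f x = \int[mu]_(x in D) f x.
Proof.
move=> mZ Z0.
have mC : measurable (~` Z) by exact: measurableC.
have main (g k : T -> \bar R) : (forall x, 0 <= k x) -> (forall x, k x <= g x) ->
    (forall x, ~ Z x -> k x = g x) ->
    ereal_sup [set sintegral mu h | h in [set h : {nnsfun T >-> R} | forall x, (h x)%:E <= k x]] =
    ereal_sup [set sintegral mu h | h in [set h : {nnsfun T >-> R} | forall x, (h x)%:E <= g x]].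
  move=> k0 kg kgE; apply/eqP; rewrite eq_le; apply/andP; split.
    apply: ge_ereal_sup => _ [h /= hk <-]; apply: ereal_sup_ubound; exists h => //= x.
    exact: le_trans (hk x) (kg x).
  apply: ge_ereal_sup => _ [h /= hg <-].
  have -> : sintegral mu h = sintegral mu (proj_nnsfun h mC).
    rewrite -!integralT_nnsfun; apply: ge0_ae_eq_integral => //.
    - exact/measurable_EFinP.
    - exact/measurable_EFinP.
    - by move=> x _; rewrite lee_fin.
    - by move=> x _; rewrite lee_fin.
    - exists Z; split => // x /= H; apply: contrapT => Zx; apply: H => _.
      by rewrite /= mindicE mem_set ?mulr1.
  apply: ereal_sup_ubound; exists (proj_nnsfun h mC) => //= x.
  have [xZ|xZ] := boolP (x \in ~` Z); rewrite /= mindicE ?(negbTE xZ) ?xZ ?mulr0 ?mulr1.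
    by rewrite kgE ?hg //; exact: set_mem xZ.
  exact: k0.
rewrite /integral; congr (_ - _); apply: main => x.
- by rewrite funeposE le_max lexx orbT.
- rewrite !funeposE !patchE in_setD.
  by case: (x \in D); case: (x \in Z) => //=; rewrite le_max maxxx lexx orbT.
- by move=> /(@mem_set _ (~` Z)); rewrite in_setC !funeposE !patchE in_setD => ->; rewrite andbT.
- by rewrite funenegE le_max lexx orbT.
- rewrite !funenegE !patchE in_setD.
  by case: (x \in D); case: (x \in Z) => //=; rewrite ?oppr0 le_max maxxx lexx orbT.
- by move=> /(@mem_set _ (~` Z)); rewrite in_setC !funenegE !patchE in_setD => ->; rewrite andbT.
Qed.

End NullSets.

(** * Lebesgue measure on three-dimensional space *)

Section Leb3.
Variable R : realType.
Local Notation pt := 'rV[R]_3.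

Lemma to_rV0 z : @to_rV R z 0 0 = z.1.1.
Proof. by rewrite mxE. Qed.

Lemma to_rV1 z : @to_rV R z 0 1 = z.1.2.
Proof. by rewrite mxE. Qed.

Lemma to_rV2 z : @to_rV R z 0 2 = z.2.
Proof. by rewrite mxE. Qed.

Lemma ord3P (P : 'I_3 -> Prop) : P 0 -> P 1 -> P 2 -> forall k, P k.
Proof.
move=> P0 P1 P2 [[|[|[|k]]] kP] //.
- by rewrite (_ : Ordinal _ = 0) //; exact: val_inj.
- by rewrite (_ : Ordinal _ = 1) //; exact: val_inj.
- by rewrite (_ : Ordinal _ = 2) //; exact: val_inj.
Qed.

Lemma to_rV_ball (z : R * R * R) (e : R) : 0 < e ->
  @to_rV R @^-1` ball (to_rV z) e = (ball z.1.1 e `*` ball z.1.2 e) `*` ball z.2 e.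
Proof.
move=> e0; apply/seteqP; split => [w [_ H]|w [[H0 H1] H2]] /=.
  have := (H 0 0, H 0 1, H 0 2).
  by rewrite !to_rV0 !to_rV1 !to_rV2 => -[[]].
split=> // i; rewrite ord1; apply: ord3P; by rewrite ?to_rV0 ?to_rV1 ?to_rV2.
Qed.

Lemma measurable_to_rV_ball (z : R * R * R) (e : R) : 0 < e ->
  measurable (@to_rV R @^-1` ball (to_rV z) e).
Proof.
move=> e0; rewrite to_rV_ball //.
by apply: measurableX; first apply: measurableX; exact: measurable_ball.
Qed.

(** The sigma-algebra is that of a product, the topology that of row vectors. They meet in the balls
    of the maximum norm, which are boxes; an open set is a countable union of those with rational
    centre and radius 1/(n+1). *)
Lemma measurable_to_rV_open (U : set pt) : open U -> measurable (@to_rV R @^-1` U).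
Proof.
move=> oU.
pose q3 (q : rat * rat * rat) : R * R * R := (ratr q.1.1, ratr q.1.2, ratr q.2).
pose F (q : rat * rat * rat * nat) : set (R * R * R) :=
  if asbool (ball (to_rV (q3 q.1)) q.2.+1%:R^-1 `<=` U)
  then @to_rV R @^-1` ball (to_rV (q3 q.1)) q.2.+1%:R^-1 else set0.
have -> : @to_rV R @^-1` U = \bigcup_q F q.
  apply/seteqP; split => [z Uz|z [q _]]; last first.
    by rewrite /F; case: asboolP => // H /H.
  have /nbhs_ballP[e /= e0 He] := open_nbhs_nbhs (conj oU Uz).
  have [n ne] : exists n, n.+1%:R^-1 < e / 2.
    have e20 : 0 < e / 2 by rewrite divr_gt0.
    by have [n _ /(_ n (leqnn n)) H] := near_infty_natSinv_lt (PosNum e20); exists n.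
  have n0 : 0 < n.+1%:R^-1 :> R by rewrite invr_gt0.
  have rat_near (t r : R) : 0 < r -> exists q : rat, ball (ratr q : R) r t.
    move=> r0; have [|q] := @rat_in_itvoo R (t - r) (t + r); first lra.
    rewrite in_itv /= => /andP[H1 H2]; exists q; rewrite /ball /= ltr_norml.
    by apply/andP; split; lra.
  have [q0 H0] := rat_near z.1.1 _ n0.
  have [q1 H1] := rat_near z.1.2 _ n0.
  have [q2 H2] := rat_near z.2 _ n0.
  have zq : (@to_rV R @^-1` ball (to_rV (q3 (q0, q1, q2))) n.+1%:R^-1) z.
    by rewrite to_rV_ball.
  exists (q0, q1, q2, n) => //; rewrite /F /=; case: asboolP => [_|[]] //.
  move=> y qy; apply: He; rewrite [e]splitr.
  apply: (@ball_triangle _ _ (to_rV (q3 (q0, q1, q2)))).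
    by apply/ball_sym; apply: le_ball zq; exact: ltW.
  by apply: le_ball qy; exact: ltW.
apply: countable_bigcupT_measurable => //.
move=> q; rewrite /F; case: asboolP => // _.
by apply: measurable_to_rV_ball; rewrite invr_gt0.
Qed.

Lemma leb3_setX (A B C : set R) : measurable (A : set (measurableTypeR R)) ->
  measurable (B : set (measurableTypeR R)) -> measurable (C : set (measurableTypeR R)) ->
  leb3 ((A `*` B) `*` C) =
  (lebesgue_measure A * lebesgue_measure B * lebesgue_measure C)%E.
Proof.
move=> mA mB mC.
have mAB : measurable (A `*` B : set (measurableTypeR R * measurableTypeR R)).
  exact: measurableX.
rewrite -(product_measure1E _ _ mA mB).
exact: (product_measure1E (@lebesgue_measure R \x @lebesgue_measure R)%E _ mAB mC).
Qed.

Lemma leb3_box (a : R) : (leb3 (@to_rV R @^-1` ball (0%R : pt) a) < +oo)%E.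
Proof.
have [a0|a0] := leP a 0.
  rewrite (_ : _ @^-1` _ = set0) ?measure0 //; apply/seteqP; split => // z [].
  by rewrite ltNge a0.
have -> : (0 : pt) = to_rV (0, 0, 0).
  by apply/rowP; apply: ord3P; rewrite ?to_rV0 ?to_rV1 ?to_rV2 mxE.
rewrite to_rV_ball // leb3_setX; try exact: measurable_ball.
by rewrite !lebesgue_measure_ball ?ltW // -!EFinM ltry.
Qed.

End Leb3.

(** * Bounded continuous functions and their integrals *)

Section NiceFunctions.
Variable R : realType.
Local Notation pt := 'rV[R]_3.
Implicit Types (f g : pt -> R).

(** On a bounded open set this implies integrability and is stable under sums and products, so it
    carries all later integral manipulations. Continuity is that of the ambient space, which only
    depends on the values in the open set [A]. *)
Definition nice (A : set pt) f :=
  (forall x, A x -> continuous_at x f) /\ exists M, forall x, A x -> `|f x| <= M.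

Variable A : set pt.
Hypothesis oA : open A.
Variable a : R.
Hypothesis Aa : A `<=` ball 0 a.

Lemma nice_cst c : nice A (fun=> c).
Proof. by split=> [x _|]; [exact: continuous_at_cst|exists `|c|]. Qed.

Lemma niceD f g : nice A f -> nice A g -> nice A (fun x => f x + g x).
Proof.
move=> [fc [M fM]] [gc [N gN]]; split=> [x Ax|].
  by apply: continuous_atD; [exact: fc|exact: gc].
exists (M + N) => x Ax; apply: le_trans (ler_normD _ _) _.
by rewrite lerD ?fM ?gN.
Qed.

Lemma niceM f g : nice A f -> nice A g -> nice A (fun x => f x * g x).
Proof.
move=> [fc [M fM]] [gc [N gN]]; split=> [x Ax|].
  by apply: continuous_atM; [exact: fc|exact: gc].
by exists (M * N) => x Ax; rewrite normrM ler_pM ?fM ?gN.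
Qed.

Lemma eq_nice f g : (forall x, A x -> f x = g x) -> nice A f -> nice A g.
Proof.
move=> fg [fc [M fM]]; split=> [x Ax|]; last by exists M => x Ax; rewrite -fg ?fM.
have H : \forall y \near x, f y = g y.
  by apply: filterS fg _; exact: open_nbhs_nbhs.
rewrite /continuous_at -fg // => B /(fc x Ax) /= fB.
by apply: filterS2 H fB => y /= ->.
Qed.

Lemma niceZ c f : nice A f -> nice A (fun x => c * f x).
Proof. by move=> nf; apply: niceM => //; exact: nice_cst. Qed.

Lemma niceN f : nice A f -> nice A (fun x => - f x).
Proof. by move/(niceZ (-1)); apply: eq_nice => x _; rewrite mulN1r. Qed.

Lemma niceB f g : nice A f -> nice A g -> nice A (fun x => f x - g x).
Proof. by move=> nf ng; apply: niceD => //; exact: niceN. Qed.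

Lemma nice_sum (I : Type) (r : seq I) (P : pred I) (f : I -> pt -> R) :
  (forall i, P i -> nice A (f i)) -> nice A (fun x => \sum_(i <- r | P i) f i x).
Proof.
move=> H; elim: r => [|i r IH].
  by apply: (@eq_nice (fun=> 0)); [move=> x _; rewrite big_nil|exact: nice_cst].
apply: (@eq_nice (fun y => if P i then f i y + \sum_(j <- r | P j) f j y
    else \sum_(j <- r | P j) f j y)); first by move=> y _; rewrite big_cons.
by case: (P i) (H i) => // Hi; apply: niceD => //; exact: Hi.
Qed.

Let D := @to_rV R @^-1` A.

Lemma measurable_dom : measurable D.
Proof. exact: measurable_to_rV_open. Qed.

Lemma dom_finite : (leb3 D < +oo)%E.
Proof.
apply: le_lt_trans (leb3_box a); apply: le_measure; rewrite ?inE.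
- exact: measurable_dom.
- by apply: measurable_to_rV_open; exact: ball_open.
- by move=> z; exact: Aa.
Qed.

Lemma nice_measurable f : nice A f -> measurable_fun D (f \o @to_rV R).
Proof.
move=> [fc _] mD; apply: (measurability _ (RGenOInfty.measurableE R)) => //.
move=> /= _ [_ [r ->] <-].
rewrite (_ : _ `&` _ = @to_rV R @^-1` (A `&` f @^-1` `]r, +oo[)) //.
apply: measurable_to_rV_open.
rewrite openE => x [Ax /= fx]; apply: filterI; first exact: open_nbhs_nbhs.
by apply: (fc x Ax); apply: open_nbhs_nbhs; split; [exact: interval_open|].
Qed.

Lemma nice_integrable f : nice A f -> leb3.-integrable D (EFin \o (f \o @to_rV R)).
Proof.
move=> nf; apply: measurable_bounded_integrable.
- exact: measurable_dom.
- exact: dom_finite.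
- exact: nice_measurable.
- have [M fM] := nf.2; exists M; split; first by rewrite num_real.
  by move=> N MN z Az; apply: le_trans (ltW MN); exact: fM.
Qed.

Lemma int3D f g : nice A f -> nice A g ->
  \int3_(x in A) (f x + g x) = \int3_(x in A) f x + \int3_(x in A) g x.
Proof.
by move=> nf ng; apply: RintegralD; [exact: measurable_dom|exact: nice_integrable..].
Qed.

Lemma int3Z c f : nice A f -> \int3_(x in A) (c * f x) = c * \int3_(x in A) f x.
Proof.
by move=> nf; apply: RintegralZl; [exact: measurable_dom|exact: nice_integrable].
Qed.

Lemma eq_int3 f g : (forall x, A x -> f x = g x) -> \int3_(x in A) f x = \int3_(x in A) g x.
Proof. by move=> fg; apply: eq_Rintegral => z /set_mem; exact: fg. Qed.

Lemma int3N f : nice A f -> \int3_(x in A) (- f x) = - \int3_(x in A) f x.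
Proof.
by move=> nf; rewrite -mulN1r -int3Z //; apply: eq_int3 => x _; rewrite mulN1r.
Qed.

Lemma int3B f g : nice A f -> nice A g ->
  \int3_(x in A) (f x - g x) = \int3_(x in A) f x - \int3_(x in A) g x.
Proof. by move=> nf ng; rewrite int3D ?int3N //; exact: niceN. Qed.

Lemma int3_0 : \int3_(x in A) (0 : R) = 0.
Proof. by rewrite /int3 Rintegral_cst ?mul0r //; exact: measurable_dom. Qed.

Lemma int3_ge0 f : (forall x, A x -> 0 <= f x) -> 0 <= \int3_(x in A) f x.
Proof. by move=> f0; apply: Rintegral_ge0 => z; exact: f0. Qed.

Lemma le_int3 f g : nice A f -> nice A g -> (forall x, A x -> f x <= g x) ->
  \int3_(x in A) f x <= \int3_(x in A) g x.
Proof.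
move=> nf ng fg; apply: le_Rintegral; [exact: measurable_dom|exact: nice_integrable..|].
by move=> z; exact: fg.
Qed.

(** If [f x] is positive, [f] exceeds [f x / 2] on a ball inside [A], and this ball has positive
    volume. *)
Lemma int3_eq0 f : nice A f -> (forall x, A x -> 0 <= f x) ->
  \int3_(x in A) f x = 0 -> forall x, A x -> f x = 0.
Proof.
move=> nf f0 If x Ax; apply: contrapT => /eqP fx.
have {}fx : 0 < f x by rewrite lt_neqAle eq_sym fx f0.
have : nbhs x (A `&` [set y | f x / 2 < f y]).
  apply: filterI; first exact: open_nbhs_nbhs.
  apply: (nf.1 x Ax [set t | f x / 2 < t]); apply: open_nbhs_nbhs; split; first exact: open_gt.
  by rewrite /= ltr_pdivrMr // ltr_pMr // ltr1n.
move=> /nbhs_ballP[e /= e0 He].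
pose B := ball x e.
have xE : x = to_rV (x 0 0, x 0 1, x 0 2).
  by apply/rowP; apply: ord3P; rewrite ?to_rV0 ?to_rV1 ?to_rV2.
have mB : measurable (@to_rV R @^-1` B) by apply: measurable_to_rV_open; exact: ball_open.
have muB : leb3 (@to_rV R @^-1` B) = ((e *+ 2) * (e *+ 2) * (e *+ 2))%:E.
  rewrite /B xE to_rV_ball // leb3_setX; try exact: measurable_ball.
  have L t : lebesgue_measure (ball t e) = (e *+ 2)%:E.
    by rewrite lebesgue_measure_ball // ltW.
  by rewrite !L -!EFinM.
have BA : @to_rV R @^-1` B `<=` D by move=> z /He[].
have : (f x / 2 * fine (leb3 (@to_rV R @^-1` B)) <= \int3_(y in A) f y)%R.
  rewrite -Rintegral_cst //.
  rewrite -lee_fin /int3 /Rintegral !fineK; last 2 first.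
  - by apply: integrable_fin_num; [exact: measurable_dom|exact: nice_integrable].
  - rewrite integral_cst // muB; exact: fin_numM.
  apply: (@le_trans _ _ (\int[leb3]_(z in @to_rV R @^-1` B) (f (to_rV z))%:E)%E).
    apply: ge0_le_integral => //.
    - by move=> z _; rewrite lee_fin ltW // divr_gt0.
    - apply/measurable_EFinP.
      apply: (measurable_funS measurable_dom BA); exact: nice_measurable.
    - by move=> z /He[_ /ltW]; rewrite lee_fin.
  apply: ge0_subset_integral => //; first exact: measurable_dom.
    by apply/measurable_EFinP; exact: nice_measurable.
  by move=> z Dz; rewrite lee_fin f0.
rewrite If muB /= leNgt => /negP; apply.
by rewrite !mulr_gt0 // ?mulrn_wgt0 // invr_gt0.
Qed.

End NiceFunctions.

(** * The cells of the mesh *)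

Section Barycentric.
Variable R : realType.
Local Notation pt := 'rV[R]_3.
Variable K : tetrahedron R.

Definition edge_mx : 'M[R]_3 := \matrix_(i < 3) (vertex K (lift ord0 i) - vertex K ord0).

Definition bcoord (i : 'I_4) (x : pt) : R :=
  let l := (x - vertex K ord0) *m invmx edge_mx in
  if unlift ord0 i is Some j then l 0 j else 1 - \sum_j l 0 j.

Lemma edge_mx_unit : edge_mx \in unitmx.
Proof. by rewrite -row_free_unit; exact: vertex_free. Qed.

Lemma bcoordP (t : 'I_4 -> R) x : \sum_i t i = 1 -> x = \sum_i t i *: vertex K i ->
  forall i, bcoord i x = t i.
Proof.
move=> t1 xE.
have t0 : t ord0 = 1 - \sum_(j < 3) t (lift ord0 j).
  by rewrite -t1 big_ord_recl addrK.
have E : (x - vertex K ord0) *m invmx edge_mx = \row_j t (lift ord0 j).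
  apply: (canLR (mulmxK edge_mx_unit)); rewrite mulmx_sum_row xE big_ord_recl t0.
  rewrite scalerBl scale1r scaler_suml addrAC [_ - _ - _]addrAC subrr add0r addrC -sumrB.
  by apply: eq_bigr => j _; rewrite mxE rowK scalerBr.
move=> i; rewrite /bcoord E; case: unliftP => [j ->|->]; first by rewrite mxE.
by rewrite t0; congr (_ - _); apply: eq_bigr => j _; rewrite mxE.
Qed.

Lemma bcoord_sum x : \sum_i bcoord i x = 1.
Proof.
rewrite big_ord_recl /bcoord unlift_none.
under [X in _ + X]eq_bigr do rewrite liftK.
by rewrite subrK.
Qed.

Lemma bcoord_point x : x = \sum_i bcoord i x *: vertex K i.
Proof.
rewrite big_ord_recl /bcoord unlift_none; set l := _ *m _.
under [X in _ + X]eq_bigr do rewrite liftK.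
have : x - vertex K ord0 = l *m edge_mx by rewrite mulmxKV ?edge_mx_unit.
rewrite mulmx_sum_row => /(canRL (subrK _)) {1}->.
rewrite scalerBl scale1r scaler_suml [RHS]addrAC -[RHS]addrA addrC; congr (_ + _).
by rewrite -sumrB; apply: eq_bigr => j _; rewrite rowK scalerBr.
Qed.

Lemma hullP x : hull K x <-> forall i, 0 <= bcoord i x.
Proof.
split=> [[t [t0 t1 xE]] i|H]; first by rewrite (bcoordP t1 xE).
by exists (bcoord^~ x); split => //; [exact: bcoord_sum|exact: bcoord_point].
Qed.

(** The coefficient vector is nonzero because [bcoord i] takes the values 1 and 0 at two vertices;
    its zero set is thus a genuine plane. *)
Lemma bcoord_affine i : exists a c, a != 0 /\ forall x, bcoord i x = dotv a x + c.
Proof.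
have [a [c H]] : exists a c, forall x, bcoord i x = dotv a x + c.
  pose N := invmx edge_mx; pose v := vertex K ord0.
  have lE x j : ((x - v) *m N) 0 j = dotv (\row_k N k j) x - dotv (\row_k N k j) v.
    rewrite mxE /dotv -sumrB; apply: eq_bigr => k _.
    by rewrite !mxE mulrBl mulrC [v 0 k * _]mulrC.
  rewrite /bcoord; case: unliftP => [j _|_].
    by exists (\row_k N k j), (- dotv (\row_k N k j) v).
  exists (- \sum_j \row_k N k j), (1 + \sum_j dotv (\row_k N k j) v) => x.
  under eq_bigr do rewrite lE.
  rewrite sumrB opprB addrA addrC; congr (_ + _).
  rewrite /dotv exchange_big -sumrN /=; apply: eq_bigr => k _.
  by rewrite mxE summxE -mulr_suml mulNr.
exists a, c; split => //; apply/negP => /eqP a0.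
have bv j : bcoord i (vertex K j) = (i == j)%:R.
  apply: (@bcoordP (fun k => (k == j)%:R)).
    by rewrite (bigD1 j) //= eqxx big1 ?addr0 // => k /negbTE ->.
  rewrite (bigD1 j) //= eqxx scale1r big1 ?addr0 // => k /negbTE ->; exact: scale0r.
have [j ij] : exists j, i != j.
  by exists (if i == ord0 then ord_max else ord0); case: (eqVneq i ord0) => [->|].
have Hi := bv i; have Hj := bv j.
rewrite !H a0 eqxx (negbTE ij) in Hi Hj.
have d0 x : dotv (0 : pt) x = 0.
  by rewrite /dotv big1 // => k _; rewrite mxE mul0r.
rewrite !d0 add0r in Hi Hj; move: Hi; rewrite Hj => /eqP.
by rewrite eq_sym oner_eq0.
Qed.

Lemma bcoord_continuous i : continuous (bcoord i).
Proof.
have [a [c [_ H]]] := bcoord_affine i; rewrite (funext H) => x.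
apply: continuous_atD; last exact: continuous_at_cst.
apply: continuous_at_sum => k _; apply: continuous_atM; first exact: continuous_at_cst.
exact: coord_continuous.
Qed.

Definition ocell : set pt := [set x | forall i, 0 < bcoord i x].

Lemma ocell_hull : ocell `<=` hull K.
Proof. by move=> x Hx; apply/hullP => i; exact: ltW. Qed.

Lemma ocell_open : open ocell.
Proof.
rewrite openE => x Hx; rewrite /interior.
have H i : \forall y \near x, 0 < bcoord i y.
  have Bx : nbhs (bcoord i x) [set t | 0 < t].
    by apply: open_nbhs_nbhs; split; [exact: open_gt|exact: Hx].
  exact: (@bcoord_continuous i x _ Bx).
exact: (filter_forall _ H).
Qed.

(** Points of the tetrahedron are moved slightly towards the centroid [c], all of whose barycentric
    coordinates are 1/4. The factor [s] keeps the displacement below [e]. *)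
Lemma hull_closure : hull K `<=` closure ocell.
Proof.
move=> x /hullP Hx B /nbhs_ballP[e /= e0 HB].
pose c : pt := 4^-1 *: \sum_i vertex K i.
pose n := `|c - x| + 1.
have n0 : 0 < n by rewrite ltr_wpDl.
pose s := Num.min 1 (e / (2 * n)).
have s0 : 0 < s by rewrite lt_min ltr01 divr_gt0 // mulr_gt0.
have s1 : s <= 1 by rewrite ge_min lexx.
pose y := x + s *: (c - x).
have yE : y = \sum_i ((1 - s) * bcoord i x + s * 4^-1) *: vertex K i.
  rewrite (eq_bigr (fun i => (1 - s) *: (bcoord i x *: vertex K i) + s *: (4^-1 *: vertex K i))).
    rewrite big_split -!scaler_sumr -bcoord_point /= -/c /y.
    by rewrite scalerBr scalerBl scale1r addrA addrAC.
  by move=> i _; rewrite scalerDl !scalerA.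
exists y; split.
  move=> i; rewrite (@bcoordP (fun i => (1 - s) * bcoord i x + s * 4^-1)) //.
    apply: ltr_wpDl; last by rewrite mulr_gt0 // invr_gt0.
    by rewrite mulr_ge0 // subr_ge0.
  rewrite big_split /= -mulr_sumr bcoord_sum sumr_const card_ord -mulr_natr.
  by field.
apply: HB; rewrite mx_norm_ball /ball_ /= /y opprD addrA subrr add0r normrN normrZ.
rewrite gtr0_norm //; apply: (@le_lt_trans _ _ (e / (2 * n) * `|c - x|)).
  by rewrite ler_wpM2r // ge_min lexx orbT.
rewrite mulrAC ltr_pdivrMr ?mulr_gt0 // ltr_pM2l // /n; have := normr_ge0 (c - x); lra.
Qed.

End Barycentric.

(** * Planes have measure zero *)

Section Planes.
Variable R : realType.
Local Notation pt := 'rV[R]_3.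
Local Notation mR := (measurableTypeR R).

Lemma dotvE (a x : pt) : dotv a x = a 0 0 * x 0 0 + a 0 1 * x 0 1 + a 0 2 * x 0 2.
Proof.
rewrite /dotv !big_ord_recr big_ord0 /= add0r.
by congr (a 0 _ * x 0 _ + a 0 _ * x 0 _ + a 0 _ * x 0 _); exact: val_inj.
Qed.

Lemma dotv_continuous (a : pt) : continuous (dotv a).
Proof.
move=> x; apply: continuous_at_sum => k _; apply: continuous_atM; first exact: continuous_at_cst.
exact: coord_continuous.
Qed.

Lemma measurable_plane (a : pt) c : measurable (@to_rV R @^-1` [set x | dotv a x + c = 0]).
Proof.
rewrite -[X in measurable X]setCK; apply: measurableC.
rewrite (_ : ~` _ = @to_rV R @^-1` (~` [set x | dotv a x + c = 0])) //.
apply: measurable_to_rV_open; apply: closed_openC.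
apply: (@closed_comp _ _ (fun x => dotv a x + c) [set 0]); last exact: closed_eq.
move=> x _; apply: continuous_atD; last exact: continuous_at_cst.
exact: dotv_continuous.
Qed.

Lemma line_set1 (u v : R) : u != 0 -> [set t | v + u * t = 0] = [set - v / u].
Proof.
move=> u0; apply/seteqP; split=> t /=; last by move=> ->; field.
by move=> H; apply: (mulfI u0); rewrite mulrCA divff // mulr1; lra.
Qed.

(** Fubini along an axis with a nonzero coefficient: the sections are single points. If the
    coefficient of the last axis is zero the plane is a cylinder, and the question passes to its
    base in one dimension less; the measure of the cylinder is then 0 times infinity, which is 0. *)
Lemma plane_null (a : pt) c : a != 0 ->
  leb3 (@to_rV R @^-1` [set x | dotv a x + c = 0]) = 0%E.
Proof.
move=> a0; set X := _ @^-1` _.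
have mX : measurable X := measurable_plane a c.
have [a2|a2] := eqVneq (a 0 2) 0; last first.
  have -> : leb3 X = (\int[(@lebesgue_measure R \x @lebesgue_measure R)]_w
     lebesgue_measure (xsection X w))%E by [].
  apply: integral0_eq => w _.
  rewrite (_ : xsection X w = [set t | (a 0 0 * w.1 + a 0 1 * w.2 + c) + a 0 2 * t = 0]).
    by rewrite line_set1 // lebesgue_measure_set1.
  by apply/seteqP; split => t; rewrite xsectionE /X /= dotvE to_rV0 to_rV1 to_rV2 /=; lra.
(* Membership in [X] no longer involves the last coordinate, so any section serves as the base. *)
pose L := ysection X (0 : mR).
have mL : measurable L := measurable_ysection _ mX.
have XE : X = L `*` setT.
  apply/seteqP; split => [z|z []]; rewrite /L ysectionE /X /= !dotvE !to_rV0 !to_rV1 !to_rV2 /= a2; lra.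
have L0 : (@lebesgue_measure R \x @lebesgue_measure R)%E L = 0%E.
  have [a1|a1] := eqVneq (a 0 1) 0; last first.
    have -> : ((@lebesgue_measure R \x @lebesgue_measure R) L = \int[@lebesgue_measure R]_w
       lebesgue_measure (xsection L w))%E by [].
    apply: integral0_eq => w _.
    rewrite (_ : xsection L w = [set t | (a 0 0 * w + c) + a 0 1 * t = 0]).
      by rewrite line_set1 // lebesgue_measure_set1.
    by apply/seteqP; split => t; rewrite xsectionE /L ysectionE /X /= dotvE to_rV0 to_rV1 to_rV2 /=; lra.
  pose M := ysection L (0 : mR).
  have mM : measurable M := measurable_ysection _ mL.
  have LE : L = M `*` setT.
    apply/seteqP; split => [z|z []]; rewrite /M /L !ysectionE /X /= !dotvE !to_rV0 !to_rV1 !to_rV2 /= a2 a1; lra.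
  have a00 : a 0 0 != 0.
    apply: contra a0 => /eqP a00; apply/eqP/rowP; apply: ord3P; by rewrite mxE.
  have ME : M = [set t | c + a 0 0 * t = 0].
    by apply/seteqP; split => t; rewrite /M /L !ysectionE /X /= dotvE to_rV0 to_rV1 to_rV2 /= a2 a1; lra.
  have M0 : @lebesgue_measure R M = 0%E by rewrite ME line_set1 // lebesgue_measure_set1.
  have := @product_measure1E _ _ _ _ _ (@lebesgue_measure R) (@lebesgue_measure R) M setT mM (@measurableT _ _).
  by move=> H; rewrite LE; apply: etrans H _; apply: etrans (congr1 (fun u => u * _)%E M0) (mul0e _).
rewrite XE.
have := @product_measure1E _ _ _ _ _ (@lebesgue_measure R \x @lebesgue_measure R)%E
  (@lebesgue_measure R) L setT mL (@measurableT _ _).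
by move=> H; apply: etrans H _; apply: etrans (congr1 (fun u => u * _)%E L0) (mul0e _).
Qed.

End Planes.

(** * Reduction of integrals to the open cells *)

Section Cells.
Variable R : realType.
Local Notation pt := 'rV[R]_3.
Local Notation mR := (measurableTypeR R).
Variables (Omega : set pt) (Th : mesh R).
Hypothesis oO : open Omega.
Hypothesis cover : closure Omega = \bigcup_i hull (cell (m := Th) i).

(** The intersection matters: a cell lies in the closure of [Omega], but its interior can contain
    boundary points of [Omega], as for a domain with a slit. *)
Definition cells : set pt := Omega `&` \bigcup_i ocell (cell (m := Th) i).

Lemma cells_open : open cells.
Proof. by apply: openI => //; apply: bigcup_open => i _; exact: ocell_open. Qed.

Lemma int3_cells (f : pt -> R) : \int3_(x in Omega) f x = \int3_(x in cells) f x.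
Proof.
(* [Z] consists of whole planes, which also cut through other cells; hence [cells] is removed from
   it in [Z3]. *)
pose Z : set pt := \bigcup_(i in [set: 'I_(ncells Th)]) \bigcup_(j in [set: 'I_4])
   [set x | bcoord (cell i) j x = 0].
pose Z3 := @to_rV R @^-1` (Z `\` cells).
have mcells : measurable (@to_rV R @^-1` cells).
  by apply: measurable_to_rV_open; exact: cells_open.
have ZE : @to_rV R @^-1` Z = \bigcup_(i in [set: 'I_(ncells Th)]) \bigcup_(j in [set: 'I_4])
   (@to_rV R @^-1` [set x | bcoord (cell i) j x = 0]).
  by apply/seteqP; split => z [i _ [j _ H]]; exists i => //; exists j.
have face i j : measurable (@to_rV R @^-1` [set x | bcoord (cell i) j x = 0]) /\
   leb3 (@to_rV R @^-1` [set x | bcoord (cell (m := Th) i) j x = 0]) = 0%E.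
  have [a [c [a0 H]]] := bcoord_affine (cell i) j.
  rewrite (_ : [set x | _] = [set x | dotv a x + c = 0]).
    by split; [exact: measurable_plane|exact: plane_null].
  by apply/seteqP; split => x /=; rewrite H.
have mZ : measurable (@to_rV R @^-1` Z).
  rewrite ZE; apply: fin_bigcup_measurable => // i _.
  by apply: fin_bigcup_measurable => // j _; exact: (face i j).1.
have mZ3 : measurable Z3.
  rewrite (_ : Z3 = @to_rV R @^-1` Z `\` @to_rV R @^-1` cells) //; exact: measurableD.
have Z30 : leb3 Z3 = 0%E.
  apply: (@subset_measure0 _ _ _ leb3 Z3 (@to_rV R @^-1` Z)) => //.
    by move=> z [].
  have null (I : finType) (F : I -> set (R * R * R)) : (forall i, measurable (F i)) ->
      (forall i, leb3 (F i) = 0%E) -> leb3 (\bigcup_(i in [set: I]) F i) = 0%E.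
    move=> mF F0; apply/eqP; rewrite -measure_le0.
    apply: le_trans (@content_sub_fsum _ _ _ leb3 _ [set: I] _ F _ _ _ _) _.
    - exact: finite_finset.
    - by move=> i _; exact: mF.
    - by apply: fin_bigcup_measurable => [|i _]; [exact: finite_finset|exact: mF].
    - by [].
    by rewrite fsbig1 // => i _; exact: F0.
  rewrite ZE; apply: (null) => i; last by apply: (null) => j; have [] := face i j.
  by apply: fin_bigcup_measurable => // j _; exact: (face i j).1.
rewrite /int3 /Rintegral -(@integral_setD_null _ (mR * mR * mR)%type R leb3 (@to_rV R @^-1` Omega) Z3 _ mZ3 Z30).
congr (fine (integral _ _ _)).
apply/seteqP; split => z; rewrite /Z3 /=.
  move=> [Oz nZ]; apply: contrapT => ncz; apply: nZ; split => //.
  have : closure Omega (to_rV z) by exact: subset_closure.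
  rewrite cover => -[i _ /hullP Hi].
  have [j Hj] : exists j, bcoord (cell i) j (to_rV z) = 0.
    apply: contrapT => H; apply: ncz; split => //; exists i => // j.
    by rewrite lt_neqAle Hi andbT eq_sym; apply/eqP => Hj; apply: H; exists j.
  by exists i => //; exists j.
by move=> cz; split; [case: cz|case].
Qed.

End Cells.

(** * Differentiable functions on the cells *)

Section DifferentiableNice.
Variable R : realType.
Local Notation pt := 'rV[R]_3.
Implicit Types (f g : pt -> R) (A B : set pt).

Lemma nice_sub A B f : B `<=` A -> nice A f -> nice B f.
Proof. by move=> BA [fc [M fM]]; split=> [x /BA|]; [exact: fc|exists M => x /BA; exact: fM]. Qed.

Lemma nice_bigcup (I : finType) (F : I -> set pt) f :
  (forall i, nice (F i) f) -> nice (\bigcup_i F i) f.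
Proof.
move=> H; split=> [x [i _ Fx]|]; first exact: (H i).1.
have /choice[M HM] : forall i, exists M, forall x, F i x -> `|f x| <= M by move=> i; exact: (H i).2.
exists (\sum_i `|M i|) => x [i _ Fx]; apply: le_trans (HM i x Fx) _.
rewrite (bigD1 i) //=; apply: le_trans (ler_norm _) _.
by rewrite lerDl; apply: sumr_ge0.
Qed.

(** Derivatives along the axes are all that [pd] sees. Every finite element function has this
    property on [cells]. *)
Definition dirnice A f :=
  [/\ nice A f, forall x k, A x -> derivable f x (delta_mx 0 k) & forall k, nice A (pd k f)].

Lemma dirnice_bigcup (I : finType) (F : I -> set pt) f :
  (forall i, dirnice (F i) f) -> dirnice (\bigcup_i F i) f.
Proof.
move=> H; split=> [|x k [i _ Fx]|k].
- by apply: nice_bigcup => i; case: (H i).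
- by case: (H i) => _ + _; apply.
- by apply: nice_bigcup => i; case: (H i).
Qed.

Lemma dirnice_sub A B f : B `<=` A -> dirnice A f -> dirnice B f.
Proof.
move=> BA [nf df npf]; split=> [|x k /BA|k]; [exact: nice_sub nf|exact: df|exact: nice_sub (npf k)].
Qed.

Lemma near_open A (P : pt -> Prop) x : open A -> (forall y, A y -> P y) -> A x ->
  \forall y \near x, P y.
Proof. by move=> oA AP Ax; apply: filterS AP _; exact: open_nbhs_nbhs. Qed.

Lemma eq_pd A f g k : open A -> (forall x, A x -> f x = g x) ->
  forall x, A x -> pd k f x = pd k g x.
Proof. by move=> oA fg x Ax; apply: near_eq_derive; exact: near_open fg Ax. Qed.

Lemma eq_dirnice A f g : open A -> (forall x, A x -> f x = g x) ->
  dirnice A f -> dirnice A g.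
Proof.
move=> oA fg [nf df npf]; split=> [|x k Ax|k].
- exact: eq_nice nf.
- by apply: near_eq_derivable (df x k Ax); exact: near_open fg Ax.
- by apply: eq_nice (npf k) => // x Ax; exact: eq_pd fg x Ax.
Qed.

Section Ops.
Variable A : set pt.
Hypothesis oA : open A.

Lemma pdD f g k x : dirnice A f -> dirnice A g -> A x ->
  pd k (fun y => f y + g y) x = pd k f x + pd k g x.
Proof. by move=> [_ df _] [_ dg _] Ax; apply: deriveD; [exact: df|exact: dg]. Qed.

Lemma pdZ c f k x : dirnice A f -> A x -> pd k (fun y => c * f y) x = c * pd k f x.
Proof. by move=> [_ df _] Ax; apply: deriveZ; exact: df. Qed.

Lemma dirniceD f g : dirnice A f -> dirnice A g -> dirnice A (fun x => f x + g x).
Proof.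
move=> nf ng; have [f1 f2 f3] := nf; have [g1 g2 g3] := ng.
split=> [|x k Ax|k]; first exact: niceD.
- by apply: derivableD; [exact: f2|exact: g2].
- by apply: eq_nice (niceD (f3 k) (g3 k)) => // x Ax; rewrite pdD.
Qed.

Lemma dirniceZ c f : dirnice A f -> dirnice A (fun x => c * f x).
Proof.
move=> nf; have [f1 f2 f3] := nf.
split=> [|x k Ax|k]; first exact: niceZ.
- by apply: derivableZ; exact: f2.
- by apply: eq_nice (niceZ c (f3 k)) => // x Ax; rewrite pdZ.
Qed.

Lemma dirniceN f : dirnice A f -> dirnice A (fun x => - f x).
Proof. by move/(dirniceZ (-1)); apply: eq_dirnice => // x _; rewrite mulN1r. Qed.

Lemma dirniceB f g : dirnice A f -> dirnice A g -> dirnice A (fun x => f x - g x).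
Proof. by move=> nf ng; apply: dirniceD => //; exact: dirniceN. Qed.

Lemma pdN f k x : dirnice A f -> A x -> pd k (fun y => - f y) x = - pd k f x.
Proof.
move=> nf Ax; rewrite -mulN1r -pdZ //.
by congr (pd k _ x); apply/funext => y; rewrite mulN1r.
Qed.

Lemma pdB f g k x : dirnice A f -> dirnice A g -> A x ->
  pd k (fun y => f y - g y) x = pd k f x - pd k g x.
Proof. by move=> nf ng Ax; rewrite pdD ?pdN //; exact: dirniceN. Qed.

Lemma dirnice0 : dirnice A (fun=> 0).
Proof.
have d0 k : pd k (fun=> 0 : R) = (fun=> 0) by apply/funext => x; exact: derive_cst.
split=> [|x k _|k]; first exact: nice_cst; first exact: derivable_cst.
by rewrite d0; exact: nice_cst.
Qed.

Lemma dirnice_sum (I : Type) (r : seq I) (F : I -> pt -> R) :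
  (forall i, dirnice A (F i)) -> dirnice A (fun x => \sum_(i <- r) F i x).
Proof.
move=> H; elim: r => [|i r IH].
  by apply: eq_dirnice dirnice0 => // x _; rewrite big_nil.
by apply: eq_dirnice (dirniceD (H i) IH) => // x _; rewrite big_cons.
Qed.

Lemma pd_sum (I : Type) (r : seq I) (F : I -> pt -> R) k x :
  (forall i, dirnice A (F i)) -> A x ->
  pd k (fun y => \sum_(i <- r) F i y) x = \sum_(i <- r) pd k (F i) x.
Proof.
move=> H Ax; elim: r => [|i r IH].
  rewrite big_nil -[RHS](derive_cst (0 : R) x (delta_mx 0 k)).
  by apply: (@eq_pd setT) => //; [exact: openT|move=> y _; rewrite big_nil].
rewrite big_cons -IH -pdD //; last exact: dirnice_sum.
by apply: (@eq_pd setT) => //; [exact: openT|move=> y _; rewrite big_cons].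
Qed.

End Ops.

Definition pev (q : mpoly 3 R) (x : pt) : R := meval (fun i => x 0 i) q.

Lemma is_derive_coord (i k : 'I_3) (x : pt) :
  is_derive x (delta_mx 0 k) (fun y : pt => y 0 i) ((k == i)%:R).
Proof.
have @f : {linear pt -> R}.
  by exists (fun N : pt => N 0 i); do 2![eexists]; do ?[constructor];
     rewrite ?mxE// => ? *; rewrite ?mxE//; move=> ?; rewrite !mxE.
rewrite (_ : (fun _ => _) = f) //.
have fc : continuous f by move=> y; exact: (@coord_continuous R 1 3 0 i y).
have df : differentiable f x by exact/linear_differentiable.
apply: DeriveDef; first exact: diff_derivable.
by rewrite deriveE // diff_lin // /f /= mxE eqxx eq_sym.
Qed.

(** Induction from constants and variables through sums and products. The derivative is asked to be
    the evaluation of a polynomial, so that the first half applies to it again. *)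
Lemma pev_nice (q : mpoly 3 R) :
  (forall a, nice (ball 0 a) (pev q)) /\
  forall k, exists q', forall x, is_derive x (delta_mx 0 k) (pev q) (pev q' x).
Proof.
pose P q := (forall a, nice (ball 0 a) (pev q)) /\
  forall k, exists q', forall x, is_derive x (delta_mx 0 k) (pev q) (pev q' x).
have PD p r : P p -> P r -> P (p + r).
  have E : pev (p + r) = pev p + pev r by apply/funext => x; rewrite /pev mevalD.
  move=> [np dp] [nr dr]; split=> [a|k].
    by rewrite E; exact: niceD.
  have [p' Hp] := dp k; have [r' Hr] := dr k; exists (p' + r') => x.
  by rewrite E /pev mevalD; exact: is_deriveD.
have PM p r : P p -> P r -> P (p * r).
  have E : pev (p * r) = pev p * pev r by apply/funext => x; rewrite /pev mevalM.
  move=> [np dp] [nr dr]; split=> [a|k].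
    by rewrite E; exact: niceM.
  have [p' Hp] := dp k; have [r' Hr] := dr k; exists (p * r' + r * p') => x.
  rewrite E /pev mevalD !mevalM; exact: is_deriveM.
have PC c : P (mpolyC 3 c).
  have E : pev (mpolyC 3 c) = cst c by apply/funext => x; rewrite /pev mevalC.
  split=> [a|k]; first by rewrite E; exact: nice_cst.
  by exists 0 => x; rewrite E /pev meval0; exact: is_derive_cst.
have PX i : P (mpolyX R (mnm1 i)).
  have E : pev (mpolyX R (mnm1 i)) = (fun x => x 0 i) by apply/funext => x; rewrite /pev mevalXU.
  rewrite /P E; split=> [a|k].
    split=> [x _|]; first exact: coord_continuous.
    exists a => x [_ /(_ 0 i)]; rewrite mxE /ball /= sub0r normrN; exact: ltW.
  exists (mpolyC 3 (k == i)%:R) => x; rewrite /pev mevalC; exact: is_derive_coord.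
have PP i n : P (mpolyX R (mnm1 i) ^+ n).
  by elim: n => [|n IH]; [rewrite expr0; exact: PC|rewrite exprS; exact: PM].
have PXm m : P (mpolyX R m).
  rewrite mpolyXE_id; elim/big_rec: _ => [|i p _ Hp]; first exact: PC.
  by apply: PM; [exact: PP|].
rewrite -/(P q); elim/mpolyind: q => [|c m p _ _ Hp].
  exact: (PC 0).
apply: PD => //; rewrite -mul_mpolyC; exact: PM.
Qed.

Lemma pev_dirnice q a : dirnice (ball 0 a) (pev q).
Proof.
have [nq dq] := pev_nice q; split=> // [x k _|k].
  by have [q' /(_ x)[]] := dq k.
have [q' H] := dq k; have [nq' _] := pev_nice q'.
apply: eq_nice (nq' a) => [|x _]; first exact: ball_open.
by case: (H x) => _ <-.
Qed.

End DifferentiableNice.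

Section FiniteElementFunctions.
Variable R : realType.
Local Notation pt := 'rV[R]_3.
Variables (Omega : set pt) (Th : mesh R).
Hypothesis oO : open Omega.
Hypothesis bO : bounded_set Omega.

Lemma bounded_ball : exists a, Omega `<=` ball 0 a.
Proof.
have [M [_ HM]] := bO; exists (`|M| + 2) => x Ox.
rewrite mx_norm_ball /ball_ /= sub0r normrN; apply: le_lt_trans (HM (`|M| + 1) _ x Ox) _.
  by rewrite (le_lt_trans (ler_norm M)) // ltrDl.
by rewrite ltrD2l ltr1n.
Qed.

Lemma polynomial_dirnice l s : (forall c : 'I_(ncells Th), polynomial_on l (cell c) s) ->
  dirnice (cells Omega Th) s.
Proof.
move=> H; have [a Oa] := bounded_ball.
apply: (@dirnice_sub _ (\bigcup_(c in [set: 'I_(ncells Th)]) (Omega `&` ocell (cell c)))).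
  by move=> x [Ox [c _ cx]]; exists c.
apply: dirnice_bigcup => c; have [q _ Hq] := H c.
apply: (@eq_dirnice _ _ (pev q)).
- by apply: openI => //; exact: ocell_open.
- by move=> x [_ /ocell_hull /Hq].
- by apply: dirnice_sub (pev_dirnice q a) => x [/Oa].
Qed.

End FiniteElementFunctions.

(** * Polynomials with vanishing gradient on a cell *)

Section ZeroGradient.
Variable R : realType.
Local Notation pt := 'rV[R]_3.

Lemma pev_differentiable (q : mpoly 3 R) (x : pt) : differentiable (pev q) x.
Proof.
pose P q := forall x : pt, differentiable (pev q : pt -> R) x.
have PD p r : P p -> P r -> P (p + r).
  move=> dp dr y; rewrite (_ : pev (p + r) = pev p + pev r); first exact: differentiableD.
  by apply/funext => z; rewrite /pev mevalD.
have PM p r : P p -> P r -> P (p * r).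
  move=> dp dr y; rewrite (_ : pev (p * r) = pev p * pev r); first exact: differentiableM.
  by apply/funext => z; rewrite /pev mevalM.
have PC c : P (mpolyC 3 c).
  move=> y; rewrite (_ : pev (mpolyC 3 c) = cst c); first exact: differentiable_cst.
  by apply/funext => z; rewrite /pev mevalC.
have PX i : P (mpolyX R (mnm1 i)).
  move=> y; rewrite (_ : pev (mpolyX R (mnm1 i)) = (fun x => x 0 i)); first exact: differentiable_coord.
  by apply/funext => z; rewrite /pev mevalXU.
have PP i n : P (mpolyX R (mnm1 i) ^+ n).
  by elim: n => [|n IH]; [rewrite expr0; exact: PC|rewrite exprS; exact: PM].
have PXm m : P (mpolyX R m).
  rewrite mpolyXE_id; elim/big_rec: _ => [|i p _ Hp]; first exact: PC.
  by apply: PM; [exact: PP|].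
suff : P q by apply.
elim/mpolyind: q => [|c m p _ _ Hp]; first exact: (PC 0).
apply: PD => //; rewrite -mul_mpolyC; exact: PM.
Qed.

Lemma is_derive_line (V W : normedModType R) (f : V -> W) (x v : V) (t : R) :
  derivable f (x + t *: v) v ->
  is_derive t 1 (fun s => f (x + s *: v)) ('D_v f (x + t *: v)).
Proof.
have E : (fun h : R => h^-1 *: ((fun s => f (x + s *: v)) (h *: 1 + t) - f (x + t *: v))) =
    (fun h => h^-1 *: (f (h *: v + (x + t *: v)) - f (x + t *: v))).
  by apply/funext => h /=; rewrite scalerDl addrCA [h *: 1](mulr1 h).
move=> dv; apply: DeriveDef.
  by move: dv; rewrite /derivable /= -E.
by rewrite /derive -E.
Qed.

Lemma derive_sum_pd (f : pt -> R) (x v : pt) :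
  differentiable f x -> 'D_v f x = \sum_k v 0 k * pd k f x.
Proof.
move=> df; rewrite deriveE // [in LHS](row_sum_delta v) linear_sum.
by apply: eq_bigr => k _; rewrite linearZ /= /pd deriveE.
Qed.

Lemma ocell_segment (K : tetrahedron R) x y t : ocell K x -> ocell K y ->
  0 <= t <= 1 -> ocell K (x + t *: (y - x)).
Proof.
move=> cx cy /andP[t0 t1] i; have [a [c [_ H]]] := bcoord_affine K i.
rewrite (_ : bcoord K i _ = (1 - t) * bcoord K i x + t * bcoord K i y).
  have [->|tn0] := eqVneq t 0; first by rewrite subr0 mul1r mul0r addr0; exact: cx.
  apply: ltr_wpDl; last by rewrite mulr_gt0 ?cy // lt_neqAle eq_sym tn0.
  by rewrite mulr_ge0 ?subr_ge0 // ltW ?cx.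
rewrite !H.
have -> : dotv a (x + t *: (y - x)) = dotv a x + t * (dotv a y - dotv a x).
  rewrite !dotvE !mxE; ring.
ring.
Qed.

(** Mean value theorem along segments of the convex open cell, then continuity of the polynomial up
    to the closed one. *)
Lemma zero_gradient_cell (K : tetrahedron R) (u : pt -> R) l :
  polynomial_on l K u -> (forall x k, ocell K x -> pd k u x = 0) ->
  exists c, forall x, hull K x -> u x = c.
Proof.
move=> [q _ Hq] du.
have Eq x : ocell K x -> u x = pev q x by move=> /ocell_hull /Hq.
have dq x k : ocell K x -> pd k (pev q) x = 0.
  move=> cx; rewrite -(du x k cx); apply: eq_pd cx; first exact: ocell_open.
  by move=> y cy; rewrite Eq.
have cst x y : ocell K x -> ocell K y -> pev q x = pev q y.
  move=> cx cy; pose h t := pev q (x + t *: (y - x)).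
  have hd (t : R) : is_derive t 1 h ('D_(y - x) (pev q) (x + t *: (y - x))).
    by apply: is_derive_line; apply: diff_derivable; exact: pev_differentiable.
  have hc : {within `[0, 1], continuous h}.
    by apply: derivable_within_continuous => t _; case: (hd t).
  have [t] := MVT_segment ler01 (fun t _ => hd t) hc.
  have -> : h 0 = pev q x by rewrite /h scale0r addr0.
  have -> : h 1 = pev q y by rewrite /h scale1r addrC subrK.
  rewrite in_itv /= => t01.
  rewrite derive_sum_pd; last exact: pev_differentiable.
  rewrite big1 ?mul0r => [/eqP|k _]; first by rewrite subr_eq0 => /eqP.
  by rewrite dq ?mulr0 //; exact: ocell_segment.
have [K0|/set0P[x0 cx0]] := eqVneq (ocell K) set0; last first.
  exists (pev q x0) => x Kx; rewrite (Hq x Kx) -/(pev q x).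
  have cl : closed [set y | pev q y = pev q x0].
    apply: (@closed_comp _ _ (pev q) [set pev q x0]); last exact: closed_eq.
    by move=> y _; apply: differentiable_continuous; exact: pev_differentiable.
  have := closure_subset (_ : ocell K `<=` [set y | pev q y = pev q x0]).
  move=> /(_ (fun y cy => cst _ _ cy cx0)) /(_ x (hull_closure Kx)).
  by rewrite -(closure_id _).1.
exists 0 => x /hull_closure; rewrite K0 closure0 //.
Qed.

End ZeroGradient.

(** * Functions of H10 with vanishing gradient *)

Section SquareIntegrable.
Variable R : realType.
Local Notation pt := 'rV[R]_3.
Variable Omega : set pt.
Hypothesis oO : open Omega.
Variable a : R.
Hypothesis Oa : Omega `<=` ball 0 a.
Implicit Types (f g u v : pt -> R).

Local Notation R3 := (measurableTypeR R * measurableTypeR R * measurableTypeR R)%type.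
Let D : set R3 := @to_rV R @^-1` Omega.
Let mD : measurable D := measurable_dom oO.

Definition integrable3 f := leb3.-integrable D (EFin \o (f \o @to_rV R)).

Lemma nice_integrable3 f : nice Omega f -> integrable3 f.
Proof. by move=> nf; have := nice_integrable oO Oa nf; rewrite /integrable3. Qed.

Lemma integrable3D f g : integrable3 f -> integrable3 g -> integrable3 (fun x => f x + g x).
Proof. by move=> nf ng; have := integrableD mD nf ng. Qed.

Lemma integrable3Z c f : integrable3 f -> integrable3 (fun x => c * f x).
Proof. by move=> nf; have := integrableZl mD c nf. Qed.

Lemma int3_D f g : integrable3 f -> integrable3 g ->
  \int3_(x in Omega) (f x + g x) = \int3_(x in Omega) f x + \int3_(x in Omega) g x.
Proof. by move=> nf ng; apply: RintegralD. Qed.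

Lemma int3_Z c f : integrable3 f -> \int3_(x in Omega) (c * f x) = c * \int3_(x in Omega) f x.
Proof. by move=> nf; apply: RintegralZl. Qed.

Lemma le_int3_ f g : integrable3 f -> integrable3 g -> (forall x, Omega x -> f x <= g x) ->
  \int3_(x in Omega) f x <= \int3_(x in Omega) g x.
Proof. by move=> nf ng fg; apply: le_Rintegral => // z; exact: fg. Qed.

Lemma L2_mul_integrable f g : L2fun Omega f -> L2fun Omega g -> integrable3 (fun x => f x * g x).
Proof.
move=> [mf f2] [mg g2].
apply: (@le_integrable _ _ _ leb3 D mD _ (fun z => ((f (to_rV z)) ^+ 2)%:E + ((g (to_rV z)) ^+ 2)%:E)%E).
- by apply/measurable_EFinP; exact: measurable_funM.
- move=> z Dz; rewrite /= lee_fin normrM [leRHS]ger0_norm ?addr_ge0 ?sqr_ge0 //.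
  rewrite -(real_normK (num_real (f _))) -(real_normK (num_real (g _))).
  move: (normr_ge0 (f (to_rV z))) (normr_ge0 (g (to_rV z))).
  move: `|f _| `|g _| => s t s0 t0; nra.
- exact: integrableD.
Qed.

Lemma L2_integrable2 f : L2fun Omega f -> integrable3 (fun x => f x ^+ 2).
Proof. by case. Qed.

Lemma L2D f g : L2fun Omega f -> L2fun Omega g -> L2fun Omega (fun x => f x + g x).
Proof.
move=> Lf Lg; have [mf f2] := Lf; have [mg g2] := Lg; split; first exact: measurable_funD.
rewrite (_ : (fun z => _) = EFin \o ((fun x => f x ^+ 2 + (2 * (f x * g x) + g x ^+ 2)) \o @to_rV R)).
  apply: integrable3D => //; apply: integrable3D => //; apply: integrable3Z.
  exact: L2_mul_integrable.
by apply/funext => z /=; congr (_%:E); ring.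
Qed.

Lemma L2Z c f : L2fun Omega f -> L2fun Omega (fun x => c * f x).
Proof.
move=> [mf f2]; split; first by apply: measurable_funM => //; exact: measurable_cst.
rewrite (_ : (fun z => _) = EFin \o ((fun x => c ^+ 2 * (f x ^+ 2)) \o @to_rV R)).
  exact: integrable3Z.
by apply/funext => z /=; rewrite exprMn.
Qed.

Lemma nice_L2 f : nice Omega f -> L2fun Omega f.
Proof.
move=> nf; split; first exact: nice_measurable.
by apply: (@nice_integrable3 (fun x => f x ^+ 2)); exact: (niceM nf nf).
Qed.

Lemma closure_Omega_compact : compact (closure Omega).
Proof.
apply: bounded_closed_compact; last exact: closed_closure.
exists (`|a| + 1); split; first by rewrite num_real.
move=> M aM x Ox.
have : closed [set y : pt | `|y| <= M].
  apply: (@closed_comp _ _ (fun y : pt => `|y|) [set t | t <= M]); last exact: closed_le.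
  by move=> y _; exact: norm_continuous.
move=> /closure_id => E.
have : Omega `<=` [set y : pt | `|y| <= M].
  move=> y /Oa; rewrite mx_norm_ball /ball_ /= sub0r normrN => ya.
  by apply: ltW; apply: lt_trans aM; apply: (lt_le_trans ya); apply: le_trans (ler_norm a) _; rewrite lerDl.
by move=> /closure_subset; rewrite -E; apply.
Qed.

Lemma compact_continuous_bounded (K : set pt) f : compact K -> {within K, continuous f} ->
  exists M, forall x, K x -> `|f x| <= M.
Proof.
move=> cK fc; have [M [_ HM]] := compact_bounded (continuous_compact fc cK).
exists (`|M| + 1) => x Kx; apply: (HM (`|M| + 1)); last by exists x.
by rewrite (le_lt_trans (ler_norm M)) // ltrDl.
Qed.

Lemma continuous_nice f : continuous f -> nice Omega f.
Proof.
move=> fc; split=> [x _|]; first exact: fc.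
have [M HM] := compact_continuous_bounded closure_Omega_compact (continuous_subspaceT fc).
by exists M => x Ox; apply: HM; exact: subset_closure.
Qed.

Section TestFunctions.

Lemma test_differentiable f x : test_function Omega f -> differentiable f x.
Proof. by move=> [/(_ [::] x)]. Qed.

Lemma test_derivable f x k : test_function Omega f -> derivable f x (delta_mx 0 k).
Proof. by move=> tf; apply: diff_derivable; exact: test_differentiable. Qed.

Lemma test_continuous f : test_function Omega f -> continuous f.
Proof. by move=> tf x; apply: differentiable_continuous; exact: test_differentiable. Qed.

Lemma test_nice f : test_function Omega f -> nice Omega f.
Proof. by move=> tf; apply: continuous_nice; exact: test_continuous. Qed.

Lemma pd_zero (K : set pt) f k : compact K -> (forall x, ~ K x -> f x = 0) ->
  forall x, ~ K x -> pd k f x = 0.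
Proof.
move=> cK f0 x nKx; have oK : open (~` K).
  by apply: closed_openC; apply: compact_closed => //; exact: norm_hausdorff.
by rewrite (eq_pd (g := fun=> 0) k oK f0 nKx); exact: derive_cst.
Qed.

Lemma pd_test f k : test_function Omega f -> test_function Omega (pd k f).
Proof.
move=> [sf [K [cK KO f0]]]; split=> [ks x|]; first by have := sf (rcons ks k) x; rewrite foldr_rcons.
by exists K; split => //; exact: pd_zero cK f0.
Qed.

Lemma testD f g : test_function Omega f -> test_function Omega g ->
  test_function Omega (fun x => f x + g x).
Proof.
move=> [sf [K [cK KO f0]]] [sg [L [cL LO g0]]]; split; last first.
  exists (K `|` L); split; [exact: compactU|by move=> x [/KO|/LO]|].
  by move=> x /not_orP[nK nL]; rewrite f0 // g0 // addr0.
have E ks : foldr pd (fun x => f x + g x) ks = (fun x => foldr pd f ks x + foldr pd g ks x).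
  elim: ks => //= k ks ->; apply/funext => x.
  by apply: deriveD; apply: diff_derivable; [exact: sf|exact: sg].
by move=> ks x; rewrite E; apply: differentiableD; [exact: sf|exact: sg].
Qed.

Lemma testZ c f : test_function Omega f -> test_function Omega (fun x => c * f x).
Proof.
move=> [sf [K [cK KO f0]]]; split; last first.
  by exists K; split => // x nK; rewrite f0 // mulr0.
have E ks : foldr pd (fun x => c * f x) ks = (fun x => c * foldr pd f ks x).
  elim: ks => //= k ks ->; apply/funext => x.
  by apply: deriveZ; apply: diff_derivable; exact: sf.
by move=> ks x; rewrite E; apply: differentiableZ; exact: sf.
Qed.

Lemma test_pdD f g k : test_function Omega f -> test_function Omega g ->
  pd k (fun x => f x + g x) = (fun x => pd k f x + pd k g x).
Proof. by move=> tf tg; apply/funext => x; apply: deriveD; exact: test_derivable. Qed.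

Lemma test_pdZ c f k : test_function Omega f ->
  pd k (fun x => c * f x) = (fun x => c * pd k f x).
Proof. by move=> tf; apply/funext => x; apply: deriveZ; exact: test_derivable. Qed.

Lemma weak_pdD k u v gu gv : L2fun Omega u -> L2fun Omega v -> L2fun Omega gu -> L2fun Omega gv ->
  weak_pd Omega k u gu -> weak_pd Omega k v gv ->
  weak_pd Omega k (fun x => u x + v x) (fun x => gu x + gv x).
Proof.
move=> Lu Lv Lgu Lgv wu wv f tf.
have Lf := nice_L2 (test_nice tf); have Ldf := nice_L2 (test_nice (pd_test k tf)).
under [in LHS](@eq_fun pt R) => x do rewrite mulrDl.
under [in RHS](@eq_fun pt R) => x do rewrite mulrDl.
rewrite !int3_D ?opprD; try exact: L2_mul_integrable.
by rewrite wu // wv.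
Qed.

Lemma weak_pdZ k c u gu : L2fun Omega u -> L2fun Omega gu ->
  weak_pd Omega k u gu -> weak_pd Omega k (fun x => c * u x) (fun x => c * gu x).
Proof.
move=> Lu Lgu wu f tf.
have Lf := nice_L2 (test_nice tf); have Ldf := nice_L2 (test_nice (pd_test k tf)).
under [in LHS](@eq_fun pt R) => x do rewrite -mulrA.
under [in RHS](@eq_fun pt R) => x do rewrite -mulrA.
by rewrite !int3_Z; try exact: L2_mul_integrable; rewrite wu // mulrN.
Qed.

Lemma int3_sq_ge0 f : 0 <= \int3_(x in Omega) (f x ^+ 2).
Proof. by apply: int3_ge0 => x _; exact: sqr_ge0. Qed.

Lemma L2B f g : L2fun Omega f -> L2fun Omega g -> L2fun Omega (fun x => f x - g x).
Proof.
move=> Lf /(L2Z (-1)) Lg; rewrite (_ : (fun x => _) = (fun x => f x + (-1) * g x)); first exact: L2D.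
by apply/funext => x; rewrite mulN1r.
Qed.

Lemma L2_cvgD (f g : nat -> pt -> R) (u v : pt -> R) :
  (forall n, L2fun Omega (f n)) -> (forall n, L2fun Omega (g n)) -> L2fun Omega u -> L2fun Omega v ->
  \int3_(x in Omega) ((f n x - u x) ^+ 2) @[n --> \oo] --> (0 : R) ->
  \int3_(x in Omega) ((g n x - v x) ^+ 2) @[n --> \oo] --> (0 : R) ->
  \int3_(x in Omega) (((f n x + g n x) - (u x + v x)) ^+ 2) @[n --> \oo] --> (0 : R).
Proof.
move=> Lf Lg Lu Lv fu gv.
have L1 n := L2B (Lf n) Lu; have L2 n := L2B (Lg n) Lv.
have H : 2 * \int3_(x in Omega) ((f n x - u x) ^+ 2) + 2 * \int3_(x in Omega) ((g n x - v x) ^+ 2)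
     @[n --> \oo] --> (0 : R).
  rewrite -[X in _ --> X]addr0 -[X in _ --> X + _](mulr0 2) -[X in _ --> _ + X](mulr0 2).
  by apply: cvgD; apply: cvgMr.
apply: (squeeze_cvgr _ (cvg_cst (0 : R)) H); near=> n.
rewrite int3_sq_ge0 /= -!int3_Z -?int3_D; try exact: L2_integrable2; try by apply: integrable3Z; exact: L2_integrable2.
apply: le_int3_.
- by apply: L2_integrable2; apply: L2B; apply: L2D.
- by apply: integrable3D; apply: integrable3Z; exact: L2_integrable2.
- move=> x _; rewrite -subr_ge0.
  by rewrite (_ : _ - _ = ((f n x - u x) - (g n x - v x)) ^+ 2) ?sqr_ge0 //; ring.
Unshelve. all: by end_near. Qed.

Lemma L2_cvgZ c (f : nat -> pt -> R) (u : pt -> R) :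
  (forall n, L2fun Omega (f n)) -> L2fun Omega u ->
  \int3_(x in Omega) ((f n x - u x) ^+ 2) @[n --> \oo] --> (0 : R) ->
  \int3_(x in Omega) ((c * f n x - c * u x) ^+ 2) @[n --> \oo] --> (0 : R).
Proof.
move=> Lf Lu fu.
have -> : (fun n => \int3_(x in Omega) ((c * f n x - c * u x) ^+ 2)) =
   (fun n => c ^+ 2 * \int3_(x in Omega) ((f n x - u x) ^+ 2)).
  apply/funext => n; rewrite -int3_Z; last by apply: L2_integrable2; exact: L2B.
  by congr int3; apply/funext => x; rewrite -mulrBr exprMn.
by rewrite -[X in _ --> X](mulr0 (c ^+ 2)); apply: cvgMr.
Qed.

Lemma H10D u v : H10 Omega u -> H10 Omega v -> H10 Omega (fun x => u x + v x).
Proof.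
move=> [Lu [gu [Hgu [f [tf fu dfu]]]]] [Lv [gv [Hgv [h [th hv dhv]]]]].
split; first exact: L2D.
exists (fun k x => gu k x + gv k x); split.
  move=> k; have [Lgu wu] := Hgu k; have [Lgv wv] := Hgv k.
  by split; [exact: L2D|exact: weak_pdD].
exists (fun n x => f n x + h n x); split=> [n||k]; first exact: testD.
- by apply: L2_cvgD => // n; apply: nice_L2; exact: test_nice.
- have [Lgu wu] := Hgu k; have [Lgv wv] := Hgv k.
  under eq_fun do under eq_fun do rewrite test_pdD //.
  by apply: L2_cvgD => // n; apply: nice_L2; apply: test_nice; exact: pd_test.
Qed.

Lemma H10Z c u : H10 Omega u -> H10 Omega (fun x => c * u x).
Proof.
move=> [Lu [gu [Hgu [f [tf fu dfu]]]]].
split; first exact: L2Z.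
exists (fun k x => c * gu k x); split.
  by move=> k; have [Lgu wu] := Hgu k; split; [exact: L2Z|exact: weak_pdZ].
exists (fun n x => c * f n x); split=> [n||k]; first exact: testZ.
- by apply: L2_cvgZ => // n; apply: nice_L2; exact: test_nice.
- have [Lgu wu] := Hgu k.
  under eq_fun do under eq_fun do rewrite test_pdZ //.
  by apply: L2_cvgZ => // n; apply: nice_L2; apply: test_nice; exact: pd_test.
Qed.

End TestFunctions.
End SquareIntegrable.

Section PlaneMeasure.
Variable R : realType.
Local Notation mR := (measurableTypeR R).

Definition leb2 : set (mR * mR) -> \bar R := (@lebesgue_measure R \x @lebesgue_measure R)%E.

HB.instance Definition _ := measure_function.Measure.copy leb2 (@lebesgue_measure R \x @lebesgue_measure R)%E.

(* The sigma-finiteness of a product measure is in the library, but the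
   canonical instance that is found only covers products of subprobabilities. *)
Lemma leb2_sigma_finite : sigma_finite setT leb2.
Proof.
pose B n : set mR := ball (0 : R) n.+1%:R.
have mB n : measurable (B n) by exact: measurable_ball.
exists (fun n => B n `*` B n).
  apply/seteqP; split => // z _.
  have [n Hn] : exists n : nat, `|z.1| + `|z.2| < n%:R.
    by exists (Num.bound (`|z.1| + `|z.2|)); apply: archi_boundP; rewrite addr_ge0.
  have Hn1 : (n%:R : R) < n.+1%:R by rewrite ltr_nat.
  exists n => //; split; rewrite /B /ball /= sub0r normrN; apply: lt_trans Hn1;
    apply: le_lt_trans Hn; by rewrite ?lerDl ?lerDr.
move=> n; split; first exact: measurableX.
have := @product_measure1E _ _ _ _ _ (@lebesgue_measure R) (@lebesgue_measure R) (B n) (B n) (mB n) (mB n).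
have L : lebesgue_measure (B n) = (n.+1%:R *+ 2)%:E by exact: lebesgue_measure_ball.
move=> H; have -> : leb2 (B n `*` B n) = ((n.+1%:R *+ 2)%:E * (n.+1%:R *+ 2)%:E)%E.
  by apply: etrans H _; exact: (congr2 (fun u v => (u * v)%E) L L).
by rewrite -EFinM ltry.
Qed.

HB.instance Definition _ := Measure_isSigmaFinite.Build _ _ _ leb2 leb2_sigma_finite.

End PlaneMeasure.

(** * Nonzero constants are not in the closure of the test functions *)

Section ConstantNotH10.
Variable R : realType.
Local Notation pt := 'rV[R]_3.
Variable Omega : set pt.
Hypothesis oO : open Omega.
Variable a : R.
Hypothesis Oa : Omega `<=` ball 0 a.
Local Notation mR := (measurableTypeR R).
Local Notation e2 := (delta_mx 0 2 : pt).

Lemma to_rV_line (w : R * R) (t : R) : to_rV (w, t) = to_rV (w, 0) + t *: e2.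
Proof.
apply/rowP; apply: ord3P; rewrite !mxE /= ?mulr0 ?addr0 //.
by rewrite mulr1 add0r.
Qed.

Lemma to_rV_line_continuous (w : R * R) : continuous (fun t : R => to_rV (w, t)).
Proof.
move=> t; apply: continuous_at_mx => i j; rewrite ord1; move: j; apply: ord3P.
- by apply: (@eq_continuous_at _ _ (fun=> w.1)) => [s|]; [rewrite to_rV0|exact: continuous_at_cst].
- by apply: (@eq_continuous_at _ _ (fun=> w.2)) => [s|]; [rewrite to_rV1|exact: continuous_at_cst].
- by apply: (@eq_continuous_at _ _ id) => [s|]; [rewrite to_rV2|exact: cvg_id].
Qed.

(** The derivative is zero off [K], so it is integrable on the whole space and Fubini applies. On
    each line the fundamental theorem of calculus on [-M, M] gives a difference of two values
    outside [K]. *)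
Lemma int3_pd_compact (F : pt -> R) (K : set pt) :
  (forall x, derivable F x e2) -> continuous F -> continuous (pd 2 F) ->
  compact K -> K `<=` Omega -> (forall x, ~ K x -> F x = 0) ->
  \int3_(x in Omega) pd 2 F x = 0.
Proof.
move=> dF cF ch cK KO F0; set h := pd 2 F.
have h0 x : ~ K x -> h x = 0 by exact: pd_zero cK F0 x.
pose M := `|a| + 1.
have M0 : 0 < M by rewrite ltr_wpDl.
have KM x : K x -> forall j, `|x 0 j| < M.
  move=> /KO /Oa [_ /(_ 0)] H j; have := H j; rewrite mxE /ball /= sub0r normrN => H1.
  by apply: lt_le_trans H1 _; apply: le_trans (ler_norm a) _; rewrite lerDl.
have KB : K `<=` ball 0 M.
  move=> x /KM H; split => // i j; rewrite ord1 mxE /ball /= sub0r normrN; exact: H.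
have intB : leb3.-integrable (@to_rV R @^-1` ball 0 M) (EFin \o (h \o @to_rV R)).
  have BB : ball (0 : pt) M `<=` ball 0 M by [].
  have := nice_integrable (ball_open (0 : pt) M) BB (continuous_nice BB ch).
  by [].
have mB : measurable (@to_rV R @^-1` ball (0 : pt) M : set (mR * mR * mR)).
  by apply: measurable_to_rV_open; exact: ball_open.
have intT : leb3.-integrable setT (EFin \o (h \o @to_rV R)).
  have := (@integrable_mkcond _ (mR * mR * mR)%type R leb3 _ (EFin \o (h \o @to_rV R)) mB).1 intB.
  rewrite (_ : _ \_ _ = EFin \o (h \o @to_rV R)) //.
  apply/funext => z; rewrite patchE; case: ifPn => // /negP zB.
  by rewrite /= h0 // => /KB Bz; apply: zB; rewrite inE.
rewrite /int3 Rintegral_mkcond.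
rewrite (_ : _ \_ _ = h \o @to_rV R); last first.
  apply/funext => z; rewrite patchE; case: ifPn => // /negP zB.
  by rewrite /= h0 // => /KO Oz; apply: zB; rewrite inE.
rewrite /Rintegral.
have FE := @integral12_prod_meas1 _ _ _ _ R (@leb2 R) (@lebesgue_measure R) _ intT.
rewrite (_ : (\int[leb3]_x ((h \o @to_rV R) x)%:E)%E = 0%E) //.
apply: etrans (esym FE) _.
apply: integral0_eq => w _; rewrite /fubini_F.
pose phi t := F (to_rV (w, t)).
have phiE : phi = (fun t => F (to_rV (w, 0) + t *: e2)).
  by apply/funext => t; rewrite /phi to_rV_line.
have dphi (t : R) : is_derive t 1 phi (h (to_rV (w, t))).
  by rewrite phiE [in h _]to_rV_line; apply: is_derive_line.
have phi0 t : M <= `|t| -> phi t = 0 /\ h (to_rV (w, t)) = 0.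
  move=> Mt; have nK : ~ K (to_rV (w, t)).
    by move=> /KM /(_ 2); rewrite to_rV2 /= ltNge Mt.
  by rewrite /phi F0 // h0.
have cphi : continuous phi.
  by move=> t; exact: (continuous_at_comp (@to_rV_line_continuous w t) (cF _)).
have chphi : continuous (fun t => h (to_rV (w, t))).
  by move=> t; exact: (continuous_at_comp (@to_rV_line_continuous w t) (ch _)).
transitivity (\int[lebesgue_measure]_(t in `[(- M)%R, M]) (h (to_rV (w, t)))%:E)%E.
  rewrite [RHS]integral_mkcond; apply: eq_integral => t _; rewrite patchE.
  case: ifPn => // /negP tM; rewrite /= (phi0 t _).2 //.
  rewrite leNgt; apply/negP => /ltW; rewrite ler_norml => tM'; apply: tM.
  by rewrite inE /= in_itv.
rewrite (continuous_FTC2 (F := phi)).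
- have M1 : M <= `|M| by rewrite ler_norm.
  have M2 : M <= `|- M| by rewrite normrN.
  by rewrite (phi0 _ M1).1 (phi0 _ M2).1 sube0.
- by rewrite gtrN.
- exact: continuous_subspaceT.
- split.
  + by move=> t _; case: (dphi t).
  + by apply: cvg_at_right_filter; exact: cphi.
  + by apply: cvg_at_left_filter; exact: cphi.
- by move=> t _; rewrite derive1E; case: (dphi t).
Qed.

Lemma int3_pd_test f : test_function Omega f -> \int3_(x in Omega) pd 2 f x = 0.
Proof.
move=> tf; have [_ [K [cK KO f0]]] := tf.
apply: int3_pd_compact cK KO f0 => [x||].
- exact: test_derivable tf.
- exact: test_continuous tf.
- exact: test_continuous (pd_test 2 tf).
Qed.

(** Integration by parts against the coordinate function, whose derivative is 1. It controls the
    integral of a test function by its derivative, as in the Poincare inequality. *)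
Lemma int3_test_coord f : test_function Omega f ->
  \int3_(x in Omega) f x = - \int3_(x in Omega) (x 0 2 * pd 2 f x).
Proof.
move=> tf; have [_ [K [cK KO f0]]] := tf.
have dx x : derivable (fun y : pt => y 0 2) x e2 by case: (is_derive_coord 2 2 x).
have df x : derivable f x e2 by exact: test_derivable tf.
have cx : continuous (fun y : pt => y 0 2) by exact: coord_continuous.
have cf := test_continuous tf; have cdf := test_continuous (pd_test 2 tf).
pose F (x : pt) := x 0 2 * f x.
have pF : pd 2 F = (fun x => x 0 2 * pd 2 f x + f x).
  apply/funext => x; rewrite /pd /F deriveM //.
  have -> : 'D_e2 (fun y : pt => y 0 2) x = 1.
    by case: (is_derive_coord 2 2 x) => _ ->; rewrite eqxx.
  by rewrite [f x *: 1]mulr1.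
have := @int3_pd_compact F K.
rewrite pF => /(_ _ _ _ cK KO) H.
have n1 : nice Omega (fun x => x 0 2 * pd 2 f x).
  by apply: niceM; apply: (continuous_nice Oa).
rewrite -[RHS]add0r; apply/esym; apply: (canLR (addrK _)); apply/esym.
rewrite addrC -(int3D oO Oa n1 (test_nice Oa tf)); apply: H => [x|x|x|x nK].
- exact: derivableM.
- by apply: continuous_atM; [exact: cx|exact: cf].
- by apply: continuous_atD; [apply: continuous_atM; [exact: cx|exact: cdf]|exact: cf].
- by rewrite /F f0 ?mulr0.
Qed.

(** Let test functions f_n approximate the constant. Their derivatives tend to a weak derivative of
    a constant, hence to 0 by [df2], and so does the integral of f_n by [int3_test_coord]. But this
    integral tends to c times the volume. The inequality [bound] expresses the argument through
    squares only. *)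
Lemma constant_H10 u c : Omega !=set0 -> (forall x, Omega x -> u x = c) -> H10 Omega u -> c = 0.
Proof.
move=> [x0 Ox0] uc [Lu [g [Hg [f [tf fu dfu]]]]].
have [Lg wg] := Hg 2.
have tdf n := pd_test 2 (tf n).
have gf h : test_function Omega h -> \int3_(x in Omega) (g 2 x * h x) = 0.
  move=> th; apply/eqP; rewrite -oppr_eq0 -(wg h th); apply/eqP.
  rewrite (eq_int3 (g := fun x => c * pd 2 h x)); last by move=> x Ox; rewrite uc.
  rewrite (int3Z oO Oa); last exact: (test_nice Oa (pd_test 2 th)).
  by rewrite int3_pd_test ?mulr0.
have Lt h : test_function Omega h -> L2fun Omega h.
  by move=> th; apply: (nice_L2 oO Oa); exact: (test_nice Oa).
have Ldf n := Lt _ (tdf n); have Lf n := Lt _ (tf n).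
(* A weak derivative of a constant is orthogonal to all test functions, so this is Pythagoras. *)
have df2 n : \int3_(x in Omega) (pd 2 (f n) x ^+ 2) <=
             \int3_(x in Omega) ((pd 2 (f n) x - g 2 x) ^+ 2).
  have E := gf _ (tdf n).
  have -> : \int3_(x in Omega) ((pd 2 (f n) x - g 2 x) ^+ 2) =
    \int3_(x in Omega) ((pd 2 (f n) x - g 2 x) ^+ 2 + 2 * (g 2 x * pd 2 (f n) x)).
    rewrite (int3_D oO) ?(int3_Z oO) ?E ?mulr0 ?addr0 //.
    - exact: L2_mul_integrable.
    - by apply: L2_integrable2; exact: L2B.
    - by apply: integrable3Z => //; exact: L2_mul_integrable.
  apply: (le_int3_ oO).
  - exact: L2_integrable2.
  - apply: integrable3D => //; first by apply: L2_integrable2; exact: L2B.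
    by apply: integrable3Z => //; exact: L2_mul_integrable.
  - move=> x _; rewrite -subr_ge0 (_ : _ - _ = g 2 x ^+ 2) ?sqr_ge0 //; ring.
pose V := \int3_(x in Omega) (1 : R).
have nx : nice Omega (fun x : pt => x 0 2) by apply: (continuous_nice Oa); exact: coord_continuous.
pose X := \int3_(x in Omega) (x 0 2 * x 0 2).
(* From c^2 - 2 c f <= (f - c)^2 and Young's inequality with weight [eps] on the product of the
   coordinate and the derivative. *)
have bound eps n : 0 < eps ->
    c ^+ 2 * V <= \int3_(x in Omega) ((f n x - u x) ^+ 2) +
      (eps * c ^+ 2 * X + eps^-1 * \int3_(x in Omega) (pd 2 (f n) x ^+ 2)).
  move=> e0.
  have -> : c ^+ 2 * V = \int3_(x in Omega) (c ^+ 2 - 2 * c * f n x) +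
     2 * c * \int3_(x in Omega) f n x.
    have nf := test_nice Oa (tf n).
    rewrite (int3B oO Oa); [|exact: nice_cst|exact: niceZ].
    rewrite (int3Z oO Oa) // subrK /V -(int3Z oO Oa); last exact: nice_cst.
    by apply: eq_int3 => x _; rewrite mulr1.
  apply: lerD.
    apply: (le_int3_ oO).
    - apply: (nice_integrable3 oO Oa); apply: niceB => //; first exact: nice_cst.
      by apply: niceZ => //; exact: (test_nice Oa).
    - by apply: L2_integrable2; exact: L2B.
    - move=> x Ox; rewrite uc // -subr_ge0 (_ : _ - _ = f n x ^+ 2) ?sqr_ge0 //; ring.
  rewrite int3_test_coord // mulrN -mulNr.
  have nd := test_nice Oa (tdf n).
  have nxd : nice Omega (fun x => x 0 2 * pd 2 (f n) x) by exact: niceM.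
  rewrite -!(int3Z oO Oa) //; [|exact: niceM..].
  rewrite -(int3D oO Oa); [|by apply: niceZ => //; exact: niceM|by apply: niceZ => //; exact: (niceM nd nd)].
  apply: (le_int3 oO Oa).
  - exact: niceZ.
  - apply: niceD; apply: niceZ => //; first exact: niceM.
    exact: (niceM nd nd).
  - move=> x _; set s := x 0 2; set t := pd _ _ _.
    rewrite -(ler_pM2l e0) -subr_ge0.
    rewrite (_ : _ - _ = (eps * c * s + t) ^+ 2) ?sqr_ge0 //.
    by field; rewrite gt_eqF.
have c2V : c ^+ 2 * V <= 0.
  have H eps : 0 < eps -> c ^+ 2 * V <= eps * c ^+ 2 * X.
    move=> e0.
    have L : \int3_(x in Omega) ((f n x - u x) ^+ 2) +
        (eps * c ^+ 2 * X + eps^-1 * \int3_(x in Omega) ((pd 2 (f n) x - g 2 x) ^+ 2))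
        @[n --> \oo] --> (eps * c ^+ 2 * X : R).
      rewrite -[X in _ --> X]add0r -[X in _ --> _ + X]addr0 -[X in _ --> _ + (_ + X)](mulr0 eps^-1).
      apply: cvgD => //; apply: cvgD; first exact: cvg_cst.
      by apply: cvgMr; exact: dfu.
    apply: (ler_cvg_to (cvg_cst _) L); near=> n.
    apply: le_trans (bound eps n e0) _; rewrite lerD2l lerD2l ler_pM2l ?invr_gt0 //; exact: df2.
  have X0 : 0 <= X by apply: int3_ge0 => x _; rewrite -expr2 sqr_ge0.
  rewrite leNgt; apply/negP => cV.
  (* With this [eps] the right-hand side is less than half of [c ^+ 2 * V]; adding 1 avoids dividing
     by zero. *)
  have := H (c ^+ 2 * V / (2 * (c ^+ 2 * X + 1))).
  have c2X : 0 <= c ^+ 2 * X by rewrite mulr_ge0 // sqr_ge0.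
  have den : 0 < c ^+ 2 * X + 1 by rewrite ltr_wpDl.
  have den2 : 0 < 2 * (c ^+ 2 * X + 1) by rewrite mulr_gt0.
  rewrite (divr_gt0 cV den2) => /(_ isT); rewrite leNgt => /negP; apply.
  rewrite -mulrA mulrAC ltr_pdivrMr // ltr_pM2l //; lra.
have V0 : V != 0.
  apply/negP => /eqP V0; have := int3_eq0 oO Oa (nice_cst Omega 1) (fun _ _ => ler01) V0 Ox0.
  by move=> /eqP; rewrite oner_eq0.
have Vge : 0 < V by rewrite lt_neqAle eq_sym V0; apply: int3_ge0.
move: c2V; rewrite pmulr_lle0 // => c2; apply/eqP; rewrite -sqrf_eq0 eq_le c2; exact: sqr_ge0.
Unshelve. all: by end_near. Qed.

End ConstantNotH10.

(** * Finite element functions with vanishing gradient *)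

Section Definiteness.
Variable R : realType.
Local Notation pt := 'rV[R]_3.
Variables (Omega : set pt) (Th : mesh R).
Hypothesis oO : open Omega.
Hypothesis cO : connected Omega.
Hypothesis nO : Omega !=set0.
Hypothesis bO : bounded_set Omega.
Hypothesis cover : closure Omega = \bigcup_i hull (cell (m := Th) i).

Lemma hull_closed (K : tetrahedron R) : closed (hull K).
Proof.
rewrite (_ : hull K = \bigcap_i [set x | 0 <= bcoord K i x]).
  apply: closed_bigI => i _.
  apply: (@closed_comp _ _ (bcoord K i) [set t | 0 <= t]); last exact: closed_ge.
  by move=> x _; exact: bcoord_continuous.
by apply/seteqP; split=> [x /hullP H i _|x H]; [exact: H|apply/hullP => i; exact: H].
Qed.

Lemma hull_in_closure (i : 'I_(ncells Th)) : hull (cell i) `<=` closure Omega.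
Proof. by move=> x Hx; rewrite cover; exists i. Qed.

Lemma cells_dense_ocell (i : 'I_(ncells Th)) x : ocell (cell i) x ->
  closure (cells Omega Th) x.
Proof.
move=> cx B Bx.
have : closure Omega x by apply: hull_in_closure; exact: ocell_hull cx.
move=> /(_ (B `&` ocell (cell i))) [].
  by apply: filterI => //; apply: open_nbhs_nbhs; split; [exact: ocell_open|].
by move=> y [Oy [By cy]]; exists y; split => //; split => //; exists i.
Qed.

(** The function is constant on each closed cell. The cells where this constant is [u x0] and those
    where it is not have closed unions, finite in number, whose traces on [Omega] are complementary;
    connectedness rules out the second. *)
Lemma zero_gradient_const l (u : pt -> R) :
  (forall i : 'I_(ncells Th), polynomial_on l (cell i) u) ->
  (forall x k, cells Omega Th x -> pd k u x = 0) ->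
  exists c, forall x, Omega x -> u x = c.
Proof.
move=> pu du.
have cu (i : 'I_(ncells Th)) : exists c, forall x, hull (cell i) x -> u x = c.
  have [q ql Hq] := pu i.
  (* The polynomial replaces [u]: the derivative of [u] is only known in [Omega], which is dense in
     the open cell, and that of the polynomial is continuous. *)
  have [|x k cx|c Hc] := @zero_gradient_cell R (cell i) (pev q) l.
  - by exists q.
  - have [q' Hq'] := (pev_nice q).2 k.
    have pq y : pd k (pev q) y = pev q' y by case: (Hq' y).
    rewrite pq.
    have cl : closed [set y | pev q' y = 0].
      apply: (@closed_comp _ _ (pev q') [set 0]); last exact: closed_eq.
      by move=> y _; apply: differentiable_continuous; exact: pev_differentiable.
    pose C := cells Omega Th `&` ocell (cell i).
    have Cx : closure C x.
      move=> B Bx; have [|y [cy [By oy]]] := cells_dense_ocell cx (B := B `&` ocell (cell i)).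
        by apply: filterI => //; apply: open_nbhs_nbhs; split; [exact: ocell_open|].
      by exists y; split.
    have : C `<=` [set y | pev q' y = 0].
      move=> y [cy oy] /=; rewrite -pq -(du y k cy); symmetry.
      apply: (eq_pd _ (ocell_open (K := cell i))) oy.
      by move=> z /ocell_hull; exact: Hq.
    by move=> /closure_subset /(_ x Cx); rewrite -(closure_id _).1.
  - by exists c => x Hx; rewrite (Hq x Hx) -/(pev q x) Hc.
have /choice[c Hc] := cu.
have [x0 Ox0] := nO; exists (u x0) => x Ox.
have inhull y : Omega y -> exists i, hull (cell (m := Th) i) y.
  by move=> /subset_closure; rewrite cover => -[i _ Hi]; exists i.
pose B := Omega `&` [set y | u y = u x0].
pose U (P : pred 'I_(ncells Th)) := \bigcup_(i in [set i | P i]) hull (cell (m := Th) i).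
have Ucl P : closed (U P).
  apply: closed_bigcup => [|i _]; [exact: finite_finset|exact: hull_closed].
suff -> : u x = u x0 by [].
have : B = Omega.
  apply: cO.
  - by exists x0; split.
  - exists (~` U (fun i => c i != u x0)); first by apply: closed_openC; exact: Ucl.
    apply/seteqP; split=> [y [Oy uy]|y [Oy nU]]; split => //.
      by move=> [i /= ci Hi]; move: ci; rewrite -(Hc i y Hi) uy eqxx.
    have [i Hi] := inhull y Oy; apply: contrapT => uy; apply: nU; exists i => //=.
    by rewrite -(Hc i y Hi); apply/eqP.
  - exists (U (fun i => c i == u x0)); first exact: Ucl.
    apply/seteqP; split=> [y [Oy uy]|y [Oy [i /= /eqP ci Hi]]]; split => //.
      by have [i Hi] := inhull y Oy; exists i => //=; rewrite -(Hc i y Hi); apply/eqP.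
    by rewrite /= (Hc i y Hi).
by move=> /seteqP[_ /(_ x Ox) []].
Qed.

Lemma zero_gradient_H10 l (u : pt -> R) : H10 Omega u ->
  (forall i : 'I_(ncells Th), polynomial_on l (cell i) u) ->
  (forall x k, cells Omega Th x -> pd k u x = 0) ->
  forall x, Omega x -> u x = 0.
Proof.
move=> Hu pu du; have [c Hc] := zero_gradient_const pu du.
have [a Oa] := bounded_ball bO.
by move=> x Ox; rewrite Hc //; exact: constant_H10 oO _ Oa _ _ nO Hc Hu.
Qed.

End Definiteness.

(** * Orthonormal bases of the discrete spaces *)

Section GramSchmidt.
Variables (R : realType) (V : lmodType R) (P : V -> Prop) (ip : V -> V -> R).
Hypothesis P0 : P 0.
Hypothesis PL : forall a u v, P u -> P v -> P (a *: u + v).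
Hypothesis ipL : forall a u v w, P u -> P v -> P w -> ip (a *: u + v) w = a * ip u w + ip v w.
Hypothesis ipC : forall u v, P u -> P v -> ip u v = ip v u.
Hypothesis ip_ge0 : forall u, P u -> 0 <= ip u u.
Variables (X : finType) (coefs : V -> (X -> R) -> Prop).
Hypothesis coefs0 : coefs 0 (fun=> 0).
Hypothesis coefsL : forall a u v c d, coefs u c -> coefs v d ->
  coefs (a *: u + v) (fun x => a * c x + d x).
Hypothesis coefs_ex : forall u, P u -> exists c, coefs u c.
Hypothesis coefs_eq0 : forall u, P u -> coefs u (fun=> 0) -> ip u u = 0.

Lemma P_sum n (a : 'I_n -> R) (e : 'I_n -> V) (Q : pred 'I_n) : (forall i, P (e i)) ->
  P (\sum_(i | Q i) a i *: e i).
Proof. by move=> Pe; elim/big_rec: _ => // i v _ Pv; exact: PL. Qed.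

Lemma PB u v : P u -> P v -> P (u - v).
Proof. by move=> Pu Pv; rewrite addrC -scaleN1r; exact: PL. Qed.

Lemma ip0l w : P w -> ip 0 w = 0.
Proof.
by move=> Pw; have := ipL (-1) P0 P0 Pw; rewrite scaler0 addr0 mulN1r addNr.
Qed.

Lemma ip_suml n (a : 'I_n -> R) (e : 'I_n -> V) w : (forall i, P (e i)) -> P w ->
  ip (\sum_i a i *: e i) w = \sum_i a i * ip (e i) w.
Proof.
move=> Pe Pw; elim: n a e Pe => [|n IH] a e Pe; first by rewrite !big_ord0 ip0l.
by rewrite !big_ord_recl ipL ?IH //; apply: P_sum.
Qed.

Lemma ipBl u v w : P u -> P v -> P w -> ip (u - v) w = ip u w - ip v w.
Proof. by move=> Pu Pv Pw; rewrite addrC -scaleN1r ipL // mulN1r addrC. Qed.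

Definition orthonormal n (e : 'I_n -> V) :=
  (forall i, P (e i)) /\ forall i j, ip (e i) (e j) = (i == j)%:R.

Lemma orthonormal_coord n (e : 'I_n -> V) (a : 'I_n -> R) j : orthonormal e ->
  ip (\sum_i a i *: e i) (e j) = a j.
Proof.
move=> [Pe ee]; rewrite ip_suml // (bigD1 j) //= ee eqxx mulr1 big1 ?addr0 // => i /negbTE ij.
by rewrite ee ij mulr0.
Qed.

Lemma orthonormal_norm n (e : 'I_n -> V) (a : 'I_n -> R) : orthonormal e ->
  ip (\sum_i a i *: e i) (\sum_i a i *: e i) = \sum_i a i ^+ 2.
Proof.
move=> oe; have [Pe _] := oe; rewrite ip_suml //; last exact: P_sum.
by apply: eq_bigr => i _; rewrite ipC //; [rewrite orthonormal_coord // expr2|exact: P_sum].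
Qed.

Lemma coefs_sum n (a : 'I_n -> R) (e : 'I_n -> V) (c : 'I_n -> X -> R) :
  (forall i, coefs (e i) (c i)) -> coefs (\sum_i a i *: e i) (fun x => \sum_i a i * c i x).
Proof.
elim: n a e c => [|n IH] a e c H.
  rewrite big_ord0 (_ : (fun x => _) = (fun=> 0)) //.
  by apply/funext => x; rewrite big_ord0.
rewrite big_ord_recl (_ : (fun x => _) =
  (fun x => a ord0 * c ord0 x + \sum_(i < n) a (lift ord0 i) * c (lift ord0 i) x)).
  by apply: coefsL => //; apply: IH.
by apply/funext => x; rewrite big_ord_recl.
Qed.

(** More vectors than coordinates admit a nontrivial combination with zero coordinates, hence of
    norm 0, against orthonormality. [coefs] is a relation because it only asks for some polynomials
    representing the function on the cells. *)
Lemma orthonormal_size n (e : 'I_n -> V) : orthonormal e -> (n <= #|X|)%N.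
Proof.
move=> oe; have [Pe ee] := oe; rewrite leqNgt; apply/negP => nX.
have /choice[c Hc] : forall i, exists c, coefs (e i) c by move=> i; exact: coefs_ex.
pose C : 'M[R]_(n, #|X|) := \matrix_(i, k) c i (enum_val k).
have : kermx C != 0.
  rewrite -mxrank_eq0 mxrank_ker subn_eq0 -ltnNge.
  exact: leq_ltn_trans (rank_leq_col _) nX.
move=> /rowV0Pn[v /sub_kermxP vC v0].
pose s := \sum_i v 0 i *: e i.
have s0 : ip s s = 0.
  apply: coefs_eq0; first exact: P_sum.
  rewrite (_ : (fun=> 0) = (fun x => \sum_i v 0 i * c i x)); first exact: coefs_sum.
  apply/funext => x; have /rowP/(_ (enum_rank x)) := vC.
  by rewrite !mxE => /esym; under eq_bigr do rewrite mxE enum_rankK.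
move: s0; rewrite orthonormal_norm // => /eqP.
rewrite psumr_eq0 => [/allP v2|i _]; last exact: sqr_ge0.
move: v0 => /negP; apply; apply/eqP/rowP => i; rewrite mxE; apply/eqP.
by have := v2 i (mem_index_enum i); rewrite /= sqrf_eq0.
Qed.

(** Take an orthonormal family of maximal size: a remainder of nonzero norm could be normalized and
    added to it. The form may be degenerate on functions defined on the whole space, so the
    remainder is only shown to have norm 0. *)
Lemma orthonormal_basis : exists n (e : 'I_n -> V), orthonormal e /\
  forall v, P v -> let r := v - \sum_i ip v (e i) *: e i in P r /\ ip r r = 0.
Proof.
pose Q n := `[< exists e : 'I_n -> V, orthonormal e >].
have Q0 : exists n, Q n.
  by exists 0%N; apply/asboolP; exists (fun=> 0); split=> -[].
have QX n : Q n -> (n <= #|X|)%N by move=> /asboolP[e]; exact: orthonormal_size.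
have [n /asboolP[e oe] nmax] := ex_maxnP Q0 QX.
have [Pe ee] := oe.
exists n, e; split => // v Pv r.
have Pr : P r by apply: PB => //; exact: P_sum.
split=> //; apply/eqP; apply: contraT => r0.
have rgt : 0 < ip r r by rewrite lt_neqAle eq_sym r0 ip_ge0.
have re j : ip r (e j) = 0.
  by rewrite ipBl ?orthonormal_coord ?subrr //; exact: P_sum.
pose k := Num.sqrt (ip r r).
have k0 : 0 < k by rewrite sqrtr_gt0.
have kk : k * k = ip r r by rewrite -expr2 sqr_sqrtr ?ltW.
(* The summand 0 gives the shape required by [PL] and [ipL]. *)
pose r' := k^-1 *: r + 0.
have Pr' : P r' by exact: PL.
have ipr' w : P w -> ip r' w = k^-1 * ip r w by move=> Pw; rewrite ipL // ip0l // addr0.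
pose e' (i : 'I_n.+1) := if unlift ord0 i is Some j then e j else r'.
have : Q n.+1.
  apply/asboolP; exists e'; split=> [i|i j]; rewrite /e'; first by case: unliftP.
  case: unliftP => [i' ->|->]; case: unliftP => [j' ->|->].
  - by rewrite ee (inj_eq lift_inj).
  - by rewrite ipC // ipr' // re mulr0 eq_sym (negbTE (neq_lift _ _)).
  - by rewrite ipr' // re mulr0 (negbTE (neq_lift _ _)).
  - by rewrite ipr' // ipC // ipr' // eqxx -kk mulKf ?mulVf ?lt0r_neq0.
by move=> /nmax; rewrite ltnn.
Qed.

End GramSchmidt.

Section NiceMatrices.
Variable R : realType.
Local Notation pt := 'rV[R]_3.
Local Notation mx := 'M[R]_3.
Variable A : set pt.
Hypothesis oA : open A.

Definition mnice m n (F : pt -> 'M[R]_(m, n)) := forall i j, nice A (fun x => F x i j).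

Lemma mniceD m n (F G : pt -> 'M[R]_(m, n)) : mnice F -> mnice G -> mnice (fun x => F x + G x).
Proof. by move=> nF nG i j; apply: eq_nice (niceD (nF i j) (nG i j)) => // x _; rewrite mxE. Qed.

Lemma mniceZ m n (f : pt -> R) (F : pt -> 'M[R]_(m, n)) :
  nice A f -> mnice F -> mnice (fun x => f x *: F x).
Proof. by move=> nf nF i j; apply: eq_nice (niceM nf (nF i j)) => // x _; rewrite mxE. Qed.

Lemma mniceN m n (F : pt -> 'M[R]_(m, n)) : mnice F -> mnice (fun x => - F x).
Proof. by move=> nF i j; apply: eq_nice (niceN oA (nF i j)) => // x _; rewrite mxE. Qed.

Lemma mniceB m n (F G : pt -> 'M[R]_(m, n)) : mnice F -> mnice G -> mnice (fun x => F x - G x).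
Proof. by move=> nF nG; apply: mniceD => //; exact: mniceN. Qed.

Lemma mniceM m n p (F : pt -> 'M[R]_(m, n)) (G : pt -> 'M[R]_(n, p)) :
  mnice F -> mnice G -> mnice (fun x => F x *m G x).
Proof.
move=> nF nG i j.
apply: (eq_nice oA (f := fun x => \sum_k F x i k * G x k j)) => [x _|]; first by rewrite mxE.
by apply: nice_sum => // k _; exact: niceM.
Qed.

Lemma mnice_tr m n (F : pt -> 'M[R]_(m, n)) : mnice F -> mnice (fun x => (F x)^T).
Proof. by move=> nF i j; apply: eq_nice (nF j i) => // x _; rewrite mxE. Qed.

Lemma mnice_sum m n (F : 'I_3 -> pt -> 'M[R]_(m, n)) : (forall k, mnice (F k)) ->
  mnice (fun x => \sum_k F k x).
Proof.
move=> nF i j; apply: (eq_nice oA (f := fun x => \sum_k F k x i j)) => [x _|].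
  by rewrite summxE.
by apply: nice_sum => // k _; exact: nF.
Qed.

Lemma nice_ddot (F G : pt -> mx) : mnice F -> mnice G -> nice A (fun x => ddot (F x) (G x)).
Proof.
move=> nF nG; apply: nice_sum => // i _; apply: nice_sum => // j _; exact: niceM.
Qed.

Lemma nice_dotv (u v : pt -> pt) : mnice u -> mnice v -> nice A (fun x => dotv (u x) (v x)).
Proof. by move=> nu nv; apply: nice_sum => // k _; exact: niceM. Qed.

Definition mdirnice m n (F : pt -> 'M[R]_(m, n)) := forall i j, dirnice A (fun x => F x i j).

Lemma mdirnice_mnice m n (F : pt -> 'M[R]_(m, n)) : mdirnice F -> mnice F.
Proof. by move=> dF i j; case: (dF i j). Qed.

Lemma mnice_gradv (v : pt -> pt) : mdirnice v -> mnice (gradv v).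
Proof.
move=> dv i j; have [_ _ H] := dv 0 i.
by apply: eq_nice (H j) => // x _; rewrite mxE.
Qed.

Lemma mnice_grad f : dirnice A f -> mnice (grad f).
Proof.
move=> [_ _ H] i j.
by apply: eq_nice (H j) => // x _; rewrite mxE.
Qed.

Lemma mnice_pdm k (F : pt -> mx) : mdirnice F -> mnice (pdm k F).
Proof.
move=> dF i j; have [_ _ H] := dF i j.
by apply: eq_nice (H k) => // x _; rewrite mxE.
Qed.

Lemma mnice_convect v (F : pt -> mx) : mnice v -> mdirnice F -> mnice (convect v F).
Proof. by move=> nv dF; apply: mnice_sum => k; apply: mniceZ; [exact: nv|exact: mnice_pdm]. Qed.

Lemma ddotDl (B C D : mx) : ddot (B + C) D = ddot B D + ddot C D.
Proof.
rewrite /ddot -big_split; apply: eq_bigr => i _; rewrite -big_split; apply: eq_bigr => j _ /=.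
by rewrite mxE mulrDl.
Qed.

Lemma ddotC (B C : mx) : ddot B C = ddot C B.
Proof. by apply: eq_bigr => i _; apply: eq_bigr => j _; rewrite mulrC. Qed.

Lemma ddotDr (B C D : mx) : ddot B (C + D) = ddot B C + ddot B D.
Proof. by rewrite ddotC ddotDl !(ddotC B). Qed.

Lemma ddotZl a (B C : mx) : ddot (a *: B) C = a * ddot B C.
Proof.
rewrite /ddot mulr_sumr; apply: eq_bigr => i _; rewrite mulr_sumr; apply: eq_bigr => j _.
by rewrite mxE mulrA.
Qed.

Lemma ddotZr a (B C : mx) : ddot B (a *: C) = a * ddot B C.
Proof. by rewrite ddotC ddotZl ddotC. Qed.

Lemma ddotNl (B C : mx) : ddot (- B) C = - ddot B C.
Proof. by rewrite -scaleN1r ddotZl mulN1r. Qed.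

Lemma ddotBl (B C D : mx) : ddot (B - C) D = ddot B D - ddot C D.
Proof. by rewrite ddotDl ddotNl. Qed.

Lemma ddotBr (B C D : mx) : ddot B (C - D) = ddot B C - ddot B D.
Proof. by rewrite ddotC ddotBl !(ddotC B). Qed.

Lemma ddot0r (B : mx) : ddot B 0 = 0.
Proof. by rewrite -(scale0r (0 : mx)) ddotZr mul0r. Qed.

Lemma ddot_ge0 (B : mx) : 0 <= ddot B B.
Proof. by apply: sumr_ge0 => i _; apply: sumr_ge0 => j _; rewrite -expr2 sqr_ge0. Qed.

Lemma ddot_eq0 (B : mx) : ddot B B = 0 -> B = 0.
Proof.
move=> /eqP; rewrite psumr_eq0 => [|i _]; last first.
  by apply: sumr_ge0 => j _; rewrite -expr2 sqr_ge0.
move=> /allP H; apply/matrixP => i j; rewrite mxE.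
have := H i (mem_index_enum i); rewrite /= psumr_eq0 => [|k _]; last by rewrite -expr2 sqr_ge0.
by move=> /allP /(_ j (mem_index_enum j)); rewrite /= mulf_eq0 orbb => /eqP.
Qed.

Lemma dotvDl (u v w : pt) : dotv (u + v) w = dotv u w + dotv v w.
Proof. by rewrite /dotv -big_split; apply: eq_bigr => k _; rewrite mxE mulrDl. Qed.

Lemma dotvC (u v : pt) : dotv u v = dotv v u.
Proof. by apply: eq_bigr => k _; rewrite mulrC. Qed.

Lemma dotvDr (u v w : pt) : dotv u (v + w) = dotv u v + dotv u w.
Proof. by rewrite dotvC dotvDl !(dotvC u). Qed.

Lemma dotvZl a (u v : pt) : dotv (a *: u) v = a * dotv u v.
Proof. by rewrite /dotv mulr_sumr; apply: eq_bigr => k _; rewrite mxE mulrA. Qed.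

Lemma dotvZr a (u v : pt) : dotv u (a *: v) = a * dotv u v.
Proof. by rewrite dotvC dotvZl dotvC. Qed.

Lemma dotvNl (u v : pt) : dotv (- u) v = - dotv u v.
Proof. by rewrite -scaleN1r dotvZl mulN1r. Qed.

Lemma dotvBl (u v w : pt) : dotv (u - v) w = dotv u w - dotv v w.
Proof. by rewrite dotvDl dotvNl. Qed.

Lemma dotvBr (u v w : pt) : dotv u (v - w) = dotv u v - dotv u w.
Proof. by rewrite dotvC dotvBl !(dotvC u). Qed.

Lemma dotv0r (u : pt) : dotv u 0 = 0.
Proof. by rewrite -(scale0r (0 : pt)) dotvZr mul0r. Qed.

Lemma dotv_ge0 (u : pt) : 0 <= dotv u u.
Proof. by apply: sumr_ge0 => k _; rewrite -expr2 sqr_ge0. Qed.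

Lemma pd_coordL m n a (F G : pt -> 'M[R]_(m, n)) i j k x : mdirnice F -> mdirnice G -> A x ->
  pd k (fun y => (a *: F + G) y i j) x =
  a * pd k (fun y => F y i j) x + pd k (fun y => G y i j) x.
Proof.
move=> dF dG Ax.
rewrite (_ : (fun y => _) = (fun y => a * F y i j + G y i j)); last first.
  by apply/funext => y; rewrite !mxE.
rewrite (pdD k (f := fun y => a * F y i j) (dirniceZ oA a (dF i j)) (dG i j) Ax).
by rewrite (pdZ a k (dF i j) Ax).
Qed.

Lemma gradvL a (u v : pt -> pt) x : mdirnice u -> mdirnice v -> A x ->
  gradv (a *: u + v) x = a *: gradv u x + gradv v x.
Proof.
by move=> du dv Ax; apply/matrixP => i j; rewrite !mxE pd_coordL.
Qed.

Lemma pdmL k a (F G : pt -> mx) x : mdirnice F -> mdirnice G -> A x ->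
  pdm k (a *: F + G) x = a *: pdm k F x + pdm k G x.
Proof. by move=> du dv Ax; apply/matrixP => i j; rewrite !mxE pd_coordL. Qed.

Lemma gradL a (f g : pt -> R^o) x : dirnice A f -> dirnice A g -> A x ->
  grad (a *: f + g) x = a *: grad f x + grad g x.
Proof.
move=> df dg Ax; apply/rowP => k; rewrite !mxE.
have := pdD k (dirniceZ oA a df) dg Ax; rewrite (pdZ a k df Ax); exact.
Qed.

Lemma gradv0 (u : pt -> pt) x : (forall y, A y -> u y = 0) -> A x -> gradv u x = 0.
Proof.
move=> u0 Ax; apply/matrixP => i j; rewrite !mxE.
rewrite (eq_pd (g := fun=> 0) j oA _ Ax) => [|y Ay]; last by rewrite u0 // mxE.
exact: derive_cst.
Qed.

Lemma pdm0 k (F : pt -> mx) x : (forall y, A y -> F y = 0) -> A x -> pdm k F x = 0.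
Proof.
move=> u0 Ax; apply/matrixP => i j; rewrite !mxE.
rewrite (eq_pd (g := fun=> 0) k oA _ Ax) => [|y Ay]; last by rewrite u0 // mxE.
exact: derive_cst.
Qed.

Lemma grad0 (f : pt -> R) x : (forall y, A y -> f y = 0) -> A x -> grad f x = 0.
Proof.
move=> u0 Ax; apply/rowP => k; rewrite !mxE.
rewrite (eq_pd (g := fun=> 0) k oA u0 Ax); exact: derive_cst.
Qed.

End NiceMatrices.

Section Spaces.
Variable R : realType.
Local Notation pt := 'rV[R]_3.
Local Notation mx := 'M[R]_3.
Variables (Omega : set pt) (Th : mesh R).
Hypothesis oO : open Omega.
Hypothesis bO : bounded_set Omega.

Lemma polynomial_onL l K a (s t : pt -> R) : polynomial_on l K s -> polynomial_on l K t ->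
  polynomial_on l K (fun x => a * s x + t x).
Proof.
move=> [q ql Hq] [r rl Hr]; exists (a *: q + r).
  apply: leq_trans (mmeasureD_le _ _ _) _; rewrite geq_max rl andbT.
  exact: leq_trans (mmeasureZ_le _ _ _) ql.
by move=> x Kx; rewrite mevalD mevalZ Hq // Hr.
Qed.

Lemma polynomial_on0 l (K : tetrahedron R) : polynomial_on l K (fun=> 0).
Proof.
by exists 0 => [|x _]; [rewrite mmeasure0|rewrite meval0].
Qed.

Lemma continuous_withinL (m n : nat) a (F G : pt -> 'M[R]_(m, n)) (K : set pt) :
  {within K, continuous F} -> {within K, continuous G} ->
  {within K, continuous (a *: F + G)}.
Proof.
move=> cF cG x; apply: continuous_at_mx => i j.
apply: (@eq_continuous_at _ _ (fun y : subspace K => a * F y i j + G y i j)).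
  by move=> y; rewrite !mxE.
apply: continuous_atD; last exact: continuous_at_coord (cG x).
by apply: continuous_atM; [exact: continuous_at_cst|exact: continuous_at_coord (cF x)].
Qed.

Lemma ShL a (s t : pt -> R^o) : Sh Omega Th s -> Sh Omega Th t -> Sh Omega Th (a *: s + t).
Proof.
move=> [cs ps] [ct pt_]; split; last by move=> i; exact: polynomial_onL.
move=> x; apply: (@continuous_atD R (subspace (closure Omega)) (fun y => a * s y) t x); last exact: ct.
by apply: continuous_atM; [exact: continuous_at_cst|exact: cs].
Qed.

Lemma Sh0 : Sh Omega Th (0 : pt -> R^o).
Proof.
split; last by move=> i; exact: polynomial_on0.
move=> x; exact: (@continuous_at_cst (subspace (closure Omega)) R 0 x).
Qed.

Lemma XhL a (F G : pt -> mx) : Xh Omega Th F -> Xh Omega Th G -> Xh Omega Th (a *: F + G).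
Proof.
move=> [cF pF] [cG pG]; split; first exact: continuous_withinL.
move=> c i j; have := polynomial_onL a (pF c i j) (pG c i j).
rewrite (_ : (fun x => (a *: F + G) x i j) = (fun x => a * F x i j + G x i j)) //.
by apply/funext => x; rewrite !mxE.
Qed.

Lemma Xh0 : Xh Omega Th (0 : pt -> mx).
Proof.
split; first by move=> x; exact: (@continuous_at_cst (subspace (closure Omega)) mx 0 x).
move=> c i j; rewrite (_ : (fun x => _) = (fun=> 0)); first exact: polynomial_on0.
by apply/funext => x; rewrite mxE.
Qed.

Lemma VhL a (u v : pt -> pt) : Vh Omega Th u -> Vh Omega Th v -> Vh Omega Th (a *: u + v).
Proof.
have [r Or] := bounded_ball bO.
move=> [cu hu pu] [cv hv pv].
have E k : (fun x => (a *: u + v) x 0 k) = (fun x => a * u x 0 k + v x 0 k).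
  by apply/funext => x; rewrite !mxE.
split; first exact: continuous_withinL.
- by move=> k; rewrite E; apply: (H10D oO Or); [apply: (H10Z oO Or); exact: hu|exact: hv].
- by move=> i k; rewrite E; exact: polynomial_onL.
Qed.

Lemma test0 : test_function Omega (fun=> 0).
Proof.
split; last by exists set0; split => //; exact: compact0.
have E ks : foldr pd (fun=> 0) ks = (fun=> 0 : R).
  by elim: ks => //= k ks ->; apply/funext => x; exact: derive_cst.
by move=> ks x; rewrite E; exact: differentiable_cst.
Qed.

Lemma H10_0 : H10 Omega (fun=> 0).
Proof.
have [r Or] := bounded_ball bO.
have L0 : L2fun Omega (fun=> 0) by apply: (nice_L2 oO Or); exact: nice_cst.
have p0 k : pd k (fun=> 0 : R) = (fun=> 0) by apply/funext => x; exact: derive_cst.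
have I0 (f : pt -> R) : f = (fun=> 0) -> int3 Omega f = 0 by move=> ->; exact: int3_0.
split=> //; exists (fun _ _ => 0); split=> [k|].
  split=> // f tf; rewrite !I0 ?oppr0 //; apply/funext => x; by rewrite mul0r.
exists (fun _ _ => 0); split=> [n||k]; first exact: test0.
- rewrite (_ : (fun n => _) = (fun=> 0)); first exact: cvg_cst.
  by apply/funext => n; apply: I0; apply/funext => x; rewrite subrr expr0n.
- rewrite (_ : (fun n => _) = (fun=> 0)); first exact: cvg_cst.
  by apply/funext => n; apply: I0; apply/funext => x; rewrite p0 subrr expr0n.
Qed.

Lemma Vh0 : Vh Omega Th (0 : pt -> pt).
Proof.
have E k : (fun x => (0 : pt -> pt) x 0 k) = (fun=> 0) by apply/funext => x; rewrite mxE.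
split; first by move=> x; exact: (@continuous_at_cst (subspace (closure Omega)) pt 0 x).
- by move=> k; rewrite E; exact: H10_0.
- by move=> i k; rewrite E; exact: polynomial_on0.
Qed.

Local Notation A := (cells Omega Th).

Lemma Sh_dirnice s : Sh Omega Th s -> dirnice A s.
Proof. by move=> [_ ps]; exact: polynomial_dirnice ps. Qed.

Lemma Xh_dirnice F : Xh Omega Th F -> mdirnice A F.
Proof. by move=> [_ ps] i j; apply: polynomial_dirnice => // c; exact: ps. Qed.

Lemma Vh_dirnice v : Vh Omega Th v -> mdirnice A v.
Proof. by move=> [_ _ ps] i j; rewrite ord1; apply: polynomial_dirnice => // c; exact: ps. Qed.

End Spaces.

Section Coefficients.
Variable R : realType.
Local Notation pt := 'rV[R]_3.
Variables (Omega : set pt) (Th : mesh R).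
Local Notation nc := (ncells Th).

(** The monomial coefficients cell by cell. [mmeasure mdeg] is the degree plus one and
    [bmultinom 3 l.+1] the multi-indices of degree below [l.+1], so both mean degree at most [l]. *)
Definition scoefs l (s : pt -> R) (c : 'I_nc * bmultinom 3 l.+1 -> R) :=
  forall i : 'I_nc, exists2 q : mpoly 3 R, (mmeasure mdeg q <= l.+1)%N &
    (forall x, hull (cell i) x -> s x = pev q x) /\ forall m, c (i, m) = mcoeff (bmnm m) q.

Lemma scoefs_ex l s : (forall i : 'I_nc, polynomial_on l (cell i) s) -> exists c, scoefs (l := l) s c.
Proof.
move=> H; have /choice[q Hq] : forall i : 'I_nc, exists q : mpoly 3 R,
    (mmeasure mdeg q <= l.+1)%N /\ (forall x, hull (cell i) x -> s x = pev q x).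
  by move=> i; have [q ql Hq] := H i; exists q.
exists (fun p => mcoeff (bmnm p.2) (q p.1)) => i.
by have [ql sq] := Hq i; exists (q i).
Qed.

Lemma scoefsL l a s t c d : scoefs (l := l) s c -> scoefs (l := l) t d ->
  scoefs (l := l) (fun x => a * s x + t x) (fun p => a * c p + d p).
Proof.
move=> Hs Ht i; have [q ql [sq cq]] := Hs i; have [r rl [tr dr]] := Ht i.
exists (a *: q + r).
  apply: leq_trans (mmeasureD_le _ _ _) _; rewrite geq_max rl andbT.
  exact: leq_trans (mmeasureZ_le _ _ _) ql.
split=> [x Hx|m]; last by rewrite cq dr mcoeffD mcoeffZ.
by rewrite /pev mevalD mevalZ sq // tr.
Qed.

Lemma scoefs0 l : scoefs (l := l) (fun=> 0) (fun=> 0).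
Proof.
move=> i; exists 0; first by rewrite mmeasure0.
by split=> [x _|m]; [rewrite /pev meval0|rewrite mcoeff0].
Qed.

Lemma scoefs_eq0 l s : scoefs (l := l) s (fun=> 0) ->
  forall x, cells Omega Th x -> s x = 0.
Proof.
move=> H x [_ [i _ /ocell_hull Hx]]; have [q ql [-> // cq]] := H i.
rewrite /pev (_ : q = 0) ?meval0 //; apply/mpolyP => m; rewrite mcoeff0.
have [ml|ml] := ltnP (mdeg m) l.+1.
  by have := cq (BMultinom ml).
by apply: memN_msupp_eq0; apply: (@mmeasure_mnm_ge _ _ mdeg); exact: leq_trans ml.
Qed.

End Coefficients.

(** * Linear functionals on pairs of a tensor and a scalar function *)

Section Forms.
Variable R : realType.
Local Notation pt := 'rV[R]_3.
Local Notation mx := 'M[R]_3.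
Variables (Omega : set pt) (Th : mesh R).
Hypothesis oO : open Omega.
Hypothesis bO : bounded_set Omega.

Local Notation A := (cells Omega Th).

Lemma A_ball : exists a, A `<=` ball 0 a.
Proof. by have [a Oa] := bounded_ball bO; exists a => x [/Oa]. Qed.

Let oA : open A := cells_open oO.
Let ra : R := sval (cid A_ball).
Let Aa : A `<=` ball 0 ra := svalP (cid A_ball).

(** One vector space for the two pairs that are dual to each other in the scheme: the increments of
    (F, phi) and the potentials (M, mu). *)
Definition Wt : lmodType R := ((pt -> mx) * (pt -> R^o))%type.
Implicit Types w : Wt.

Definition PW w := Xh Omega Th w.1 /\ Sh Omega Th w.2.

Lemma PW0 : PW 0.
Proof. by split; [exact: Xh0|exact: Sh0]. Qed.

Lemma PWL a w w' : PW w -> PW w' -> PW (a *: w + w').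
Proof. by move=> [? ?] [? ?]; split; [exact: XhL|exact: ShL]. Qed.

Lemma PW1 w : PW w -> mdirnice A w.1.
Proof. by move=> [/(Xh_dirnice oO bO)]. Qed.

Lemma PW2 w : PW w -> dirnice A w.2.
Proof. by move=> [_ /(Sh_dirnice oO bO)]. Qed.

(** The general first-order linear integrand. The L2 product, the energy gradient, the coupling with
    a given velocity and the dissipation are all instances, so linearity and the vanishing on
    functions that are zero on [cells] are proved once. *)
Definition uform (al : pt -> mx) (be : 'I_3 -> pt -> mx) (rh : pt -> R) (si : pt -> pt) w (x : pt) : R :=
  ddot (al x) (w.1 x) + (\sum_k ddot (be k x) (pdm k w.1 x)) + rh x * w.2 x + dotv (si x) (grad w.2 x).

Definition ucoefs (al : pt -> mx) (be : 'I_3 -> pt -> mx) (rh : pt -> R) (si : pt -> pt) :=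
  [/\ mnice A al, forall k, mnice A (be k), nice A rh & mnice A si].

Lemma uform_nice (al : pt -> mx) be rh si w : ucoefs al be rh si -> PW w -> nice A (uform al be rh si w).
Proof.
move=> [nal nbe nrh nsi] Pw; have d1 := PW1 Pw; have d2 := PW2 Pw.
apply: niceD; last by apply: nice_dotv => //; exact: mnice_grad.
apply: niceD; last by apply: niceM => //; case: d2.
apply: niceD; first by apply: nice_ddot => //; exact: mdirnice_mnice.
by apply: nice_sum => // k _; apply: nice_ddot => //; exact: mnice_pdm.
Qed.

Lemma uformL al be rh si a w w' x : PW w -> PW w' -> A x ->
  uform al be rh si (a *: w + w') x = a * uform al be rh si w x + uform al be rh si w' x.
Proof.
move=> Pw Pw' Ax; rewrite /uform.
have -> : grad (a *: w + w').2 x = a *: grad w.2 x + grad w'.2 x.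
  by apply: (gradL oA a (PW2 Pw) (PW2 Pw')).
have -> : (a *: w + w').1 x = a *: w.1 x + w'.1 x by [].
have -> : (a *: w + w').2 x = a * w.2 x + w'.2 x by [].
rewrite (eq_bigr (fun k => a * ddot (be k x) (pdm k w.1 x) + ddot (be k x) (pdm k w'.1 x))).
  rewrite big_split -mulr_sumr /= ddotDr ddotZr dotvDr dotvZr; ring.
move=> k _; rewrite -ddotZr -ddotDr; congr ddot.
exact: (pdmL oA k a (PW1 Pw) (PW1 Pw')).
Qed.

Definition zero_on_A w := forall x, A x -> w.1 x = 0 /\ w.2 x = 0.

Lemma uform0 al be rh si w x : zero_on_A w -> A x -> uform al be rh si w x = 0.
Proof.
move=> w0 Ax; have [w1 w2] := w0 x Ax; rewrite /uform w1 w2 ddot0r mulr0.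
rewrite (grad0 oA _ Ax) => [|y /w0[]//]; rewrite dotv0r big1 ?addr0 // => k _.
by rewrite (pdm0 oA k _ Ax) ?ddot0r // => y /w0[].
Qed.

Definition U al be rh si w := \int3_(x in A) uform al be rh si w x.

Lemma U_L al be rh si a w w' : ucoefs al be rh si -> PW w -> PW w' ->
  U al be rh si (a *: w + w') = a * U al be rh si w + U al be rh si w'.
Proof.
move=> H Pw Pw'; have n1 := uform_nice H Pw; have n2 := uform_nice H Pw'.
rewrite /U -(int3Z oA Aa) // -(int3D oA Aa) //; last exact: niceZ.
by apply: eq_int3 => x Ax; exact: uformL.
Qed.

Lemma U_0 al be rh si w : zero_on_A w -> U al be rh si w = 0.
Proof.
move=> w0; rewrite /U -[RHS](int3_0 oA); apply: eq_int3 => x Ax; exact: uform0.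
Qed.

Definition ipW w w' := \int3_(x in A) (ddot (w.1 x) (w'.1 x) + w.2 x * w'.2 x).

Lemma ipW_U w w' : ipW w w' = U w.1 (fun _ _ => 0) w.2 (fun=> 0) w'.
Proof.
apply: eq_int3 => x _; rewrite /uform.
by rewrite big1 ?addr0 => [|k _]; rewrite ?(dotvC 0) ?dotv0r ?addr0 // ddotC ddot0r.
Qed.

Lemma mnice0 m n : mnice A (fun=> 0 : 'M[R]_(m, n)).
Proof. by move=> i j; apply: (eq_nice oA _ (nice_cst A 0)) => x _; rewrite mxE. Qed.

Lemma ipW_coefs w : PW w -> ucoefs w.1 (fun _ _ => 0) w.2 (fun=> 0).
Proof.
move=> Pw; split; [exact/mdirnice_mnice/PW1|by move=> k; exact: mnice0| |exact: mnice0].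
by case: (PW2 Pw).
Qed.

Lemma ipWC w w' : ipW w w' = ipW w' w.
Proof. by apply: eq_int3 => x _; rewrite ddotC mulrC. Qed.

Lemma ipWL a u v w : PW u -> PW v -> PW w -> ipW (a *: u + v) w = a * ipW u w + ipW v w.
Proof. by move=> Pu Pv Pw; rewrite ![ipW _ w]ipWC !(ipW_U w) U_L //; exact: ipW_coefs. Qed.

Lemma ipW_ge0 w : 0 <= ipW w w.
Proof. by apply: int3_ge0 => x _; rewrite addr_ge0 ?ddot_ge0 // -expr2 sqr_ge0. Qed.

Lemma ipW_eq0 w : PW w -> ipW w w = 0 -> zero_on_A w.
Proof.
move=> Pw H x Ax.
have n : nice A (fun x => ddot (w.1 x) (w.1 x) + w.2 x * w.2 x).
  apply: niceD; first by apply: nice_ddot => //; exact/mdirnice_mnice/PW1.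
  by apply: niceM; case: (PW2 Pw).
have n0 y : A y -> 0 <= ddot (w.1 y) (w.1 y) + w.2 y * w.2 y.
  by move=> _; rewrite addr_ge0 ?ddot_ge0 // -expr2 sqr_ge0.
have := int3_eq0 oA Aa n n0 H Ax; rewrite -expr2 => /eqP.
rewrite paddr_eq0 ?ddot_ge0 ?sqr_ge0 // sqrf_eq0 => /andP[/eqP /ddot_eq0 -> /eqP ->].
by [].
Qed.

Lemma W_basis : exists d (e : 'I_d -> Wt), orthonormal PW ipW e /\
  forall w, PW w -> let r := w - \sum_i ipW w (e i) *: e i in PW r /\ zero_on_A r.
Proof.
pose X : finType := ((('I_3 * 'I_3) + unit) * ('I_(ncells Th) * bmultinom 3 2))%type.
pose coefs w (c : X -> R) := (forall i j, scoefs (l := 1) (fun x => w.1 x i j) (fun p => c (inl (i, j), p))) /\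
  scoefs (l := 1) w.2 (fun p => c (inr tt, p)).
have H1 u v : PW u -> PW v -> ipW u v = ipW v u by move=> _ _; exact: ipWC.
have H2 u : PW u -> 0 <= ipW u u by move=> _; exact: ipW_ge0.
have c0 : coefs 0 (fun=> 0).
  split; last exact: scoefs0.
  move=> i j; rewrite (_ : (fun x => _) = (fun=> 0)); first exact: scoefs0.
  by apply/funext => x; rewrite mxE.
have cL a u v c d : coefs u c -> coefs v d -> coefs (a *: u + v) (fun x => a * c x + d x).
  move=> [u1 u2] [v1 v2]; split; last exact: scoefsL u2 v2.
  move=> i j; rewrite (_ : (fun x => _) = (fun x => a * u.1 x i j + v.1 x i j)).
    exact: scoefsL (u1 i j) (v1 i j).
  by apply/funext => x; rewrite !mxE.
have cex u : PW u -> exists c, coefs u c.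
  move=> [[_ p1] [_ p2]].
  have /choice[c1 Hc1] : forall ij : 'I_3 * 'I_3, 
      exists c : 'I_(ncells Th) * bmultinom 3 2 -> R, scoefs (l := 1) (fun x => u.1 x ij.1 ij.2) c.
    by move=> [i j]; apply: scoefs_ex => k; exact: p1.
  have [c2 Hc2] := scoefs_ex p2.
  exists (fun p : X => match p.1 with inl ij => c1 ij p.2 | inr _ => c2 p.2 end).
  by split=> [i j|]; [exact: (Hc1 (i, j))|exact: Hc2].
have c00 u : PW u -> coefs u (fun=> 0) -> ipW u u = 0.
  move=> Pu [u1 u2]; rewrite ipW_U; apply: U_0 => x Ax; split; last exact: scoefs_eq0 u2 x Ax.
  by apply/matrixP => i j; rewrite mxE; exact: scoefs_eq0 (u1 i j) x Ax.
have [d [e [oe He]]] := orthonormal_basis PW0 PWL ipWL H1 H2 c0 cL cex c00.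
exists d, e; split => // w Pw; have [Pr r0] := He w Pw; split => //.
exact: ipW_eq0.
Qed.

End Forms.

Section LinearExpansion.
Variables (R : realType) (V : lmodType R) (P : V -> Prop) (Phi : V -> R).
Hypothesis P0 : P 0.
Hypothesis PL : forall a u v, P u -> P v -> P (a *: u + v).
Hypothesis PhiL : forall a u v, P u -> P v -> Phi (a *: u + v) = a * Phi u + Phi v.

Lemma linear_on_sum n (a : 'I_n -> R) (e : 'I_n -> V) : (forall i, P (e i)) ->
  Phi (\sum_i a i *: e i) = \sum_i a i * Phi (e i).
Proof.
have Phi0 : Phi 0 = 0.
  by have := PhiL (-1) P0 P0; rewrite scaler0 addr0 mulN1r addNr.
move=> Pe; elim: n a e Pe => [|n IH] a e Pe; first by rewrite !big_ord0.
rewrite !big_ord_recl PhiL ?IH //.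
by elim/big_rec: _ => // i v _ Pv; exact: PL.
Qed.

Lemma linear_on_expand n (a : 'I_n -> R) (e : 'I_n -> V) w : (forall i, P (e i)) -> P w ->
  P (w - \sum_i a i *: e i) -> Phi (w - \sum_i a i *: e i) = 0 ->
  Phi w = \sum_i a i * Phi (e i).
Proof.
move=> Pe Pw Pr r0; rewrite -linear_on_sum //.
have Ps : P (\sum_i a i *: e i) by elim/big_rec: _ => // i v _ Pv; exact: PL.
have {1}-> : w = 1 *: (w - \sum_i a i *: e i) + \sum_i a i *: e i by rewrite scale1r subrK.
by rewrite PhiL // r0 mulr0 add0r.
Qed.

End LinearExpansion.

(** * Velocities, their gradient product, and the pressure *)

Section Velocity.
Variable R : realType.
Local Notation pt := 'rV[R]_3.
Local Notation mx := 'M[R]_3.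
Variables (Omega : set pt) (Th : mesh R).
Hypothesis oO : open Omega.
Hypothesis cO : connected Omega.
Hypothesis nO : Omega !=set0.
Hypothesis bO : bounded_set Omega.
Hypothesis cover : closure Omega = \bigcup_i hull (cell (m := Th) i).

Local Notation A := (cells Omega Th).
Let oA : open A := cells_open oO.
Let ra : R := sval (cid (@A_ball _ _ Th bO)).
Let Aa : A `<=` ball 0 ra := svalP (cid (@A_ball _ _ Th bO)).

Definition Vt : lmodType R := (pt -> pt)%type.
Local Notation Vh := (@Vh R Omega Th : Vt -> Prop).
Implicit Types u v : Vt.

Definition vform (al : pt -> mx) (si : pt -> pt) u (x : pt) : R :=
  ddot (al x) (gradv u x) + dotv (si x) (u x).

Lemma vform_nice al si u : mnice A al -> mnice A si -> Vh u -> nice A (vform al si u).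
Proof.
move=> nal nsi /(Vh_dirnice oO bO) du; apply: niceD.
  by apply: nice_ddot => //; exact: mnice_gradv.
by apply: nice_dotv => //; exact: mdirnice_mnice.
Qed.

Definition Vf al si u := \int3_(x in A) vform al si u x.

Lemma VfL al si a u v : mnice A al -> mnice A si -> Vh u -> Vh v ->
  Vf al si (a *: u + v) = a * Vf al si u + Vf al si v.
Proof.
move=> nal nsi Pu Pv; have n1 := vform_nice nal nsi Pu; have n2 := vform_nice nal nsi Pv.
rewrite /Vf -(int3Z oA Aa) // -(int3D oA Aa) //; last exact: niceZ.
apply: eq_int3 => x Ax; rewrite /vform.
rewrite (gradvL oA a (Vh_dirnice oO bO Pu) (Vh_dirnice oO bO Pv)) //.
have -> : (a *: u + v) x = a *: u x + v x by [].
rewrite ddotDr ddotZr dotvDr dotvZr; ring.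
Qed.

Lemma Vf0 al si u : (forall x, A x -> u x = 0) -> Vf al si u = 0.
Proof.
move=> u0; rewrite /Vf -[RHS](int3_0 oA); apply: eq_int3 => x Ax.
by rewrite /vform (gradv0 oA u0 Ax) ddot0r u0 // dotv0r addr0.
Qed.

Definition ipV nu u v := nu * \int3_(x in A) ddot (gradv u x) (gradv v x).

Lemma ipVC nu u v : ipV nu u v = ipV nu v u.
Proof.
rewrite /ipV (eq_int3 (g := fun x => ddot (gradv v x) (gradv u x))) // => x _.
exact: ddotC.
Qed.

Lemma ipV_Vf nu u v : ipV nu u v = nu * Vf (gradv u) (fun=> 0) v.
Proof.
congr (_ * _); apply: eq_int3 => x _.
by rewrite /vform (dotvC 0) dotv0r addr0.
Qed.

Lemma zero_gradv u : Vh u -> (forall x, A x -> gradv u x = 0) -> forall x, A x -> u x = 0.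
Proof.
move=> [_ hu pu] du x [Ox _]; apply/rowP => k; rewrite mxE.
apply: (zero_gradient_H10 oO cO nO bO cover (hu k) (fun i => pu i k)) => // y j Ay.
by have /matrixP/(_ k j) := du y Ay; rewrite !mxE.
Qed.

(** The subspace [P] is a parameter: the whole velocity space serves for the pressure, the
    discretely divergence-free fields for the solution of the scheme. *)
Lemma V_basis nu (P : Vt -> Prop) : 0 < nu -> P 0 ->
  (forall a u v, P u -> P v -> P (a *: u + v)) -> (forall u, P u -> Vh u) ->
  exists d (e : 'I_d -> Vt), orthonormal P (ipV nu) e /\
  forall u, P u -> let r := u - \sum_i ipV nu u (e i) *: e i in P r /\ forall x, A x -> r x = 0.
Proof.
move=> nu0 P0 PL PV.
pose X : finType := ('I_3 * ('I_(ncells Th) * bmultinom 3 3))%type.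
pose coefs u (c : X -> R) := forall k, scoefs (l := 2) (fun x => u x 0 k) (fun p => c (k, p)).
have H0 a u v w : P u -> P v -> P w -> ipV nu (a *: u + v) w = a * ipV nu u w + ipV nu v w.
  move=> /PV Pu /PV Pv /PV Pw.
  rewrite ![ipV nu _ w]ipVC !(ipV_Vf nu w) VfL //; first by ring.
    exact/mnice_gradv/(Vh_dirnice oO bO).
  exact: mnice0.
have H1 u v : P u -> P v -> ipV nu u v = ipV nu v u.
  by move=> _ _; exact: ipVC.
have H2 u : P u -> 0 <= ipV nu u u.
  by move=> _; apply: mulr_ge0; [exact: ltW|apply: int3_ge0 => x _; exact: ddot_ge0].
have c0 : coefs 0 (fun=> 0).
  move=> k; rewrite (_ : (fun x => _) = (fun=> 0)); first exact: scoefs0.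
  by apply/funext => x; rewrite mxE.
have cL a u v c d : coefs u c -> coefs v d -> coefs (a *: u + v) (fun x => a * c x + d x).
  move=> u1 v1 k; rewrite (_ : (fun x => _) = (fun x => a * u x 0 k + v x 0 k)).
    exact: scoefsL (u1 k) (v1 k).
  by apply/funext => x; rewrite !mxE.
have cex u : P u -> exists c, coefs u c.
  move=> /PV[_ _ pu].
  have /choice[c Hc] : forall k : 'I_3,
      exists c : 'I_(ncells Th) * bmultinom 3 3 -> R, scoefs (l := 2) (fun x => u x 0 k) c.
    by move=> k; apply: scoefs_ex => i; exact: pu.
  by exists (fun p : X => c p.1 p.2).
have c00 u : P u -> coefs u (fun=> 0) -> ipV nu u u = 0.
  move=> Pu cu; rewrite ipV_Vf Vf0 ?mulr0 // => x Ax.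
  by apply/rowP => k; rewrite mxE; exact: scoefs_eq0 (cu k) x Ax.
have [d [e [oe He]]] := orthonormal_basis P0 PL H0 H1 H2 c0 cL cex c00.
exists d, e; split => // u Pu; have [Pr /eqP r0] := He u Pu; split => //.
apply: zero_gradv; first exact: PV.
move: r0; rewrite mulf_eq0 (gt_eqF nu0) /= => /eqP r0 x Ax.
have /PV/(Vh_dirnice oO bO)/(mnice_gradv oA) ng := Pr.
by apply: ddot_eq0; apply: (int3_eq0 oA Aa (nice_ddot oA ng ng) (fun _ _ => ddot_ge0 _) r0 Ax).
Qed.

Local Notation Qt := (pt -> R^o)%type.
Local Notation Rh := (@Rh R Omega Th : Qt -> Prop).

Lemma Rh0 : Rh 0.
Proof. by split; [exact: Sh0|exact: int3_0]. Qed.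

Lemma RhL a (p q : Qt) : Rh p -> Rh q -> Rh (a *: p + q).
Proof.
move=> [Sp p0] [Sq q0]; split; first exact: ShL.
have [np _ _] := Sh_dirnice oO bO Sp; have [nq _ _] := Sh_dirnice oO bO Sq.
move: p0 q0; rewrite !(int3_cells oO cover) => p0 q0.
rewrite (_ : (fun x => _) = (fun x => a * p x + q x)) //.
by rewrite (int3D oA Aa) ?(int3Z oA Aa) ?p0 ?q0 ?mulr0 ?addr0 //; exact: niceZ.
Qed.

Definition ipQ (p q : Qt) := \int3_(x in A) (p x * q x).

Lemma ipQL a (p q r : Qt) f : nice A f -> Rh p -> Rh q ->
  \int3_(x in A) ((a *: p + q) x * f x) = a * \int3_(x in A) (p x * f x) + \int3_(x in A) (q x * f x).
Proof.
move=> nf [Sp _] [Sq _].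
have [np _ _] := Sh_dirnice oO bO Sp; have [nq _ _] := Sh_dirnice oO bO Sq.
have n1 : nice A (fun x => p x * f x) by exact: niceM.
have n2 : nice A (fun x => q x * f x) by exact: niceM.
rewrite -(int3Z oA Aa) // -(int3D oA Aa) //; last exact: niceZ.
by apply: eq_int3 => x _; rewrite mulrA -mulrDl.
Qed.

Lemma Q_basis : exists d (e : 'I_d -> Qt), orthonormal Rh ipQ e /\
  forall p, Rh p -> let r := p - \sum_i ipQ p (e i) *: e i in Rh r /\ forall x, A x -> r x = 0.
Proof.
pose X : finType := ('I_(ncells Th) * bmultinom 3 2)%type.
pose coefs (u : Qt) (c : X -> R) := scoefs (l := 1) u c.
have nR p : Rh p -> nice A p by move=> [/(Sh_dirnice oO bO)[]].
have H0 a (u v w : Qt) : Rh u -> Rh v -> Rh w -> ipQ (a *: u + v) w = a * ipQ u w + ipQ v w.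
  by move=> Pu Pv /nR nw; exact: ipQL.
have H1 (u v : Qt) : Rh u -> Rh v -> ipQ u v = ipQ v u.
  by move=> _ _; apply: eq_int3 => x _; rewrite mulrC.
have H2 (u : Qt) : Rh u -> 0 <= ipQ u u.
  by move=> _; apply: int3_ge0 => x _; rewrite -expr2 sqr_ge0.
have c0 : coefs 0 (fun=> 0) by exact: scoefs0.
have cL a (u v : Qt) c d : coefs u c -> coefs v d -> coefs (a *: u + v) (fun x => a * c x + d x).
  exact: scoefsL.
have cex (u : Qt) : Rh u -> exists c, coefs u c by move=> [[_ pu] _]; exact: scoefs_ex.
have c00 (u : Qt) : Rh u -> coefs u (fun=> 0) -> ipQ u u = 0.
  move=> Pu cu; rewrite /ipQ -[RHS](int3_0 oA); apply: eq_int3 => x Ax.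
  by rewrite (scoefs_eq0 cu Ax) mulr0.
have [d [e [oe He]]] := orthonormal_basis Rh0 RhL H0 H1 H2 c0 cL cex c00.
exists d, e; split => // p Pp; have [Pr r0] := He p Pp; split => // x Ax.
have nr := nR _ Pr.
have := int3_eq0 oA Aa (niceM nr nr) (fun y _ => _) r0 Ax.
by move=> /(_ (fun y => sqr_ge0 _)) /eqP; rewrite mulf_eq0 orbb => /eqP.
Qed.

Lemma divvE (c : R) u x : c * divv u x = ddot (c *: 1%:M) (gradv u x).
Proof.
rewrite ddotZl; congr (_ * _); rewrite /ddot; apply: eq_bigr => i _.
rewrite (bigD1 i) //= !mxE eqxx mul1r big1 ?addr0 // => j ji.
by rewrite !mxE eq_sym (negbTE ji) mul0r.
Qed.

Lemma int3_div_Vf (s : pt -> R) u :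
  \int3_(x in A) (s x * divv u x) = Vf (fun x => s x *: 1%:M) (fun=> 0) u.
Proof.
by apply: eq_int3 => x _; rewrite /vform divvE (dotvC 0) dotv0r addr0.
Qed.

Lemma mnice_scalar s : nice A s -> mnice A (fun x => s x *: (1%:M : mx)).
Proof. by move=> ns; apply: mniceZ => // i j; exact: nice_cst. Qed.

Lemma nice_divv u : Vh u -> nice A (divv u).
Proof.
move=> /(Vh_dirnice oO bO) du; apply: nice_sum => // k _.
by have [_ _] := du 0 k; apply.
Qed.

(* The functionals [u |-> int p div u], [p] in [R_h], span the annihilator of
   their common kernel. *)
Lemma pressure_exists al si : mnice A al -> mnice A si ->
  (forall u, Vh u -> (forall p, Rh p -> \int3_(x in A) (p x * divv u x) = 0) -> Vf al si u = 0) ->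
  exists s, Rh s /\ forall u, Vh u -> Vf al si u = \int3_(x in A) (s x * divv u x).
Proof.
move=> nal nsi H.
have [n [g [[Pg gg] Hg]]] := V_basis ltr01 (Vh0 Th oO bO) (@VhL R Omega Th oO bO) (fun _ => id).
have [k [q [[Pq qq] Hq]]] := Q_basis.
have nR p : Rh p -> nice A p by move=> [/(Sh_dirnice oO bO)[]].
pose Bm : 'M[R]_(n, k) := \matrix_(i, j) \int3_(x in A) (q j x * divv (g i) x).
pose l : 'cV[R]_n := \col_i Vf al si (g i).
have ker (y : 'rV_n) : y *m Bm = 0 -> y *m l = 0.
  move=> yB; pose u : Vt := \sum_i y 0 i *: g i.
  have Pu : Vh u by apply: (P_sum (P := Vh)) => //; [exact: Vh0|move=> *; exact: VhL].
  have lu (al' : pt -> mx) (si' : pt -> pt) : mnice A al' -> mnice A si' ->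
      Vf al' si' u = \sum_i y 0 i * Vf al' si' (g i).
    move=> na ns; apply: (@linear_on_sum R Vt Vh (Vf al' si')) => //.
    - exact: Vh0.
    - by move=> a v w; exact: VhL.
    - by move=> a v w; exact: VfL.
  have uq j : \int3_(x in A) (q j x * divv u x) = 0.
    rewrite int3_div_Vf lu; [|exact/mnice_scalar/nR|exact: mnice0].
    have /rowP/(_ j) := yB; rewrite !mxE => {2}<-.
    by apply: eq_bigr => i _; rewrite mxE int3_div_Vf.
  have : Vf al si u = 0.
    apply: H => // p Pp.
    have [Pr r0] := Hq p Pp.
    rewrite (@linear_on_expand R Qt Rh (fun p => \int3_(x in A) (p x * divv u x)) Rh0 RhL _ k
       (fun i => ipQ p (q i)) q) //.
    - by rewrite big1 // => j _; rewrite uq mulr0.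
    - by move=> a v w Pv Pw; apply: ipQL => //; exact: nice_divv.
    - rewrite -[RHS](int3_0 oA); apply: eq_int3 => x Ax.
      by rewrite r0 // mul0r.
  rewrite lu // => E; apply/rowP => j; rewrite ord1 !mxE -[RHS]E.
  by apply: eq_bigr => i _; rewrite mxE.
(* By [ker] the left kernel of [Bm] annihilates [l], so [l] is a combination of the columns of [Bm];
   the coefficients are those of the pressure in the basis [q]. *)
have lB : (l^T <= Bm^T)%MS.
  rewrite submxE; apply/eqP; apply: trmx_inj; rewrite trmx_mul trmxK trmx0.
  apply/row_matrixP => i; rewrite row0 row_mul; apply: ker.
  rewrite -row_mul; suff -> : (cokermx Bm^T)^T *m Bm = 0 by rewrite row0.
  by rewrite -[X in _ *m X]trmxK -trmx_mul mulmx_coker trmx0.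
have [s sE] := submxP lB.
exists (\sum_j s 0 j *: q j); split.
  by apply: (P_sum (P := Rh)) => //; [exact: Rh0|exact: RhL].
set S := \sum_j _.
have PS : Rh S by apply: (P_sum (P := Rh)) => //; [exact: Rh0|exact: RhL].
have nS := nR _ PS.
move=> u Pu; rewrite int3_div_Vf.
have [Pr r0] := Hg u Pu.
have ex (al' : pt -> mx) (si' : pt -> pt) : mnice A al' -> mnice A si' ->
    Vf al' si' u = \sum_i ipV 1 u (g i) * Vf al' si' (g i).
  move=> na ns; apply: (@linear_on_expand R Vt Vh (Vf al' si')) => //.
  - exact: Vh0.
  - by move=> a v w; exact: VhL.
  - by move=> a v w; exact: VfL.
  - exact: Vf0.
rewrite !ex //; [|exact: mnice_scalar|exact: mnice0].
apply: eq_bigr => i _; congr (_ * _).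
rewrite -int3_div_Vf.
rewrite (@linear_on_sum R Qt Rh (fun p => \int3_(x in A) (p x * divv (g i) x)) Rh0 RhL) //; last first.
  by move=> a v w Pv Pw; apply: ipQL => //; exact: nice_divv.
have /matrixP/(_ 0 i) := sE; rewrite !mxE => ->.
by apply: eq_bigr => j _; rewrite !mxE.
Qed.

End Velocity.

(** * The energy inequality *)

Section Convexity.
Variable R : realType.

(** Convexity bounds the difference quotients with step in (0, 1] by [f b - f a]; a larger limit
    would be approached by such a quotient. *)
Lemma convex_gradient (V : normedModType R) (f : V -> R) (a b : V) :
  convex_fun f -> derivable f a (b - a) -> 'D_(b - a) f a <= f b - f a.
Proof.
move=> cf df; rewrite leNgt; apply/negP => H.
have L : h^-1 *: (f (h *: (b - a) + a) - f a) @[h --> 0^'] --> 'D_(b - a) f a by exact: df.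
have := cvgr_gt _ L _ H; rewrite near_withinE => H1.
have /nbhs_ballP[e /= e0 He] : nbhs (0 : R)
  [set h : R | h != 0 -> f b - f a < h^-1 *: (f (h *: (b - a) + a) - f a)] by exact: H1.
pose t := Num.min (e / 2) 1.
have t0 : 0 < t by rewrite lt_min divr_gt0 //=.
have t1 : t <= 1 by rewrite ge_min lexx orbT.
have te : t < e by rewrite gt_min; apply/orP; left; rewrite ltr_pdivrMr // ltr_pMr // ltr1n.
have := He t; rewrite /ball /= sub0r normrN gtr0_norm // => /(_ te (lt0r_neq0 t0)).
apply/negP; rewrite -leNgt.
have Hc : f (t *: b + (1 - t) *: a) <= t * f b + (1 - t) * f a.
  exact: (cf (Itv01 (ltW t0) t1) b a (mem_set I) (mem_set I)).
rewrite [_ *: _]mulrC ler_pdivrMr //.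
have -> : t *: (b - a) + a = t *: b + (1 - t) *: a.
  by rewrite scalerBr scalerBl scale1r addrAC addrA [t *: b + a - _]addrAC.
by apply: (@le_trans _ _ (t * f b + (1 - t) * f a - f a)); [rewrite lerD2r|lra].
Qed.

Lemma derive_direction1 (f : R -> R) (a v : R) : derivable f a 1 ->
  derivable f a v /\ 'D_v f a = f^`()%classic a * v.
Proof.
move=> /derivable1_diffP df; split; first exact: diff_derivable.
rewrite derive1E !deriveE //.
by rewrite -[in LHS](mulr1 v) -[v * 1]/(v *: (1 : R)) linearZ /= mulrC.
Qed.

Lemma derive_direction_mx (g : 'M[R]_3 -> R) (A H : 'M[R]_3) : differentiable g A ->
  derivable g A H /\ 'D_H g A = ddot (dmx g A) H.
Proof.
move=> dg; split; first exact: diff_derivable.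
rewrite deriveE // [in LHS](matrix_sum_delta H) linear_sum /ddot.
apply: eq_bigr => i _; rewrite linear_sum; apply: eq_bigr => j _.
by rewrite linearZ /= mxE deriveE // mulrC.
Qed.

Lemma convex_diff (f : R -> R) a b : C1 f -> convex_fun (f : R^o -> R) ->
  f b - f a <= f^`()%classic b * (b - a).
Proof.
move=> [df _] cf; have [dd DE] := derive_direction1 (a - b) (df b).
have := convex_gradient (V := R^o) cf dd; rewrite DE; lra.
Qed.

Lemma concave_diff (f : R -> R) a b : C1 f -> concave_fun (f : R^o -> R) ->
  f b - f a <= f^`()%classic a * (b - a).
Proof.
move=> [df _] cf; have [dd DE] := derive_direction1 (b - a) (df a).
have := convex_gradient (V := R^o) cf (derivableN dd); rewrite deriveN // DE; lra.
Qed.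

Lemma convex_diff_mx (g : 'M[R]_3 -> R) A B : C1mx g -> convex_fun g ->
  g B - g A <= ddot (dmx g B) (B - A).
Proof.
move=> [dg _] cg; have [dd DE] := derive_direction_mx (A - B) (dg B).
by have := convex_gradient cg dd; rewrite DE -opprB -scaleN1r ddotZr; lra.
Qed.

Lemma concave_diff_mx (g : 'M[R]_3 -> R) A B : C1mx g -> concave_fun g ->
  g B - g A <= ddot (dmx g A) (B - A).
Proof.
move=> [dg _] cg; have [dd DE] := derive_direction_mx (B - A) (dg A).
by have := convex_gradient cg (derivableN dd); rewrite deriveN // DE; lra.
Qed.

Lemma C1_continuous (f : R -> R) : C1 f -> continuous f.
Proof. by move=> [df _] x; apply: differentiable_continuous; apply/derivable1_diffP. Qed.

Lemma C1mx_continuous (g : 'M[R]_3 -> R) : C1mx g -> continuous g.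
Proof. by move=> [dg _] A; exact: differentiable_continuous. Qed.

Lemma pospart_ge0 (r : R) : 0 <= pospart r.
Proof. by rewrite le_max lexx. Qed.

Lemma le_pospart (r : R) : r <= pospart r.
Proof. by rewrite le_max lexx orbT. Qed.

Lemma pospart_continuous : continuous (@pospart R).
Proof. by move=> r; apply: continuous_at_max; [exact: continuous_at_cst|exact: cvg_id]. Qed.

End Convexity.

Section EnergyInequality.
Variable R : realType.
Local Notation pt := 'rV[R]_3.
Local Notation mx := 'M[R]_3.
Variables (Omega : set pt) (Th : mesh R).
Hypothesis oO : open Omega.
Hypothesis bO : bounded_set Omega.

Local Notation A := (cells Omega Th).
Let oA : open A := cells_open oO.

Lemma within_continuous_at (T : topologicalType) (f : pt -> T) x :
  {within closure Omega, continuous f} -> Omega x -> continuous_at x f.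
Proof.
move=> cf Ox; have cx : closure Omega x by exact: subset_closure.
have := (@subspace_continuousP _ (closure Omega) _ f).1 cf x cx.
rewrite within_interior //; apply: filterS (open_nbhs_nbhs (conj oO Ox)).
exact: subset_closure.
Qed.

Lemma within_comp (T : topologicalType) (f : pt -> T) (H : T -> R) (K : set pt) :
  {within K, continuous f} -> continuous H -> {within K, continuous (fun x => H (f x))}.
Proof. by move=> cf cH x; exact: (continuous_at_comp (cf x) (cH _)). Qed.

(** Boundedness comes from compactness of the closure of [Omega], on which discrete functions are
    continuous. Thus no growth condition on the nonlinearity enters. *)
Lemma nice_comp (T : topologicalType) (f : pt -> T) (H : T -> R) :
  {within closure Omega, continuous f} -> continuous H -> nice A (fun x => H (f x)).
Proof.
move=> cf cH; split=> [x [Ox _]|].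
  by apply: continuous_at_comp; [exact: within_continuous_at|exact: cH].
have [a Oa] := bounded_ball bO.
have [M HM] := compact_continuous_bounded (closure_Omega_compact Oa) (within_comp cf cH).
by exists M => x [Ox _]; apply: HM; exact: subset_closure.
Qed.

Variables (E : energy R) (S : splitting R).
Hypothesis CS : convex_splitting E S.
Hypothesis eg0 : forall M, 0 <= eg E M.

Lemma psi_continuous : continuous (psi E).
Proof.
have [[c1 c2 _ _ H] _ _ _] := CS; rewrite (funext H) => x.
by apply: continuous_atD; exact: C1_continuous.
Qed.

Lemma ef_continuous : continuous (ef E).
Proof.
have [_ [c1 c2 _ _ H] _ _] := CS; rewrite (funext H) => x.
by apply: continuous_atD; exact: C1_continuous.
Qed.

Lemma eg_continuous : continuous (eg E).
Proof.
have [_ _ [c1 c2 _ _ H] _] := CS; rewrite (funext H) => x.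
by apply: continuous_atD; exact: C1mx_continuous.
Qed.

Lemma eh_continuous : continuous (eh E).
Proof.
have [_ _ _ [c1 c2 _ _ H]] := CS; rewrite (funext H) => x.
by apply: continuous_atD; exact: C1mx_continuous.
Qed.

Variables (phin : pt -> R) (Fn : pt -> mx).

(** Together with [stress_gradient], [chemical_source] and [grad phi] these are the coefficients
    with which [U] becomes the sum of the right-hand sides of the equations for M and mu. *)
Definition elastic_stress (F : pt -> mx) (x : pt) : mx :=
  (dmx (hp S) (F x) + dmx (hm S) (Fn x))
  + pospart (ef E (phin x)) *: (dmx (gp S) (F x) + dmx (gm S) (Fn x))
  + (ef E (phin x) - pospart (ef E (phin x))) *: (dmx (gp S) (Fn x) + dmx (gm S) (F x)).

Definition chemical_source (F : pt -> mx) (phi : pt -> R) (x : pt) : R :=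
  ((psip S)^`()%classic (phi x) + (psim S)^`()%classic (phin x))
  + ((fp S)^`()%classic (phi x) * eg E (F x) + (fm S)^`()%classic (phin x) * eg E (F x)).

Definition stress_gradient (F : pt -> mx) (k : 'I_3) (x : pt) : mx := lambda E *: pdm k F x.

Definition energy_density (phi : pt -> R) (F : pt -> mx) (x : pt) : R :=
  psi E (phi x) + eh E (F x) + ef E (phi x) * eg E (F x)
  + 1 / 2 * dotv (grad phi x) (grad phi x) + lambda E / 2 * ddotgrad F F x.

Lemma mnice_dmx (g : mx -> R) (F : pt -> mx) : C1mx g -> Xh Omega Th F ->
  mnice A (fun x => dmx g (F x)).
Proof.
move=> [_ cg] [cF _] i j.
apply: (nice_comp (H := fun M => dmx g M i j) cF) => M.
exact: continuous_at_coord (cg M).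
Qed.

Lemma C1_derive_nice (f : R -> R) (phi : pt -> R) : C1 f -> Sh Omega Th phi ->
  nice A (fun x => f^`()%classic (phi x)).
Proof. by move=> [_ cf] [cp _]; exact: nice_comp. Qed.

Lemma scheme_ucoefs F phi : Sh Omega Th phin -> Xh Omega Th Fn ->
  Xh Omega Th F -> Sh Omega Th phi ->
  ucoefs Omega Th (elastic_stress F) (stress_gradient F) (chemical_source F phi) (grad phi).
Proof.
move=> Sn Xn XF Sp.
have [[p1 p2 _ _ _] [f1 f2 _ _ _] [g1 g2 _ _ _] [h1 h2 _ _ _]] := CS.
have nf : nice A (fun x => ef E (phin x)) by apply: nice_comp Sn.1 ef_continuous.
have npf : nice A (fun x => pospart (ef E (phin x))).
  apply: (nice_comp (H := fun r => pospart (ef E r)) Sn.1) => r.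
  by apply: continuous_at_comp; [exact: ef_continuous|exact: pospart_continuous].
have ng : nice A (fun x => eg E (F x)) by apply: nice_comp XF.1 eg_continuous.
split.
- apply: mniceD => //; first (apply: mniceD => //; first (apply: mniceD => //; exact: mnice_dmx)).
    by apply: mniceZ => //; apply: mniceD => //; exact: mnice_dmx.
  by apply: mniceZ => //; [exact: niceB|apply: mniceD => //; exact: mnice_dmx].
- move=> k; apply: mniceZ => //; first exact: nice_cst.
  by apply: mnice_pdm => //; exact: (Xh_dirnice oO bO).
- apply: niceD; first by apply: niceD; exact: C1_derive_nice.
  by apply: niceD; apply: niceM => //; exact: C1_derive_nice.
- by apply: mnice_grad => //; exact: (Sh_dirnice oO bO).
Qed.

Lemma energy_density_nice phi F : Sh Omega Th phi -> Xh Omega Th F -> nice A (energy_density phi F).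
Proof.
move=> Sp XF.
have dp := Sh_dirnice oO bO Sp; have dF := Xh_dirnice oO bO XF.
apply: niceD; [apply: niceD; [apply: niceD; [apply: niceD|]|]|].
- exact: nice_comp Sp.1 psi_continuous.
- exact: nice_comp XF.1 eh_continuous.
- apply: niceM; [exact: nice_comp Sp.1 ef_continuous|exact: nice_comp XF.1 eg_continuous].
- by apply: niceZ => //; apply: nice_dotv => //; exact: mnice_grad.
- apply: niceZ => //; apply: nice_sum => // k _.
  by apply: nice_ddot => //; exact: mnice_pdm.
Qed.

Lemma ddot_sub_id (P Q : mx) : ddot P (P - Q) = 1 / 2 * (ddot P P - ddot Q Q + ddot (P - Q) (P - Q)).
Proof. by rewrite !ddotBr !ddotBl (ddotC Q P); field. Qed.

Lemma dotv_sub_id (p q : pt) : dotv p (p - q) = 1 / 2 * (dotv p p - dotv q q + dotv (p - q) (p - q)).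
Proof. by rewrite !dotvBr !dotvBl (dotvC q p); field. Qed.

(** A convex part is bounded by its derivative at the new point, a concave one by that at the old
    point. For the product, the increment is (f(r) - f(rn)) g(M) + f(rn) (g(M) - g(Mn)): the first
    term uses [eg0], the second splits f(rn) into its positive part and a nonpositive rest, for
    which the roles of convex and concave are exchanged. *)
Lemma splitting_inequality (r rn : R) (M Mn : mx) :
  psi E r + eh E M + ef E r * eg E M - (psi E rn + eh E Mn + ef E rn * eg E Mn) <=
  ddot ((dmx (hp S) M + dmx (hm S) Mn)
    + pospart (ef E rn) *: (dmx (gp S) M + dmx (gm S) Mn)
    + (ef E rn - pospart (ef E rn)) *: (dmx (gp S) Mn + dmx (gm S) M)) (M - Mn)
  + (((psip S)^`()%classic r + (psim S)^`()%classic rn)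
     + ((fp S)^`()%classic r * eg E M + (fm S)^`()%classic rn * eg E M)) * (r - rn).
Proof.
have [[p1 p2 p3 p4 pE] [f1 f2 f3 f4 fE] [g1 g2 g3 g4 gE] [h1 h2 h3 h4 hE]] := CS.
have ip := convex_diff rn r p1 p3; have im := concave_diff rn r p2 p4.
have jp := convex_diff rn r f1 f3; have jm := concave_diff rn r f2 f4.
have gp1 := convex_diff_mx Mn M g1 g3; have gm1 := concave_diff_mx Mn M g2 g4.
have hp1 := convex_diff_mx Mn M h1 h3; have hm1 := concave_diff_mx Mn M h2 h4.
have nr (B C : mx) : ddot B (- C) = - ddot B C by rewrite ddotC ddotNl ddotC.
have gp2 := convex_diff_mx M Mn g1 g3; have gm2 := concave_diff_mx M Mn g2 g4.
rewrite -(opprB M Mn) nr in gp2; rewrite -(opprB M Mn) nr in gm2.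
rewrite !ddotDl !ddotZl !ddotDl.
have q0 := pospart_ge0 (ef E rn); have tq := le_pospart (ef E rn).
have gM0 := eg0 M.
rewrite (gE M) in gM0; rewrite (pE r) (pE rn) (hE M) (hE Mn) (fE r) (gE M) (gE Mn).
rewrite (fE rn) in q0 tq *.
move: (psip S r) (psip S rn) (psim S r) (psim S rn) ip im => ? ? ? ?.
move: (fp S r) (fp S rn) (fm S r) (fm S rn) q0 tq jp jm => a1 a2 a3 a4.
move: (pospart _) => q.
move: (gp S M) (gp S Mn) (gm S M) (gm S Mn) gM0 gp1 gm1 gp2 gm2 => c1 c2 c3 c4.
move: (hp S M) (hp S Mn) (hm S M) (hm S Mn) hp1 hm1 => ? ? ? ?.
move: (ddot _ _) (ddot _ _) (ddot _ _) (ddot _ _) (ddot _ _) (ddot _ _) => d1 d2 e1 e2 e3 e4.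
move: ((psip S)^`()%classic r) ((psim S)^`()%classic rn) => x1 x2.
move: ((fp S)^`()%classic r) ((fm S)^`()%classic rn) (r - rn) => x3 x4 y.
move=> i1 i2 g0 i3 i4 i5 i6 q0 tq i7 i8 i9 i10.
(* The three products: [A1] and [A2] for the positive part and the rest of f(rn), where the latter
   reverses the inequality, and [A3] for the increment of f times g(M). What remains is linear. *)
have A1 : q * (c1 + c3 - (c2 + c4)) <= q * (e2 + e1) by apply: ler_wpM2l => //; lra.
have A2 : (a2 + a4 - q) * (c1 + c3 - (c2 + c4)) <= (a2 + a4 - q) * (d2 + d1).
  by apply: ler_wnM2l; lra.
have A3 : (a1 - a2 + (a3 - a4)) * (c1 + c3) <= (x3 * y + x4 * y) * (c1 + c3).
  by apply: ler_wpM2r => //; lra.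
lra.
Qed.

(** Quadratic terms taken at the new level give p . (p - q) = (|p|^2 - |q|^2 + |p - q|^2) / 2; the
    last square is the numerical dissipation that appears in the stability bound. *)
Lemma energy_density_step phi F x : Sh Omega Th phin -> Xh Omega Th Fn ->
  Xh Omega Th F -> Sh Omega Th phi -> A x ->
  energy_density phi F x - energy_density phin Fn x
   + (1 / 2 * dotv (grad phi x - grad phin x) (grad phi x - grad phin x)
   + lambda E / 2 * \sum_k ddot (pdm k F x - pdm k Fn x) (pdm k F x - pdm k Fn x)) <=
  uform (elastic_stress F) (stress_gradient F) (chemical_source F phi) (grad phi)
    ((F - Fn, (phi : pt -> R^o) - phin) : Wt R) x.
Proof.
move=> Sn Xn XF Sp Ax.
have dp := Sh_dirnice oO bO Sp; have dF := Xh_dirnice oO bO XF.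
have dpn := Sh_dirnice oO bO Sn; have dFn := Xh_dirnice oO bO Xn.
rewrite /uform /=.
have -> : grad ((phi : pt -> R^o) - phin) x = grad phi x - grad phin x.
  apply/rowP => k; rewrite !mxE; exact: (pdB oA k dp dpn Ax).
have E1 k : ddot (stress_gradient F k x) (pdm k (F - Fn) x) =
    lambda E / 2 * (ddot (pdm k F x) (pdm k F x) - ddot (pdm k Fn x) (pdm k Fn x) +
       ddot (pdm k F x - pdm k Fn x) (pdm k F x - pdm k Fn x)).
  have -> : pdm k (F - Fn) x = pdm k F x - pdm k Fn x.
    apply/matrixP => i j; rewrite !mxE.
    rewrite (_ : (fun y => _) = (fun y => F y i j - Fn y i j)).
      exact: (pdB oA k (dF i j) (dFn i j) Ax).
    by apply/funext => y; rewrite !mxE.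
  by rewrite ddotZl ddot_sub_id; field.
rewrite (eq_bigr _ (fun k _ => E1 k)) -mulr_sumr big_split sumrB /= dotv_sub_id.
have := splitting_inequality (phi x) (phin x) (F x) (Fn x).
rewrite -/(elastic_stress F x) -/(chemical_source F phi x).
have -> : (F - Fn) x = F x - Fn x by [].
have -> : ((phi : pt -> R^o) - phin) x = phi x - phin x by [].
rewrite /energy_density /ddotgrad.
move: (ddot (elastic_stress F x) _) (chemical_source F phi x * _) => a c.
move: (\sum_k ddot (pdm k F x) (pdm k F x)) => s1.
move: (\sum_k ddot (pdm k Fn x) (pdm k Fn x)) => s2.
move: (\sum_k ddot (_ - _) _) => s3.
move: (dotv (grad phi x) _) (dotv (grad phin x) _) (dotv (_ - _) _) => d1 d2 d3.
lra.
Qed.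

End EnergyInequality.

(** * Continuity of the discrete energy gradient *)

Section UniformFamilies.
Variable R : realType.
Local Notation pt := 'rV[R]_3.
Local Notation mx := 'M[R]_3.
Variables (A K : set pt) (a : R) (d : nat).
Hypothesis oA : open A.
Hypothesis Aa : A `<=` ball 0 a.
Hypothesis AK : A `<=` K.
Hypothesis cK : compact K.
Local Notation vec := 'rV[R]_d.

(* Coefficient vectors [X] parametrize functions on [A], continuously for the
   uniform norm. *)
Definition unif (k : vec -> pt -> R) := (forall X, nice A (k X)) /\
  forall X0 (eps : R), 0 < eps ->
    \forall X \near X0, forall x, A x -> `|k X x - k X0 x| <= eps.

Lemma unif_fixed f : nice A f -> unif (fun=> f).
Proof.
move=> nf; split=> // X0 eps e0; apply: (@filterE _ (nbhs X0)) => X x _.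
by rewrite subrr normr0 ltW.
Qed.

Lemma unifD k l : unif k -> unif l -> unif (fun X x => k X x + l X x).
Proof.
move=> [nk Hk] [nl Hl]; split=> [X|X0 eps e0]; first exact: niceD.
have e2 : 0 < eps / 2 by rewrite divr_gt0.
apply: (@filterS2 _ (nbhs X0)) (Hk X0 _ e2) (Hl X0 _ e2) => X H1 H2 x Ax.
rewrite opprD addrACA (le_trans (ler_normD _ _)) // (splitr eps).
by rewrite lerD ?H1 ?H2.
Qed.

Lemma unifM f k : nice A f -> unif k -> unif (fun X x => f x * k X x).
Proof.
move=> nf [nk Hk]; split=> [X|X0 eps e0]; first exact: niceM.
have [_ [M HM]] := nf.
have M0 : 0 < `|M| + 1 by rewrite ltr_wpDl.
have e2 : 0 < eps / (`|M| + 1) by rewrite divr_gt0.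
apply: (@filterS _ (nbhs X0)) (Hk X0 _ e2) => X H1 x Ax.
rewrite -mulrBr normrM (_ : eps = (`|M| + 1) * (eps / (`|M| + 1))); last first.
  by rewrite mulrC divfK // gt_eqF.
apply: ler_pM => //; last exact: H1.
have := HM x Ax; have := ler_norm M; lra.
Qed.

Lemma unif_sum (I : Type) (r : seq I) (k : I -> vec -> pt -> R) :
  (forall i, unif (k i)) -> unif (fun X x => \sum_(i <- r) k i X x).
Proof.
move=> H; elim: r => [|i r IH].
  rewrite (_ : (fun X x => _) = (fun=> fun=> 0)).
    by apply: unif_fixed; exact: nice_cst.
  by apply/funext => X; apply/funext => x; rewrite big_nil.
rewrite (_ : (fun X x => _) = (fun X x => k i X x + \sum_(j <- r) k j X x)).
  exact: unifD.
by apply/funext => X; apply/funext => x; rewrite big_cons.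
Qed.

Lemma unif_coord f l : nice A f -> unif (fun (X : vec) x => X 0 l * f x).
Proof.
move=> nf.
rewrite (_ : (fun (X : vec) x => _) = (fun X x => f x * X 0 l)); last first.
  by apply/funext => X; apply/funext => x; rewrite mulrC.
apply: unifM => //; split=> [X|X0 eps e0]; first exact: (nice_cst A (X 0 l)).
have cX : (X : vec) 0 l @[X --> X0] --> X0 0 l by exact: coord_continuous.
have H := cvg_ball cX e0; near=> X => x _.
by rewrite distrC ltW //; near: X; exact: H.
Unshelve. all: by end_near.
Qed.

(** Joint continuity in the point and the parameter is uniform in the point because [K] is compact.
    This suffices for nonlinearities [H] that are merely continuous. *)
Lemma unif_comp (T : topologicalType) (q : vec -> pt -> T) (H : T -> R) : continuous H ->
  (forall X x, A x -> continuous_at x (q X)) ->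
  (forall X0 y0, K y0 ->
    q p.2 p.1 @[p --> filter_prod (within K (nbhs y0)) (nbhs X0)] --> q X0 y0) ->
  unif (fun X x => H (q X x)).
Proof.
move=> cH qc qK.
have kK X0 y0 : K y0 ->
    H (q p.2 p.1) @[p --> filter_prod (within K (nbhs y0)) (nbhs X0)] --> H (q X0 y0).
  by move=> Ky; apply: (cvg_comp _ _ (qK X0 y0 Ky)); exact: cH.
have near_unif X0 (eps : R) : 0 < eps ->
    \forall X \near X0, forall x, K x -> `|H (q X x) - H (q X0 x)| <= eps.
  move=> e0; have e2 : 0 < eps / 2 by rewrite divr_gt0.
  have cov := (near_covering_withinP K).2 ((compact_near_coveringP K).1 cK).
  apply: (cov vec (nbhs X0) (fun X x => `|H (q X x) - H (q X0 x)| <= eps) _) => y0 Ky.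
  have [[P Q] /= [NP NQ] PQ] := cvg_ball (kK X0 y0 Ky) e2.
  have X0Q : Q X0 by exact: nbhs_singleton.
  exists (fun y => K y -> P y, Q) => //= -[y X] /= [KP QX] Ky'.
  have := PQ (y, X) (conj (KP Ky') QX); have := PQ (y, X0) (conj (KP Ky') X0Q).
  rewrite /= => h1 h2; rewrite (splitr eps) -(subrKA (H (q X0 y0))).
  by rewrite (le_trans (ler_normD _ _)) // lerD // ltW // distrC.
split=> [X|X0 eps e0]; last first.
  by apply: (@filterS _ (nbhs X0)) (near_unif X0 _ e0) => X HX x /AK; exact: HX.
split=> [x Ax|]; first by apply: continuous_at_comp; [exact: qc|exact: cH].
have kX : {within K, continuous (fun x => H (q X x))}.
  apply/subspace_continuousP => y Ky.
  have := kK X y Ky => /(@cvg_comp _ _ _ (fun y => (y, X)) _ _ _ _); apply.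
  by move=> B [[P Q] /= [NP NQ] PQ]; apply: filterS NP => z Pz; apply: PQ; split=> //; exact: nbhs_singleton.
have [M HM] := compact_continuous_bounded cK kX.
by exists M => x /AK; exact: HM.
Qed.

Lemma unif_int_continuous k : unif k -> continuous (fun X => \int3_(x in A) k X x).
Proof.
move=> [nk Hk] X0; have FF : Filter (nbhs (X0 : vec)) := nbhs_filter X0.
apply: (iffRL (@cvg_ballP _ _ _ (nbhs (X0 : vec)) FF (fun X => \int3_(x in A) k X x)
  (\int3_(x in A) k X0 x))) => eps0 e00.
set eps := eps0 / 2; have e0 : 0 < eps by rewrite divr_gt0.
pose c := \int3_(x in A) (1 : R).
have c0 : 0 <= c by apply: int3_ge0 => x _; exact: ler01.
(* The volume plus one as denominator, so that no positivity of the volume is involved. *)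
have c1 : 0 < c + 1 by rewrite ltr_wpDl.
have e1 : 0 < eps / (c + 1) by rewrite divr_gt0.
near=> X.
have HX : forall x, A x -> `|k X x - k X0 x| <= eps / (c + 1) by near: X; exact: Hk.
have n1 := nk X0; have n2 := nk X; have nc := nice_cst A (1 : R).
have ne : nice A (fun=> eps / (c + 1)) := nice_cst A _.
have ce : eps / (c + 1) * c <= eps.
  by rewrite mulrAC ler_pdivrMr // ler_pM2l // lerDl.
have iE : \int3_(x in A) (eps / (c + 1)) = eps / (c + 1) * c.
  by rewrite -(int3Z oA Aa) //; apply: eq_int3 => x _; rewrite mulr1.
apply: le_lt_trans (_ : eps < _); last by rewrite /eps; lra.
rewrite -(int3B oA Aa) // ler_norml; apply/andP; split.
  apply: le_trans (_ : \int3_(x in A) (-1 * (eps / (c + 1))) <= _).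
    by rewrite (int3Z oA Aa) // iE mulN1r lerN2.
  apply: (le_int3 oA Aa); [exact: niceZ|exact: niceB|].
  by move=> x Ax; rewrite mulN1r; have := HX x Ax; rewrite distrC ler_norml => /andP[].
apply: le_trans (_ : \int3_(x in A) (eps / (c + 1)) <= _); last by rewrite iE.
apply: (le_int3 oA Aa) => //; first exact: niceB.
by move=> x Ax; have := HX x Ax; rewrite distrC ler_norml => /andP[].
Unshelve. all: by end_near.
Qed.

Lemma eq_unif k l : (forall X x, A x -> k X x = l X x) -> unif k -> unif l.
Proof.
move=> kl [nk Hk]; split=> [X|X0 eps e0]; first exact: (eq_nice oA (kl X) (nk X)).
by apply: (@filterS _ (nbhs X0)) (Hk X0 _ e0) => X H x Ax; rewrite -!kl // H.
Qed.

Definition munif m n (F : vec -> pt -> 'M[R]_(m, n)) := forall i j, unif (fun X x => F X x i j).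

Lemma munif_fixed m n (F : pt -> 'M[R]_(m, n)) : mnice A F -> munif (fun=> F).
Proof. by move=> nF i j; exact: unif_fixed. Qed.

Lemma munifD m n (F G : vec -> pt -> 'M[R]_(m, n)) :
  munif F -> munif G -> munif (fun X x => F X x + G X x).
Proof.
move=> uF uG i j; apply: (eq_unif _ (unifD (uF i j) (uG i j))) => X x _.
by rewrite mxE.
Qed.

Lemma munifZ m n f (F : vec -> pt -> 'M[R]_(m, n)) :
  nice A f -> munif F -> munif (fun X x => f x *: F X x).
Proof.
move=> nf uF i j; apply: (eq_unif _ (unifM nf (uF i j))) => X x _.
by rewrite mxE.
Qed.

Lemma unif_ddot F (G : pt -> mx) : munif F -> mnice A G -> unif (fun X x => ddot (F X x) (G x)).
Proof.
move=> uF nG; apply: unif_sum => i; apply: unif_sum => j.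
apply: (eq_unif _ (unifM (nG i j) (uF i j))) => X x _; exact: mulrC.
Qed.

Lemma unif_dotv F (G : pt -> pt) : munif F -> mnice A G -> unif (fun X x => dotv (F X x) (G x)).
Proof.
move=> uF nG; apply: unif_sum => i.
apply: (eq_unif _ (unifM (nG 0 i) (uF 0 i))) => X x _; exact: mulrC.
Qed.

End UniformFamilies.

Lemma cvg_sumr (R : realType) (T : Type) (F : set_system T) (I : Type) (r : seq I)
    (f : I -> T -> R) (a : I -> R) : Filter F ->
  (forall i, f i x @[x --> F] --> a i) ->
  \sum_(i <- r) f i x @[x --> F] --> \sum_(i <- r) a i.
Proof.
move=> FF H; elim: r => [|i r IH].
  rewrite big_nil (_ : (fun x => _) = (fun=> 0)); first exact: cvg_cst.
  by apply/funext => x; rewrite big_nil.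
rewrite big_cons (_ : (fun x => _) = (fun x => f i x + \sum_(j <- r) f j x)).
  exact: (@cvgD R R^o).
by apply/funext => x; rewrite big_cons.
Qed.

(** * The discrete energy gradient as a function of the coordinates *)

Section Residual.
Variable R : realType.
Local Notation pt := 'rV[R]_3.
Local Notation mx := 'M[R]_3.
Variables (Omega : set pt) (Th : mesh R).
Hypothesis oO : open Omega.
Hypothesis bO : bounded_set Omega.

Local Notation A := (cells Omega Th).
Let oA : open A := cells_open oO.
Let ra : R := sval (cid (@A_ball _ _ Th bO)).
Let Aa : A `<=` ball 0 ra := svalP (cid (@A_ball _ _ Th bO)).

Variables (E : energy R) (S : splitting R).
Hypothesis CS : convex_splitting E S.
Variables (phin : pt -> R) (Fn : pt -> mx).
Hypothesis Sn : Sh Omega Th phin.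
Hypothesis Xn : Xh Omega Th Fn.
Variables (d : nat) (e : 'I_d -> Wt R).
Hypothesis Pe : forall i, PW Omega Th (e i).
Local Notation vec := 'rV[R]_d.

Definition state (X : vec) : Wt R := ((Fn, phin) : Wt R) + \sum_l X 0 l *: e l.

Lemma state_PW X : PW Omega Th (state X).
Proof.
have H : PW Omega Th (\sum_l X 0 l *: e l).
  apply: (P_sum (P := PW Omega Th)) => //; [exact: PW0|exact: PWL].
rewrite /state -[X in PW _ _ (X + _)]scale1r; apply: PWL => //.
Qed.

Lemma state1 X x i j : (state X).1 x i j = Fn x i j + \sum_l X 0 l * (e l).1 x i j.
Proof.
have E1 : (state X).1 = Fn + \sum_l X 0 l *: (e l).1.
  by rewrite /state /=; congr (_ + _); elim/big_rec2: _ => // l u v _ <-.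
rewrite E1 /= mxE; congr (_ + _).
rewrite fct_sumE summxE; apply: eq_bigr => l _; by rewrite !mxE.
Qed.

Lemma state2 X x : (state X).2 x = phin x + \sum_l X 0 l * (e l).2 x.
Proof.
have E1 : (state X).2 = (phin : pt -> R^o) + \sum_l X 0 l *: (e l).2.
  by rewrite /state /=; congr (_ + _); elim/big_rec2: _ => // l u v _ <-.
by rewrite E1 /=; congr (_ + _); rewrite fct_sumE.
Qed.

Let K := closure Omega.
Let cK : compact K.
Proof. by have [a Oa] := bounded_ball bO; exact: closure_Omega_compact Oa. Qed.
Let AK : A `<=` K.
Proof. by move=> x [Ox _]; exact: subset_closure. Qed.

Lemma state_cvg X0 y0 : K y0 ->
  ((state p.2).1 p.1, (state p.2).2 p.1)
    @[p --> filter_prod (within K (nbhs y0)) (nbhs X0)] --> ((state X0).1 y0, (state X0).2 y0).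
Proof.
move=> Ky.
set F := filter_prod _ _.
have FF : Filter F by exact: filter_prod_filter.
have within_cvg (T : topologicalType) (f : pt -> T) : {within K, continuous f} ->
    f p.1 @[p --> F] --> f y0.
  move=> cf; have := (@subspace_continuousP _ K _ f).1 cf y0 Ky.
  by move=> H; apply: (cvg_comp _ _ _ H); exact: cvg_fst.
have within_entry (f : pt -> mx) i j : {within K, continuous f} ->
    f p.1 i j @[p --> F] --> f y0 i j.
  move=> cf; apply: (within_cvg R (fun y => f y i j)).
  exact: (within_comp (H := fun M : mx => M i j) cf (@coord_continuous _ _ _ i j)).
have cX (l : 'I_d) : (p.2 : vec) 0 l @[p --> F] --> X0 0 l.
  have : snd @ F --> X0 by exact: cvg_snd.
  have cc : (X : vec) 0 l @[X --> X0] --> X0 0 l by exact: coord_continuous.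
  by move=> H; exact: (cvg_comp _ _ H cc).
have c1 : (state p.2).1 p.1 @[p --> F] --> (state X0).1 y0.
  apply: cvg_mx => i j.
  rewrite (_ : (fun p => _) = (fun p => Fn p.1 i j + \sum_l (p.2 : vec) 0 l * (e l).1 p.1 i j)); last first.
    by apply/funext => p; exact: state1.
  rewrite state1; apply: (@cvgD R R^o); first exact: within_entry Xn.1.
  apply: cvg_sumr => l; apply: cvgM => //.
  by apply: within_entry; have [[]] := Pe l.
have c2 : (state p.2).2 p.1 @[p --> F] --> (state X0).2 y0.
rewrite (_ : (fun p => _) = (fun p => phin p.1 + \sum_l (p.2 : vec) 0 l * (e l).2 p.1)); last first.
  by apply/funext => p; exact: state2.
rewrite state2; apply: (@cvgD R R^o); first exact: within_cvg Sn.1.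
apply: cvg_sumr => l; apply: cvgM => //.
by apply: within_cvg; have [_ []] := Pe l.
exact: (cvg_pair c1 c2).
Qed.

Local Notation unif := (@unif R A d).
Local Notation munif := (@munif R A d).

Lemma state_unif (H : mx * R -> R) : continuous H ->
  unif (fun X x => H ((state X).1 x, (state X).2 x)).
Proof.
move=> cH; apply: (unif_comp AK cK cH (q := fun X x => ((state X).1 x, (state X).2 x))).
  move=> X x [Ox _]; have [[c1 _] [c2 _]] := state_PW X.
  exact: (cvg_pair (within_continuous_at oO c1 Ox) (within_continuous_at oO c2 Ox)).
by move=> X0 y0; exact: state_cvg.
Qed.

Lemma dmx_munif (g : mx -> R) : C1mx g -> munif (fun X x => dmx g ((state X).1 x)).
Proof.
move=> [_ cg] i j; apply: (state_unif (H := fun t => dmx g t.1 i j)) => // t.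
apply: continuous_at_coord; apply: continuous_at_comp (cg _); exact: cvg_fst.
Qed.

Lemma chemical_unif (H : mx * R -> R) w : PW Omega Th w -> continuous H ->
  unif (fun X x => H ((state X).1 x, (state X).2 x) * w.2 x).
Proof.
move=> Pw cH; have [nw _ _] := PW2 oO bO Pw.
apply: (eq_unif oA _ (unifM nw (state_unif cH))) => X x _; exact: mulrC.
Qed.

Lemma pdm_state_munif k : munif (fun X x => pdm k (state X).1 x).
Proof.
have H i j x : A x -> forall X, pdm k (state X).1 x i j =
    pdm k Fn x i j + \sum_l X 0 l * pdm k (e l).1 x i j.
  move=> Ax X; rewrite !mxE.
  rewrite (_ : (fun y => _) = (fun y => Fn y i j + \sum_l X 0 l * (e l).1 y i j)).
    have dn := Xh_dirnice oO bO Xn i j.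
    have de l : dirnice A (fun y => X 0 l * (e l).1 y i j).
      by apply: dirniceZ => //; exact: (PW1 oO bO (Pe l) i j).
    rewrite (pdD k dn (dirnice_sum oA _ de) Ax).
    rewrite (pd_sum oA) //; congr (_ + _); apply: eq_bigr => l _.
    by rewrite (pdZ _ k (PW1 oO bO (Pe l) i j) Ax) mxE.
  by apply/funext => y; exact: state1.
move=> i j; apply: (eq_unif oA (fun X x Ax => esym (H i j x Ax X))).
apply: unifD; first by apply: unif_fixed; exact: (mnice_pdm oA k (Xh_dirnice oO bO Xn) i j).
apply: unif_sum => l; apply: unif_coord.
exact: (mnice_pdm oA k (PW1 oO bO (Pe l)) i j).
Qed.

Lemma grad_state_munif : munif (fun X x => grad (state X).2 x).
Proof.
have H k x : A x -> forall X, grad (state X).2 x 0 k =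
    grad phin x 0 k + \sum_l X 0 l * grad (e l).2 x 0 k.
  move=> Ax X; rewrite !mxE.
  rewrite (_ : (state X).2 = (fun y => phin y + \sum_l X 0 l * (e l).2 y)).
    have dn := Sh_dirnice oO bO Sn.
    have de l : dirnice A (fun y => X 0 l * (e l).2 y).
      by apply: dirniceZ => //; exact: (PW2 oO bO (Pe l)).
    rewrite (pdD k dn (dirnice_sum oA _ de) Ax).
    rewrite (pd_sum oA) //; congr (_ + _); apply: eq_bigr => l _.
    by rewrite (pdZ _ k (PW2 oO bO (Pe l)) Ax) mxE.
  by apply/funext => y; exact: state2.
move=> i k; rewrite ord1; apply: (eq_unif oA (fun X x Ax => esym (H k x Ax X))).
apply: unifD; first by apply: unif_fixed; exact: (mnice_grad oA (Sh_dirnice oO bO Sn) 0 k).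
apply: unif_sum => l; apply: unif_coord.
exact: (mnice_grad oA (PW2 oO bO (Pe l)) 0 k).
Qed.

(** Values on a basis of the (M, mu) determined by the state [X]: the convex-split substitute for
    the derivative of the energy. *)
Definition residual (X : vec) (w : Wt R) : R :=
  U Omega Th (elastic_stress E S phin Fn (state X).1) (stress_gradient E (state X).1)
    (chemical_source E S phin (state X).1 (state X).2) (grad (state X).2) w.

Lemma residual_continuous w : PW Omega Th w -> continuous (fun X => residual X w).
Proof.
move=> Pw; have [[p1 p2 _ _ _] [f1 f2 _ _ _] [g1 g2 _ _ _] [h1 h2 _ _ _]] := CS.
have d1 := PW1 oO bO Pw; have d2 := PW2 oO bO Pw.
have nf : nice A (fun x => ef E (phin x)) by exact: (nice_comp Th oO bO Sn.1 (ef_continuous CS)).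
have npf : nice A (fun x => pospart (ef E (phin x))).
  apply: (nice_comp Th oO bO (H := fun r => pospart (ef E r)) Sn.1) => r.
  by apply: continuous_at_comp; [exact: ef_continuous CS _|exact: pospart_continuous].
apply: (unif_int_continuous oA Aa).
apply: unifD; last exact: (unif_dotv oA grad_state_munif (mnice_grad oA d2)).
apply: unifD; first apply: unifD.
- apply: (unif_ddot oA) (mdirnice_mnice d1); apply: munifD => //; first apply: munifD => //.
  + by apply: munifD => //; [exact: dmx_munif|apply: munif_fixed; exact: mnice_dmx].
  + apply: munifZ => //; apply: munifD => //; [exact: dmx_munif|].
    by apply: munif_fixed; exact: mnice_dmx.
  + apply: munifZ => //; first exact: niceB.
    by apply: munifD => //; [apply: munif_fixed; exact: mnice_dmx|exact: dmx_munif].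
- apply: unif_sum => k; apply: (unif_ddot oA); last exact: (mnice_pdm oA k d1).
  by apply: munifZ => //; [exact: nice_cst|exact: pdm_state_munif].
- have cfst : continuous (fun t : mx * R => eg E t.1).
    by move=> t; apply: (@continuous_comp _ _ _ fst (eg E)); [exact: cvg_fst|exact: eg_continuous CS _].
  have csnd (f : R -> R) : C1 f -> continuous (fun t : mx * R => f^`()%classic t.2).
    by move=> [_ cf] t; apply: (@continuous_comp _ _ _ snd (f^`()%classic)); [exact: cvg_snd|exact: cf].
  have nw : nice A w.2 by case: d2.
  apply: (eq_unif oA (k := fun X x =>
     ((psip S)^`()%classic ((state X).2 x) * w.2 x + (psim S)^`()%classic (phin x) * w.2 x) +
     ((fp S)^`()%classic ((state X).2 x) * eg E ((state X).1 x) * w.2 x +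
      (fm S)^`()%classic (phin x) * (eg E ((state X).1 x) * w.2 x)))).
    by move=> X x _; rewrite /chemical_source !mulrDl mulrA.
  apply: unifD; apply: unifD.
  + exact: (chemical_unif (H := fun t => (psip S)^`()%classic t.2) Pw (csnd _ p1)).
  + by apply: unif_fixed; apply: niceM => //; exact: (C1_derive_nice oO bO).
  + apply: (chemical_unif (H := fun t => (fp S)^`()%classic t.2 * eg E t.1) Pw) => t.
    by apply: continuous_atM; [exact: csnd|exact: cfst].
  + apply: unifM; first exact: (C1_derive_nice oO bO).
    exact: (chemical_unif (H := fun t => eg E t.1) Pw cfst).
Qed.

End Residual.

(** * Existence of discrete solutions *)

Section PositiveForms.
Variables (R : realType) (d : nat).
Local Notation vec := 'rV[R]_d.

Lemma dotDl (u v w : vec) : dot (u + v) w = dot u w + dot v w.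
Proof. by rewrite /dot -big_split; apply: eq_bigr => i _ /=; rewrite mxE mulrDl. Qed.

Lemma dot_mulmx n (Am : 'M[R]_(d, n)) (u : vec) (w : 'rV[R]_n) : dot (u *m Am) w = dot u (w *m Am^T).
Proof.
rewrite /dot; under eq_bigr do rewrite mxE mulr_suml.
rewrite exchange_big /=; apply: eq_bigr => i _; rewrite mxE mulr_sumr.
by apply: eq_bigr => j _; rewrite !mxE; ring.
Qed.

(* Expanding the form at [z - z Am / c] bounds [|z Am|^2] by [c] times the form. *)
Lemma psd_mulmx_bound (Am : 'M[R]_d) : Am^T = Am -> (forall z : vec, 0 <= dot (z *m Am) z) ->
  exists2 c : R, 0 <= c & forall z : vec, dot (z *m Am) (z *m Am) <= c * dot (z *m Am) z.
Proof.
(* A crude upper bound for the eigenvalues of [Am], made positive by the 1 since its inverse is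
   used. *)
move=> sA pA; pose c := 1 + \sum_i \sum_j `|Am i j|.
have s0 : 0 <= \sum_i \sum_j `|Am i j| by apply: sumr_ge0 => i _; exact: sumr_ge0.
have c0 : 0 < c by rewrite /c; lra.
have bnd (w : vec) : dot (w *m Am) w <= c * dot w w.
  apply: (@le_trans _ _ ((\sum_i \sum_j `|Am i j|) * dot w w)); last first.
    by rewrite ler_wpM2r ?dot_ge0 // /c lerDr ler01.
  rewrite /dot; under eq_bigr do rewrite mxE mulr_suml.
  rewrite exchange_big /= mulr_suml; apply: ler_sum => i _.
  rewrite mulr_suml; apply: ler_sum => j _.
  rewrite mulrC mulrA mulrC (le_trans (ler_norm _)) // normrM ler_wpM2l //.
  rewrite normrM -[leRHS](@sqr_sqrtr R (dot w w)) ?dot_ge0 // expr2.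
  by apply: ler_pM => //; exact: coord_le_dot.
exists c; first exact: ltW.
move=> z; set y := z *m Am.
have := pA (z + (- c^-1) *: y).
rewrite mulmxDl -scalemxAl -/y dotDl [dot y _]dotC dotDl !(dotZl, dotZr).
rewrite [dot (y *m Am) _]dotC dotDl !(dotZl, dotZr).
have -> : dot z (y *m Am) = dot y y by rewrite -{1}sA -dot_mulmx.
rewrite [dot z y]dotC [dot y (y *m Am)]dotC.
have := bnd y; set N := dot y y; set Q := dot y z; set P := dot _ y => Pb H.
have H2 : (c^-1) ^+ 2 * P <= c^-1 * N.
  rewrite expr2 -mulrA ler_pM2l ?invr_gt0 //.
  by rewrite -(ler_pM2l c0) mulrA mulfV ?mul1r // gt_eqF.
have : c^-1 * N <= Q by move: H H2; rewrite expr2; lra.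
by rewrite -(ler_pM2l c0) mulrA mulfV ?mul1r // gt_eqF.
Qed.

End PositiveForms.

(** * Transport coupling and dissipation as bilinear forms *)

Section WeakForms.
Variable R : realType.
Local Notation pt := 'rV[R]_3.
Local Notation mx := 'M[R]_3.
Variables (Omega : set pt) (Th : mesh R).
Hypothesis oO : open Omega.
Hypothesis bO : bounded_set Omega.

Local Notation A := (cells Omega Th).
Let oA : open A := cells_open oO.
Let ra : R := sval (cid (@A_ball _ _ Th bO)).
Let Aa : A `<=` ball 0 ra := svalP (cid (@A_ball _ _ Th bO)).

Variables (phin : pt -> R) (Fn : pt -> mx).
Hypothesis Sn : Sh Omega Th phin.
Hypothesis Xn : Xh Omega Th Fn.
Implicit Types (w : Wt R) (u : pt -> pt).

Definition coupling w u : R :=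
  \int3_(x in A) (w.2 x * dotv (grad phin x) (u x))
  - \int3_(x in A) (ddot (w.1 x *m (Fn x)^T) (gradv u x))
  + \int3_(x in A) (dotv (odot Fn w.1 x) (u x)).

Let dn : dirnice A phin := Sh_dirnice oO bO Sn.
Let dFn : mdirnice A Fn := Xh_dirnice oO bO Xn.

Lemma mnice_odot w : PW Omega Th w -> mnice A (odot Fn w.1).
Proof.
move=> Pw i k; rewrite ord1.
apply: (eq_nice oA _ (nice_ddot oA (mnice_pdm oA k dFn) (mdirnice_mnice (PW1 oO bO Pw)))).
by move=> x _; rewrite mxE.
Qed.

Lemma coupling_nice w u : PW Omega Th w -> Vh Omega Th u ->
  [/\ nice A (fun x => w.2 x * dotv (grad phin x) (u x)),
      nice A (fun x => ddot (w.1 x *m (Fn x)^T) (gradv u x)) &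
      nice A (fun x => dotv (odot Fn w.1 x) (u x))].
Proof.
move=> Pw Vu; have [n2 _ _] := PW2 oO bO Pw; have n1 := mdirnice_mnice (PW1 oO bO Pw).
have du := Vh_dirnice oO bO Vu; have nu := mdirnice_mnice du.
split.
- by apply: niceM => //; apply: nice_dotv => //; exact: mnice_grad.
- apply: nice_ddot => //; last exact: mnice_gradv.
  by apply: mniceM => //; apply: mnice_tr => //; exact: (mdirnice_mnice dFn).
- by apply: nice_dotv => //; exact: mnice_odot.
Qed.

Lemma coupling_vcoefs w : PW Omega Th w ->
  mnice A (fun x => - (w.1 x *m (Fn x)^T)) /\
  mnice A (fun x => w.2 x *: grad phin x + odot Fn w.1 x).
Proof.
move=> Pw; have [n2 _ _] := PW2 oO bO Pw; have n1 := mdirnice_mnice (PW1 oO bO Pw).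
split.
  by apply: mniceN => //; apply: mniceM => //; apply: mnice_tr => //; exact: (mdirnice_mnice dFn).
by apply: mniceD => //; [apply: mniceZ => //; exact: mnice_grad|exact: mnice_odot].
Qed.

Lemma coupling_Vf w u : PW Omega Th w -> Vh Omega Th u ->
  coupling w u = Vf Omega Th (fun x => - (w.1 x *m (Fn x)^T))
    (fun x => w.2 x *: grad phin x + odot Fn w.1 x) u.
Proof.
move=> Pw Vu; have [n1 n2 n3] := coupling_nice Pw Vu.
rewrite /coupling -(int3B oA Aa) // -(int3D oA Aa) //; last exact: niceB.
by apply: eq_int3 => x _; rewrite /vform ddotNl dotvDl dotvZl; ring.
Qed.

Lemma ddot_mul_tr (M F G : mx) : ddot (M *m F^T) G = ddot (G *m F) M.
Proof.
rewrite /ddot; apply: eq_bigr => i _.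
under eq_bigr do rewrite mxE mulr_suml.
rewrite exchange_big /=; apply: eq_bigr => j _; rewrite mxE mulr_suml.
by apply: eq_bigr => k _; rewrite mxE; ring.
Qed.

Lemma dotv_odot (F M : pt -> mx) u x : dotv (odot F M x) (u x) = ddot (convect u F x) (M x).
Proof.
rewrite /dotv /convect; elim/big_rec2: _ => [|k a B _ ->].
  by rewrite ddotC ddot0r.
by rewrite ddotDl ddotZl mxE mulrC.
Qed.

(** The forces exerted by (M, mu) on the velocity are adjoint to the transport of (F, phi) by it.
    This produces the transpose in B B^T and the cancellation in the energy law. *)
Lemma coupling_dual w u : coupling w u =
  \int3_(x in A) (ddot (convect u Fn x) (w.1 x))
  - \int3_(x in A) (ddot (gradv u x *m Fn x) (w.1 x))
  + \int3_(x in A) (dotv (u x) (grad phin x) * w.2 x).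
Proof.
rewrite /coupling addrAC addrC addrA addrC addrA.
congr (_ - _ + _).
- by apply: eq_int3 => x _; rewrite dotv_odot.
- by apply: eq_int3 => x _; rewrite ddot_mul_tr.
- by apply: eq_int3 => x _; rewrite mulrC dotvC.
Qed.

Lemma coupling_ucoefs u : Vh Omega Th u ->
  ucoefs Omega Th (fun x => convect u Fn x - gradv u x *m Fn x) (fun _ _ => 0)
    (fun x => dotv (u x) (grad phin x)) (fun=> 0).
Proof.
move=> Vu; have du := Vh_dirnice oO bO Vu; have nu := mdirnice_mnice du.
split; [|by move=> k; exact: mnice0| |exact: mnice0].
  apply: mniceB => //; first exact: mnice_convect.
  by apply: mniceM => //; [exact: mnice_gradv|exact: (mdirnice_mnice dFn)].
by apply: nice_dotv => //; exact: mnice_grad.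
Qed.

Lemma coupling_U w u : PW Omega Th w -> Vh Omega Th u ->
  coupling w u = U Omega Th (fun x => convect u Fn x - gradv u x *m Fn x) (fun _ _ => 0)
    (fun x => dotv (u x) (grad phin x)) (fun=> 0) w.
Proof.
move=> Pw Vu; rewrite coupling_Vf //; apply: eq_int3 => x _.
rewrite /vform /uform ddotNl dotvDl dotvZl ddot_mul_tr dotv_odot ddotBl.
rewrite big1 ?addr0 => [|k _]; last by rewrite ddotC ddot0r.
by rewrite [dotv 0 _]dotvC dotv0r (dotvC (u x)) mulrC; ring.
Qed.

Variables (b : R -> R) (gamma : R).
Hypothesis cb : continuous b.
Hypothesis b_ge0 : forall r, 0 <= b r.
Hypothesis gamma_ge0 : 0 <= gamma.

Definition diffusion w w' : R :=
  gamma * \int3_(x in A) (ddot (w.1 x) (w'.1 x))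
  + \int3_(x in A) (b (phin x) * dotv (grad w.2 x) (grad w'.2 x)).

Lemma diffusionC w w' : diffusion w w' = diffusion w' w.
Proof.
rewrite /diffusion.
have -> : \int3_(x in A) (ddot (w.1 x) (w'.1 x)) = \int3_(x in A) (ddot (w'.1 x) (w.1 x)).
  by apply: eq_int3 => x _; exact: ddotC.
have -> // : \int3_(x in A) (b (phin x) * dotv (grad w.2 x) (grad w'.2 x)) =
  \int3_(x in A) (b (phin x) * dotv (grad w'.2 x) (grad w.2 x)).
by apply: eq_int3 => x _; rewrite (dotvC (grad w.2 x)).
Qed.

Lemma diffusion_ge0 w : 0 <= diffusion w w.
Proof.
apply: addr_ge0; first by apply: mulr_ge0 => //; apply: int3_ge0 => x _; exact: ddot_ge0.
by apply: int3_ge0 => x _; apply: mulr_ge0 => //; exact: dotv_ge0.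
Qed.

Lemma diffusion_ucoefs w : PW Omega Th w ->
  ucoefs Omega Th (fun x => gamma *: w.1 x) (fun _ _ => 0) (fun=> 0)
    (fun x => b (phin x) *: grad w.2 x).
Proof.
move=> Pw; split; [|by move=> k; exact: mnice0|exact: nice_cst|].
  apply: mniceZ => //; [exact: nice_cst|exact: (mdirnice_mnice (PW1 oO bO Pw))].
apply: mniceZ => //; first exact: (nice_comp Th oO bO Sn.1 cb).
exact: (mnice_grad oA (PW2 oO bO Pw)).
Qed.

Lemma diffusion_U w w' : PW Omega Th w -> PW Omega Th w' ->
  diffusion w w' = U Omega Th (fun x => gamma *: w.1 x) (fun _ _ => 0) (fun=> 0)
    (fun x => b (phin x) *: grad w.2 x) w'.
Proof.
move=> Pw Pw'.
have n1 : nice A (fun x => ddot (w.1 x) (w'.1 x)).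
  by apply: nice_ddot => //; exact: (mdirnice_mnice (PW1 oO bO _)).
have n2 : nice A (fun x => b (phin x) * dotv (grad w.2 x) (grad w'.2 x)).
  apply: niceM; first exact: (nice_comp Th oO bO Sn.1 cb).
  by apply: nice_dotv => //; exact: (mnice_grad oA (PW2 oO bO _)).
rewrite /diffusion -(int3Z oA Aa) // -(int3D oA Aa) //; last exact: niceZ.
apply: eq_int3 => x _; rewrite /uform ddotZl dotvZl mul0r addr0.
by rewrite big1 ?addr0 // => k _; rewrite ddotC ddot0r.
Qed.

End WeakForms.

Section EnergyEstimates.
Variable R : realType.
Local Notation pt := 'rV[R]_3.
Local Notation mx := 'M[R]_3.
Variables (Omega : set pt) (Th : mesh R).
Hypothesis oO : open Omega.
Hypothesis bO : bounded_set Omega.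

Local Notation A := (cells Omega Th).
Let oA : open A := cells_open oO.
Let ra : R := sval (cid (@A_ball _ _ Th bO)).
Let Aa : A `<=` ball 0 ra := svalP (cid (@A_ball _ _ Th bO)).

Variables (E : energy R) (S : splitting R).
Hypothesis CS : convex_splitting E S.
Hypothesis eg0 : forall M, 0 <= eg E M.
Variable Kd : R.
Hypothesis dens_ge : forall r M, - Kd <= psi E r + eh E M + ef E r * eg E M.

Definition cell_energy phi F := \int3_(x in A) energy_density E phi F x.
Definition domain_volume := \int3_(x in A) (1 : R).

Lemma cell_energy_ge phi F : Sh Omega Th phi -> Xh Omega Th F ->
  - (Kd * domain_volume) + (1 / 2 * \int3_(x in A) (dotv (grad phi x) (grad phi x)) +
    lambda E / 2 * \int3_(x in A) (ddotgrad F F x)) <= cell_energy phi F.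
Proof.
move=> Sp XF.
have np := mnice_grad oA (Sh_dirnice oO bO Sp).
have n1 : nice A (fun x => dotv (grad phi x) (grad phi x)) by exact: nice_dotv.
have n2 : nice A (fun x => ddotgrad F F x).
  apply: nice_sum => // k _; have nk := mnice_pdm oA k (Xh_dirnice oO bO XF).
  exact: nice_ddot.
have z1 := niceZ (1 / 2) n1; have z2 := niceZ (lambda E / 2) n2.
have z3 : nice A (fun=> - Kd * 1) by exact: nice_cst.
rewrite -mulNr -(int3Z oA Aa _ (nice_cst A 1)) -!(int3Z oA Aa) // -!(int3D oA Aa) //; last exact: niceD.
apply: (le_int3 oA Aa); [by apply: niceD => //; exact: niceD|exact: (energy_density_nice oO bO CS)|].
move=> x _; rewrite /energy_density mulr1 addrA !lerD2r; exact: dens_ge.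
Qed.

Variables (phin : pt -> R) (Fn : pt -> mx).
Hypothesis Sn : Sh Omega Th phin.
Hypothesis Xn : Xh Omega Th Fn.

Local Notation source F phi := (U Omega Th (elastic_stress E S phin Fn F) (stress_gradient E F)
  (chemical_source E S phin F phi) (grad phi)).

(** The substitute for the energy gradient, tested with the increment, dominates the energy
    increment plus the numerical dissipation. *)
Lemma source_ge F phi : Sh Omega Th phi -> Xh Omega Th F ->
  cell_energy phi F - cell_energy phin Fn
  + (1 / 2 * \int3_(x in A) (dotv (grad phi x - grad phin x) (grad phi x - grad phin x))
   + lambda E / 2 * \int3_(x in A) (\sum_k ddot (pdm k F x - pdm k Fn x) (pdm k F x - pdm k Fn x)))
  <= source F phi ((F - Fn, (phi : pt -> R^o) - phin) : Wt R).
Proof.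
move=> Sp XF.
have np := mnice_grad oA (Sh_dirnice oO bO Sp).
have npn := mnice_grad oA (Sh_dirnice oO bO Sn).
have n1 : nice A (fun x => dotv (grad phi x - grad phin x) (grad phi x - grad phin x)).
  by apply: nice_dotv => //; exact: mniceB.
have n2 : nice A (fun x => \sum_k ddot (pdm k F x - pdm k Fn x) (pdm k F x - pdm k Fn x)).
  apply: nice_sum => // k _; apply: nice_ddot => //; apply: mniceB => //.
  - exact: (mnice_pdm oA k (Xh_dirnice oO bO XF)).
  - exact: (mnice_pdm oA k (Xh_dirnice oO bO Xn)).
  - exact: (mnice_pdm oA k (Xh_dirnice oO bO XF)).
  - exact: (mnice_pdm oA k (Xh_dirnice oO bO Xn)).
have z1 := niceZ (1 / 2) n1; have z2 := niceZ (lambda E / 2) n2.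
have e1 := energy_density_nice oO bO CS Sp XF.
have e2 := energy_density_nice oO bO CS Sn Xn.
have e3 := niceB oA e1 e2; have e4 := niceD z1 z2.
rewrite -!(int3Z oA Aa) // -(int3B oA Aa) // -!(int3D oA Aa) //.
apply: (le_int3 oA Aa); first exact: niceD.
  apply: (uform_nice oO bO); first exact: (scheme_ucoefs oO bO CS).
  split=> /=; first by rewrite -(scaleN1r Fn) addrC; exact: (XhL _ Xn XF).
  by rewrite -(@scaleN1r R (pt -> R^o) phin) addrC; exact: (ShL _ Sn Sp).
by move=> x Ax; exact: (energy_density_step oO bO CS eg0 Sn Xn XF Sp Ax).
Qed.

Lemma source_split F phi w : Sh Omega Th phi -> Xh Omega Th F -> PW Omega Th w ->
  source F phi w =
    (\int3_(x in A) (ddot (dmx (hp S) (F x) + dmx (hm S) (Fn x)) (w.1 x))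
     + \int3_(x in A) (pospart (ef E (phin x)) *
            ddot (dmx (gp S) (F x) + dmx (gm S) (Fn x)) (w.1 x))
     + \int3_(x in A) ((ef E (phin x) - pospart (ef E (phin x))) *
            ddot (dmx (gp S) (Fn x) + dmx (gm S) (F x)) (w.1 x))
     + lambda E * \int3_(x in A) (ddotgrad F w.1 x))
  + (\int3_(x in A) (dotv (grad phi x) (grad w.2 x))
     + \int3_(x in A)
            (((psip S)^`()%classic (phi x) + (psim S)^`()%classic (phin x)) * w.2 x)
     + \int3_(x in A)
            (((fp S)^`()%classic (phi x) * eg E (F x)
              + (fm S)^`()%classic (phin x) * eg E (F x)) * w.2 x)).
Proof.
move=> Sp XF Pw.
have [[p1 p2 _ _ _] [f1 f2 _ _ _] [g1 g2 _ _ _] [h1 h2 _ _ _]] := CS.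
have d1 := PW1 oO bO Pw; have nw1 := mdirnice_mnice d1.
have d2 := PW2 oO bO Pw; have [nw2 _ _] := d2.
have nf : nice A (fun x => ef E (phin x)) by exact: (nice_comp Th oO bO Sn.1 (ef_continuous CS)).
have ng : nice A (fun x => eg E (F x)) by exact: (nice_comp Th oO bO XF.1 (eg_continuous CS)).
have npf : nice A (fun x => pospart (ef E (phin x))).
  apply: (nice_comp Th oO bO (H := fun r => pospart (ef E r)) Sn.1) => r.
  by apply: continuous_at_comp; [exact: ef_continuous CS _|exact: pospart_continuous].
have nd g f G : C1mx g -> C1mx f -> Xh Omega Th G ->
    nice A (fun x => ddot (dmx g (F x) + dmx f (G x)) (w.1 x)).
  by move=> cg cf XG; apply: nice_ddot => //; apply: mniceD => //; exact: (mnice_dmx oO bO).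
have i1 := nd _ _ _ h1 h2 Xn.
have i2 := niceM npf (nd _ _ _ g1 g2 Xn).
have i3 : nice A (fun x => (ef E (phin x) - pospart (ef E (phin x))) *
            ddot (dmx (gp S) (Fn x) + dmx (gm S) (F x)) (w.1 x)).
  apply: niceM; first exact: niceB.
  by apply: nice_ddot => //; apply: mniceD => //; exact: (mnice_dmx oO bO).
have i4 : nice A (ddotgrad F w.1).
  apply: nice_sum => // k _; apply: nice_ddot => //; last exact: (mnice_pdm oA k d1).
  exact: (mnice_pdm oA k (Xh_dirnice oO bO XF)).
have i5 : nice A (fun x => dotv (grad phi x) (grad w.2 x)).
  by apply: nice_dotv => //; [exact: (mnice_grad oA (Sh_dirnice oO bO Sp))|exact: (mnice_grad oA d2)].
have nc f (q : pt -> R) : C1 f -> Sh Omega Th q -> nice A (fun x => f^`()%classic (q x)).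
  by move=> cf Sq; exact: (C1_derive_nice oO bO).
have i6 : nice A (fun x => ((psip S)^`()%classic (phi x) + (psim S)^`()%classic (phin x)) * w.2 x).
  by apply: niceM => //; apply: niceD; exact: nc.
have i7 : nice A (fun x => ((fp S)^`()%classic (phi x) * eg E (F x)
              + (fm S)^`()%classic (phin x) * eg E (F x)) * w.2 x).
  by apply: niceM => //; apply: niceD; apply: niceM => //; exact: nc.
have z4 := niceZ (lambda E) i4.
have s12 := niceD i1 i2; have s123 := niceD s12 i3; have s1234 := niceD s123 z4.
have s56 := niceD i5 i6; have s567 := niceD s56 i7.
rewrite -!(int3Z oA Aa) // -!(int3D oA Aa) //.
apply: eq_int3 => x _; rewrite /uform /elastic_stress /chemical_source /stress_gradient.
rewrite !(ddotDl (_ + _)) !ddotZl /ddotgrad.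
under eq_bigr do rewrite ddotZl.
rewrite -mulr_sumr; ring.
Qed.

End EnergyEstimates.

Section Existence.
Variable R : realType.
Local Notation pt := 'rV[R]_3.
Local Notation mx := 'M[R]_3.
Variables (Omega : set pt) (Th : mesh R).
Hypothesis oO : open Omega.
Hypothesis cO : connected Omega.
Hypothesis nO : Omega !=set0.
Hypothesis bO : bounded_set Omega.
Hypothesis cover : closure Omega = \bigcup_i hull (cell (m := Th) i).

Local Notation A := (cells Omega Th).
Let oA : open A := cells_open oO.
Let ra : R := sval (cid (@A_ball _ _ Th bO)).
Let Aa : A `<=` ball 0 ra := svalP (cid (@A_ball _ _ Th bO)).

Variables (E : energy R) (S : splitting R).
Hypothesis CS : convex_splitting E S.
Hypothesis eg0 : forall M, 0 <= eg E M.
Hypothesis lam0 : 0 < lambda E.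
Variable Kd : R.
Hypothesis dens_ge : forall r M, - Kd <= psi E r + eh E M + ef E r * eg E M.
Variables (b : R -> R) (nu gamma dt : R).
Hypothesis cb : continuous b.
Hypothesis b_ge0 : forall r, 0 <= b r.
Hypothesis nu0 : 0 < nu.
Hypothesis gamma0 : 0 < gamma.
Hypothesis dt0 : 0 < dt.

Variables (phin : pt -> R) (Fn : pt -> mx).
Hypothesis Sn : Sh Omega Th phin.
Hypothesis Xn : Xh Omega Th Fn.

Local Notation source F phi := (U Omega Th (elastic_stress E S phin Fn F) (stress_gradient E F)
  (chemical_source E S phin F phi) (grad phi)).

Definition divfree (u : pt -> pt) :=
  Vh Omega Th u /\ forall p, Rh Omega Th p -> \int3_(x in A) (p x * divv u x) = 0.

Lemma divfree0 : divfree 0.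
Proof.
split; first exact: Vh0.
move=> p _; rewrite int3_div_Vf //; exact: Vf0.
Qed.

Lemma divfreeL a u v : divfree u -> divfree v -> divfree (a *: u + v).
Proof.
move=> [Vu du] [Vv dv]; split; first exact: VhL.
move=> p Pp; have [/(Sh_dirnice oO bO)[np _ _] _] := Pp.
have := du p Pp; have := dv p Pp; rewrite !int3_div_Vf => d1 d2.
rewrite (@VfL _ _ _ oO bO) ?d1 ?d2 ?mulr0 ?addr0 //; [exact: mnice_scalar|exact: mnice0].
Qed.

Lemma U_sum al be rh si n (z : 'I_n -> R) (e : 'I_n -> Wt R) : ucoefs Omega Th al be rh si ->
  (forall i, PW Omega Th (e i)) ->
  U Omega Th al be rh si (\sum_i z i *: e i) = \sum_i z i * U Omega Th al be rh si (e i).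
Proof.
move=> uc Pe.
by rewrite (linear_on_sum (PW0 Omega Th) (fun a u v => @PWL R Omega Th a u v)
  (fun a u v Pu Pv => U_L oO bO a uc Pu Pv) z Pe).
Qed.

Lemma coupling_suml n (z : 'I_n -> R) (e : 'I_n -> Wt R) u : (forall i, PW Omega Th (e i)) ->
  Vh Omega Th u ->
  coupling Omega Th phin Fn (\sum_i z i *: e i) u = \sum_i z i * coupling Omega Th phin Fn (e i) u.
Proof.
move=> Pe Vu.
have Pz : PW Omega Th (\sum_i z i *: e i).
  exact: (P_sum (PW0 Omega Th) (fun a u v => @PWL R Omega Th a u v) z xpredT Pe).
rewrite (coupling_U oO bO Sn Xn Pz Vu) (U_sum _ (coupling_ucoefs oO bO Sn Xn Vu) Pe).
by apply: eq_bigr => i _; rewrite (coupling_U oO bO Sn Xn (Pe i) Vu).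
Qed.

Lemma divfree_sum n (y : 'I_n -> R) (f : 'I_n -> Vt R) : (forall j, divfree (f j)) ->
  divfree (\sum_j y j *: f j).
Proof. by move=> Pf; exact: (P_sum divfree0 divfreeL y xpredT Pf). Qed.

Lemma coupling_sumr n (y : 'I_n -> R) (f : 'I_n -> Vt R) w : (forall j, divfree (f j)) ->
  PW Omega Th w ->
  coupling Omega Th phin Fn w (\sum_j y j *: f j) = \sum_j y j * coupling Omega Th phin Fn w (f j).
Proof.
move=> Pf Pw; have [c1 c2] := coupling_vcoefs oO bO Sn Xn Pw.
have [Vs _] := divfree_sum y Pf; rewrite (coupling_Vf oO bO Sn Xn Pw Vs).
rewrite (linear_on_sum divfree0 divfreeL
  (fun a u v (Pu : divfree u) (Pv : divfree v) => VfL oO bO a c1 c2 Pu.1 Pv.1) y Pf).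
by apply: eq_bigr => i _; rewrite (coupling_Vf oO bO Sn Xn Pw (Pf i).1).
Qed.

Lemma diffusion_sumr n (z : 'I_n -> R) (e : 'I_n -> Wt R) w : (forall i, PW Omega Th (e i)) ->
  PW Omega Th w -> diffusion Omega Th phin b gamma w (\sum_i z i *: e i) =
  \sum_i z i * diffusion Omega Th phin b gamma w (e i).
Proof.
move=> Pe Pw.
have Pz : PW Omega Th (\sum_i z i *: e i).
  exact: (P_sum (PW0 Omega Th) (fun a u v => @PWL R Omega Th a u v) z xpredT Pe).
rewrite (diffusion_U oO bO Sn gamma cb Pw Pz) (U_sum _ (diffusion_ucoefs oO bO Sn gamma cb Pw) Pe).
by apply: eq_bigr => i _; rewrite (diffusion_U oO bO Sn gamma cb Pw (Pe i)).
Qed.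

Lemma ipVL a u v w : divfree u -> divfree v -> divfree w ->
  ipV Omega Th nu (a *: u + v) w = a * ipV Omega Th nu u w + ipV Omega Th nu v w.
Proof.
move=> [Vu _] [Vv _] [Vw _].
have nw : mnice A (gradv w) by exact: (mnice_gradv oA (Vh_dirnice oO bO Vw)).
rewrite ![ipV _ _ _ _ w]ipVC !(ipV_Vf Omega Th nu w).
by rewrite (VfL oO bO a nw (@mnice0 R Omega Th oO 1 3) Vu Vv); ring.
Qed.

Local Notation coup := (coupling Omega Th phin Fn).
Local Notation diff := (diffusion Omega Th phin b gamma).

Lemma W_functional_expand (Psi : Wt R -> R) n (e : 'I_n -> Wt R) w : (forall i, PW Omega Th (e i)) ->
  PW Omega Th w -> PW Omega Th (w - \sum_i ipW Omega Th w (e i) *: e i) ->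
  Psi (w - \sum_i ipW Omega Th w (e i) *: e i) = 0 ->
  (forall a u v, PW Omega Th u -> PW Omega Th v -> Psi (a *: u + v) = a * Psi u + Psi v) ->
  Psi w = \sum_i ipW Omega Th w (e i) * Psi (e i).
Proof.
move=> Pe Pw Pr r0 PsiL.
exact: (linear_on_expand (PW0 Omega Th) (fun a u v => @PWL R Omega Th a u v) PsiL Pe Pw Pr r0).
Qed.

(** The bound involves only the lower bound of the energy density and the energy of the old level,
    not the unknown: this is the constant [C] of the solvability criterion. *)
Lemma source_coercive F phi : Sh Omega Th phi -> Xh Omega Th F ->
  - (Kd * domain_volume Omega Th + cell_energy Omega Th E phin Fn) <=
  source F phi ((F - Fn, (phi : pt -> R^o) - phin) : Wt R).
Proof.
move=> Sp XF.
have H1 := source_ge oO bO CS eg0 Sn Xn Sp XF; have H2 := cell_energy_ge oO bO CS dens_ge Sp XF.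
apply: le_trans H1.
have p1 : 0 <= \int3_(x in A) (dotv (grad phi x - grad phin x) (grad phi x - grad phin x)).
  by apply: int3_ge0 => x _; exact: dotv_ge0.
have l2 : 0 <= lambda E / 2 by rewrite divr_ge0 // ltW.
have p2 : 0 <= lambda E / 2 * \int3_(x in A) (\sum_k ddot (pdm k F x - pdm k Fn x) (pdm k F x - pdm k Fn x)).
  by apply: mulr_ge0 => //; apply: int3_ge0 => x _; apply: sumr_ge0 => k _; exact: ddot_ge0.
have p3 : 0 <= \int3_(x in A) (dotv (grad phi x) (grad phi x)).
  by apply: int3_ge0 => x _; exact: dotv_ge0.
have p4 : 0 <= lambda E / 2 * \int3_(x in A) (ddotgrad F F x).
  by apply: mulr_ge0 => //; apply: int3_ge0 => x _; apply: sumr_ge0 => k _; exact: ddot_ge0.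
have arith (k c1 c2 i1 l1 i3 l3 : R) : 0 <= i1 -> 0 <= l1 -> 0 <= i3 -> 0 <= l3 ->
    - k + (1 / 2 * i3 + l3) <= c1 -> - (k + c2) <= c1 - c2 + (1 / 2 * i1 + l1) by lra.
exact: arith p1 p2 p3 p4 H2.
Qed.

(** The scheme without pressure: [w] stands for (M, mu), [dl] for the increments of (F, phi), and
    the velocity equation is tested with divergence-free fields only. *)
Lemma discrete_solution : exists (w dl : Wt R) (v : Vt R),
  [/\ PW Omega Th w, PW Omega Th dl /\ divfree v,
   forall w', PW Omega Th w' -> ipW Omega Th w w' = source (Fn + dl.1) ((phin : pt -> R^o) + dl.2) w',
   forall u, divfree u -> ipV Omega Th nu v u = coup w u &
   forall w', PW Omega Th w' -> ipW Omega Th dl w' = - dt * (coup w' v + diff w w')].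
Proof.
have [d [e [oe He]]] := @W_basis R Omega Th oO bO.
have [m [f [of_ Hf]]] := @V_basis R Omega Th oO cO nO bO cover nu divfree nu0 divfree0 divfreeL
   (fun u H => H.1).
have [Pe ee] := oe; have [Pf ff] := of_.
have ge0 : 0 <= gamma by exact: ltW.
pose B : 'M[R]_(d, m) := \matrix_(i, j) coup (e i) (f j).
pose D : 'M[R]_d := \matrix_(i, j) diff (e i) (e j).
pose wx (z : 'rV[R]_d) : Wt R := \sum_i z 0 i *: e i.
pose vy (y : 'rV[R]_m) : Vt R := \sum_j y 0 j *: f j.
have Pwx z : PW Omega Th (wx z).
  exact: (P_sum (PW0 Omega Th) (fun a u v => @PWL R Omega Th a u v) _ xpredT Pe).
have Pvy y : divfree (vy y) by exact: divfree_sum.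
have dotD z z' : dot (z *m D) z' = diff (wx z) (wx z').
  rewrite diffusion_sumr //; apply: eq_bigr => j _; rewrite mxE mulrC; congr (_ * _).
  rewrite diffusionC diffusion_sumr //; apply: eq_bigr => i _.
  by rewrite mxE diffusionC.
(* The basis [f] is orthonormal for the viscous product, so the velocity driven by potentials with
   coordinates z has coordinates z B; inserting it in the transport terms yields z B B^T. *)
pose Am := B *m B^T + D.
have sA : Am^T = Am.
  rewrite /Am linearD /= trmx_mul trmxK; congr (_ + _).
  by apply/matrixP => i j; rewrite !mxE diffusionC.
have AmE z z' : dot (z *m Am) z' = dot (z *m B) (z' *m B) + diff (wx z) (wx z').
  by rewrite mulmxDr dotDl mulmxA dot_mulmx trmxK dotD.
have pA z : 0 <= dot (z *m Am) z.
  by rewrite AmE addr_ge0 ?dot_ge0 //; exact: diffusion_ge0.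
have [c c0 Ac] := psd_mulmx_bound sA pA.
pose G (X : 'rV[R]_d) : 'rV[R]_d := \row_k residual Omega Th E S phin Fn e X (e k).
have cG : continuous G.
  move=> X; apply: continuous_at_mx => i k.
  apply: (@eq_continuous_at _ _ (fun X => residual Omega Th E S phin Fn e X (e k))).
    by move=> Y; rewrite mxE.
  exact: (residual_continuous oO bO CS Sn Xn Pe (Pe k)).
pose C := `|Kd * domain_volume Omega Th + cell_energy Omega Th E phin Fn|.
have stE X : wx X = (((state phin Fn e X).1 - Fn, ((state phin Fn e X).2 : pt -> R^o) - phin) : Wt R).
  have <- : state phin Fn e X - (Fn, phin) = wx X by rewrite /state addrC addKr.
  by [].
have us X : ucoefs Omega Th (elastic_stress E S phin Fn (state phin Fn e X).1)
    (stress_gradient E (state phin Fn e X).1)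
    (chemical_source E S phin (state phin Fn e X).1 (state phin Fn e X).2) (grad (state phin Fn e X).2).
  by have [XF Sp] := state_PW Sn Xn Pe X; exact: (scheme_ucoefs oO bO CS).
have gG X : - C <= dot X (G X).
  have [XF Sp] := state_PW Sn Xn Pe X.
  (* By linearity this is the energy gradient tested with the increment itself, to which
     [source_coercive] applies. *)
  have -> : dot X (G X) = source (state phin Fn e X).1 (state phin Fn e X).2 (wx X).
    rewrite /wx (U_sum _ (us X) Pe).
    by apply: eq_bigr => k _; rewrite mxE.
  rewrite stE; apply: le_trans (source_coercive Sp XF); rewrite lerN2; exact: ler_norm.
have [X HX] := gradient_system_solvable (ltW dt0) c0 (normr_ge0 _) cG Ac gG.
set y := G X *m B.
have vE j : y 0 j = coup (wx (G X)) (f j).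
  rewrite mxE (coupling_suml _ Pe (Pf j).1); apply: eq_bigr => i _.
  by rewrite [B _ _]mxE.
exists (wx (G X)), (wx X), (vy y); split=> //.
(* Both sides are linear in the test function and ignore what vanishes on [cells], so comparing them
   on the basis is enough. The next two equations are treated likewise. *)
- move=> w' Pw'; have [Pr r0] := He w' Pw'.
  have ux := ipW_coefs oO bO (Pwx (G X)).
  rewrite ipW_U (W_functional_expand Pe Pw' Pr (U_0 oO _ _ _ _ r0)
    (fun a u v Pu Pv => U_L oO bO a ux Pu Pv)).
  rewrite [RHS](W_functional_expand Pe Pw' Pr (U_0 oO _ _ _ _ r0)
    (fun a u v Pu Pv => U_L oO bO a (us X) Pu Pv)).
  apply: eq_bigr => k _; congr (_ * _); rewrite -ipW_U.
  rewrite (orthonormal_coord (PW0 Omega Th) (fun a u v => @PWL R Omega Th a u v)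
     (fun a u v w => @ipWL R Omega Th oO bO a u v w) _ _ oe).
  by rewrite mxE.
- move=> u Du; have [Pr r0] := Hf u Du; have [Vv _] := Pvy y; have [Vu _] := Du.
  have ngv : mnice A (gradv (vy y)) by exact: (mnice_gradv oA (Vh_dirnice oO bO Vv)).
  have n0 := @mnice0 R Omega Th oO 1 3.
  have [c1 c2] := coupling_vcoefs oO bO Sn Xn (Pwx (G X)).
  have ex al1 si1 : mnice A al1 -> mnice A si1 ->
      Vf Omega Th al1 si1 u = \sum_i ipV Omega Th nu u (f i) * Vf Omega Th al1 si1 (f i).
    move=> m1 m2; apply: (linear_on_expand divfree0 divfreeL
      (fun a u v (Pu : divfree u) (Pv : divfree v) => VfL oO bO a m1 m2 Pu.1 Pv.1) Pf Du Pr).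
    exact: (Vf0 oO _ _ r0).
  rewrite (coupling_Vf oO bO Sn Xn (Pwx _) Vu) ipV_Vf (ex _ _ ngv n0) (ex _ _ c1 c2) mulr_sumr.
  apply: eq_bigr => j _.
  rewrite mulrCA; congr (_ * _).
  rewrite -ipV_Vf -(coupling_Vf oO bO Sn Xn (Pwx _) (Pf j).1) -vE.
  exact: (orthonormal_coord divfree0 divfreeL ipVL _ _ of_).
- move=> w' Pw'; have [Pr r0] := He w' Pw'.
  have [Vv _] := Pvy y.
  have uc := coupling_ucoefs oO bO Sn Xn Vv.
  have ud := diffusion_ucoefs oO bO Sn gamma cb (Pwx (G X)).
  have ux := ipW_coefs oO bO (Pwx X).
  pose Phi w1 := - dt * (coup w1 (vy y) + diff (wx (G X)) w1).
  have PhiE w1 : PW Omega Th w1 -> Phi w1 = - dt *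
      (U Omega Th (fun x => convect (vy y) Fn x - gradv (vy y) x *m Fn x) (fun _ _ => 0)
        (fun x => dotv (vy y x) (grad phin x)) (fun=> 0) w1 +
       U Omega Th (fun x => gamma *: (wx (G X)).1 x) (fun _ _ => 0) (fun=> 0)
        (fun x => b (phin x) *: grad (wx (G X)).2 x) w1).
    move=> Pw1; rewrite /Phi (coupling_U oO bO Sn Xn Pw1 Vv).
    by rewrite (diffusion_U oO bO Sn gamma cb (Pwx _) Pw1).
  have Phi0 : Phi (w' - \sum_i ipW Omega Th w' (e i) *: e i) = 0.
    by rewrite (PhiE _ Pr) !(U_0 oO _ _ _ _ r0) addr0 mulr0.
  have PhiL a u v : PW Omega Th u -> PW Omega Th v -> Phi (a *: u + v) = a * Phi u + Phi v.
    move=> Pu Pv; rewrite !PhiE //; last exact: PWL.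
    rewrite (U_L oO bO a uc Pu Pv) (U_L oO bO a ud Pu Pv).
    move: (U _ _ _ _ _ _ u) (U _ _ _ _ _ _ v) (U _ _ _ _ _ _ u) (U _ _ _ _ _ _ v) => q1 q2 q3 q4.
    ring.
  rewrite -/(Phi w') (W_functional_expand Pe Pw' Pr Phi0 PhiL).
  rewrite ipW_U (W_functional_expand Pe Pw' Pr (U_0 oO _ _ _ _ r0)
    (fun a u v Pu Pv => U_L oO bO a ux Pu Pv)).
  apply: eq_bigr => k _; congr (_ * _); rewrite -ipW_U.
  rewrite (orthonormal_coord (PW0 Omega Th) (fun a u v => @PWL R Omega Th a u v)
     (fun a u v w => @ipWL R Omega Th oO bO a u v w) _ _ oe).
  rewrite {1}HX mxE /Phi; congr (_ * _).
  rewrite mulmxDr mxE mulmxA; congr (_ + _).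
    rewrite -/y mxE /vy (coupling_sumr _ Pf (Pe k)).
    by apply: eq_bigr => j _; rewrite !mxE.
  rewrite diffusionC /wx (diffusion_sumr _ Pe (Pe k)) mxE; apply: eq_bigr => i _.
  by rewrite [D _ _]mxE diffusionC.
Qed.

End Existence.

Section Components.
Variable R : realType.
Local Notation pt := 'rV[R]_3.
Local Notation mx := 'M[R]_3.
Variables (Omega : set pt) (Th : mesh R).
Hypothesis oO : open Omega.
Hypothesis cO : connected Omega.
Hypothesis nO : Omega !=set0.
Hypothesis bO : bounded_set Omega.
Hypothesis cover : closure Omega = \bigcup_i hull (cell (m := Th) i).

Local Notation A := (cells Omega Th).
Let oA : open A := cells_open oO.
Let ra : R := sval (cid (@A_ball _ _ Th bO)).
Let Aa : A `<=` ball 0 ra := svalP (cid (@A_ball _ _ Th bO)).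

Lemma int3_zero (f : pt -> R) : (forall x, A x -> f x = 0) -> \int3_(x in A) f x = 0.
Proof. by move=> f0; rewrite -[RHS](int3_0 oA); exact: eq_int3. Qed.

Variables (E : energy R) (S : splitting R).
Hypothesis CS : convex_splitting E S.
Variables (b : R -> R) (nu gamma dt : R) (phin : pt -> R) (Fn : pt -> mx).
Hypothesis cb : continuous b.
Hypothesis Sn : Sh Omega Th phin.
Hypothesis Xn : Xh Omega Th Fn.

(** Test functions with one zero component separate the paired equations into the tensor and the
    scalar equations of the scheme. *)
Definition wfst (Theta : pt -> mx) : Wt R := (Theta, 0).
Definition wsnd (xi : pt -> R) : Wt R := (0, xi).

Lemma wfst_PW Theta : Xh Omega Th Theta -> PW Omega Th (wfst Theta).
Proof. by move=> XT; split => //; exact: Sh0. Qed.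

Lemma wsnd_PW xi : Sh Omega Th xi -> PW Omega Th (wsnd xi).
Proof. by move=> Sx; split => //; exact: Xh0. Qed.

Lemma ipW_fst w Theta : ipW Omega Th w (wfst Theta) = \int3_(x in A) (ddot (w.1 x) (Theta x)).
Proof. by apply: eq_int3 => x _; rewrite /= mulr0 addr0. Qed.

Lemma ipW_snd w xi : ipW Omega Th w (wsnd xi) = \int3_(x in A) (w.2 x * xi x).
Proof. by apply: eq_int3 => x _; rewrite /= ddot0r add0r. Qed.

Lemma coupling_fst Theta v : coupling Omega Th phin Fn (wfst Theta) v =
  \int3_(x in A) (ddot (convect v Fn x) (Theta x)) - \int3_(x in A) (ddot (gradv v x *m Fn x) (Theta x)).
Proof.
rewrite coupling_dual [X in _ + X]int3_zero ?addr0 // => x _.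
exact: mulr0.
Qed.

Lemma coupling_snd xi v : coupling Omega Th phin Fn (wsnd xi) v =
  \int3_(x in A) (dotv (v x) (grad phin x) * xi x).
Proof.
rewrite coupling_dual !(int3_zero (f := fun x => ddot _ _)) ?subr0 ?add0r // => x _; exact: ddot0r.
Qed.

Lemma diffusion_fst w Theta : diffusion Omega Th phin b gamma w (wfst Theta) =
  gamma * \int3_(x in A) (ddot (w.1 x) (Theta x)).
Proof.
rewrite /diffusion [X in _ + X]int3_zero ?addr0 // => x Ax.
by rewrite (grad0 oA (f := (wfst Theta).2) (fun _ _ => erefl) Ax) dotv0r mulr0.
Qed.

Lemma diffusion_snd w xi : diffusion Omega Th phin b gamma w (wsnd xi) =
  \int3_(x in A) (b (phin x) * dotv (grad w.2 x) (grad xi x)).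
Proof.
rewrite /diffusion [X in _ * X]int3_zero ?mulr0 ?add0r // => x Ax; exact: ddot0r.
Qed.

Local Notation source F phi := (U Omega Th (elastic_stress E S phin Fn F) (stress_gradient E F)
  (chemical_source E S phin F phi) (grad phi)).

Lemma source_fst F phi Pi : Sh Omega Th phi -> Xh Omega Th F -> Xh Omega Th Pi ->
  source F phi (wfst Pi) =
    \int3_(x in A) (ddot (dmx (hp S) (F x) + dmx (hm S) (Fn x)) (Pi x))
     + \int3_(x in A) (pospart (ef E (phin x)) *
            ddot (dmx (gp S) (F x) + dmx (gm S) (Fn x)) (Pi x))
     + \int3_(x in A) ((ef E (phin x) - pospart (ef E (phin x))) *
            ddot (dmx (gp S) (Fn x) + dmx (gm S) (F x)) (Pi x))
     + lambda E * \int3_(x in A) (ddotgrad F Pi x).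
Proof.
move=> Sp XF XP; rewrite (source_split oO bO CS) //; last exact: wfst_PW.
rewrite [X in _ + X](_ : _ = 0) ?addr0 //.
rewrite !int3_zero ?addr0 // => x Ax; rewrite ?mulr0 //.
by rewrite (grad0 oA (f := (wfst Pi).2) (fun _ _ => erefl) Ax) dotv0r.
Qed.

Lemma source_snd F phi chi : Sh Omega Th phi -> Xh Omega Th F -> Sh Omega Th chi ->
  source F phi (wsnd chi) =
  \int3_(x in A) (dotv (grad phi x) (grad chi x))
     + \int3_(x in A)
            (((psip S)^`()%classic (phi x) + (psim S)^`()%classic (phin x)) * chi x)
     + \int3_(x in A)
            (((fp S)^`()%classic (phi x) * eg E (F x)
              + (fm S)^`()%classic (phin x) * eg E (F x)) * chi x).
Proof.
move=> Sp XF Sc; rewrite (source_split oO bO CS) //; last exact: wsnd_PW.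
rewrite [X in X + _](_ : _ = 0) ?add0r //.
rewrite !int3_zero ?mulr0 ?addr0 // => x Ax; rewrite ?ddot0r ?mulr0 //.
by rewrite /ddotgrad big1 // => k _; rewrite (pdm0 oA k (F := (wsnd chi).1) (fun _ _ => erefl) Ax) ddot0r.
Qed.

Hypothesis eg0 : forall M, 0 <= eg E M.
Hypothesis lam0 : 0 < lambda E.
Variable Kd : R.
Hypothesis dens_ge : forall r M, - Kd <= psi E r + eh E M + ef E r * eg E M.
Hypothesis b_ge0 : forall r, 0 <= b r.
Hypothesis nu0 : 0 < nu.
Hypothesis gamma0 : 0 < gamma.
Hypothesis dt0 : 0 < dt.

Lemma scheme_step_exists : exists v s F M phi mu,
  scheme_step Omega Th E S b nu gamma dt phin Fn v s F M phi mu.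
Proof.
have [w [dl [v [Pw [Pdl [Vv dv]] eqW eqV eqD]]]] :=
  discrete_solution oO cO nO bO cover CS eg0 lam0 dens_ge cb b_ge0 nu0 gamma0 dt0 Sn Xn.
have [c1 c2] := coupling_vcoefs oO bO Sn Xn Pw.
have ngv : mnice A (gradv v) by exact: (mnice_gradv oA (Vh_dirnice oO bO Vv)).
(* [al] and [si] represent viscous form minus forces. It vanishes on divergence-free fields, so it
   is the divergence tested with some pressure. *)
pose al x : mx := nu *: gradv v x - - (w.1 x *m (Fn x)^T).
pose si x : pt := - (w.2 x *: grad phin x + odot Fn w.1 x).
have nal : mnice A al.
  by apply: mniceB => //; apply: mniceZ => //; exact: nice_cst.
have nsi : mnice A si by exact: mniceN.
have VfE u : Vh Omega Th u -> Vf Omega Th al si u = ipV Omega Th nu v u - coupling Omega Th phin Fn w u.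
  move=> Vu; rewrite coupling_Vf // ipV_Vf.
  have n0 := @mnice0 R Omega Th oO 1 3.
  have n1 := vform_nice oO bO ngv n0 Vu; have n2 := vform_nice oO bO c1 c2 Vu.
  rewrite /Vf -(int3Z oA Aa) // -(int3B oA Aa) //; last exact: niceZ.
  apply: eq_int3 => x _; rewrite /vform /al /si ddotBl ddotZl dotvNl [dotv 0 _]dotvC dotv0r.
  ring.
have [s [Rs sE]] : exists s, Rh Omega Th s /\
    forall u, Vh Omega Th u -> Vf Omega Th al si u = \int3_(x in A) (s x * divv u x).
  apply: (pressure_exists oO cO nO bO cover nal nsi) => u Vu du.
  by rewrite VfE // eqV ?subrr.
have [Xd Sd] := Pdl; have [XM Smu] := Pw.
have XF : Xh Omega Th (Fn + dl.1) by rewrite -[Fn]scale1r; exact: XhL.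
have Sp : Sh Omega Th ((phin : pt -> R^o) + dl.2).
  by rewrite -[X in X + _](@scale1r R (pt -> R^o)); exact: ShL.
exists v, s, (Fn + dl.1), w.1, ((phin : pt -> R^o) + dl.2), w.2; split=> //.
move=> u p Theta Pi xi chi [Vu Rp XT XP [Sx Sc]].
rewrite !(int3_cells oO cover); split.
- rewrite -/(ipV Omega Th nu v u) -/(coupling Omega Th phin Fn w u).
  by rewrite -sE // VfE // opprB addrC subrK.
- exact: dv.
- have := eqD _ (wfst_PW XT); rewrite ipW_fst coupling_fst diffusion_fst.
  rewrite (eq_int3 (f := fun x => ddot ((Fn + dl.1) x - Fn x) (Theta x))
    (g := fun x => ddot (dl.1 x) (Theta x))); last first.
    by move=> x _; congr ddot; rewrite addrC addKr.
  move=> ->; ring.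
- by have := eqW _ (wfst_PW XP); rewrite ipW_fst source_fst.
- split; last by have := eqW _ (wsnd_PW Sc); rewrite ipW_snd source_snd.
  have := eqD _ (wsnd_PW Sx); rewrite ipW_snd coupling_snd diffusion_snd.
  rewrite (eq_int3 (f := fun x => (((phin : pt -> R^o) + dl.2) x - phin x) * xi x)
    (g := fun x => dl.2 x * xi x)); last first.
    by move=> x _; congr (_ * _); rewrite /= addrC addKr.
  move=> ->; ring.
Qed.

End Components.

(** * Stability *)

Section Stability.
Variable R : realType.
Local Notation pt := 'rV[R]_3.
Local Notation mx := 'M[R]_3.
Variables (Omega : set pt) (Th : mesh R).
Hypothesis oO : open Omega.
Hypothesis bO : bounded_set Omega.
Hypothesis cover : closure Omega = \bigcup_i hull (cell (m := Th) i).

Local Notation A := (cells Omega Th).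
Let oA : open A := cells_open oO.
Let ra : R := sval (cid (@A_ball _ _ Th bO)).
Let Aa : A `<=` ball 0 ra := svalP (cid (@A_ball _ _ Th bO)).

Variables (E : energy R) (S : splitting R).
Hypothesis CS : convex_splitting E S.
Hypothesis eg0 : forall M, 0 <= eg E M.
Variables (b : R -> R) (nu gamma dt : R).
Hypothesis dt0 : 0 < dt.

Lemma total_energy_cells phi F : Sh Omega Th phi -> Xh Omega Th F ->
  total_energy Omega E phi F = cell_energy Omega Th E phi F.
Proof.
move=> Sp XF; rewrite /total_energy /sqnorm_grad /sqnorm_gradmx !(int3_cells oO cover).
have np := mnice_grad oA (Sh_dirnice oO bO Sp).
have n1 : nice A (fun x => dotv (grad phi x) (grad phi x)) by exact: nice_dotv.
have n2 : nice A (fun x => ddotgrad F F x).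
  by apply: nice_sum => // k _; apply: nice_ddot => //; exact: (mnice_pdm oA k (Xh_dirnice oO bO XF)).
have n3 : nice A (fun x => psi E (phi x) + eh E (F x) + ef E (phi x) * eg E (F x)).
  apply: niceD; first apply: niceD.
  - exact: (nice_comp Th oO bO Sp.1 (psi_continuous CS)).
  - exact: (nice_comp Th oO bO XF.1 (eh_continuous CS)).
  - apply: niceM; first exact: (nice_comp Th oO bO Sp.1 (ef_continuous CS)).
    exact: (nice_comp Th oO bO XF.1 (eg_continuous CS)).
have z1 := niceZ (1 / 2) n1; have z2 := niceZ (lambda E / 2) n2; have n13 := niceD n3 z1.
by rewrite -(int3Z oA Aa (1 / 2) n1) -(int3Z oA Aa (lambda E / 2) n2) -!(int3D oA Aa).
Qed.

Lemma sqnorm_grad_quotient f g : Sh Omega Th f -> Sh Omega Th g ->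
  dt ^+ 2 * sqnorm_grad Omega (fun x => (f x - g x) / dt) =
  \int3_(x in A) (dotv (grad f x - grad g x) (grad f x - grad g x)).
Proof.
move=> Sf Sg; have df := Sh_dirnice oO bO Sf; have dg := Sh_dirnice oO bO Sg.
have nb : mnice A (fun x => grad f x - grad g x) by apply: mniceB => //; exact: mnice_grad.
have n1 : nice A (fun x => dotv (grad f x - grad g x) (grad f x - grad g x)) by exact: nice_dotv.
rewrite /sqnorm_grad (int3_cells oO cover).
have -> : \int3_(x in A) (dotv (grad (fun x => (f x - g x) / dt) x) (grad (fun x => (f x - g x) / dt) x))
   = \int3_(x in A) (dt^-1 ^+ 2 * dotv (grad f x - grad g x) (grad f x - grad g x)).
  apply: eq_int3 => x Ax.
  have -> : grad (fun x => (f x - g x) / dt) x = dt^-1 *: (grad f x - grad g x).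
    apply/rowP => k; rewrite !mxE -(pdB oA k df dg Ax).
    rewrite -(pdZ _ k (dirniceB oA df dg) Ax).
    by apply: (eq_pd (A := A)) => // y _; exact: mulrC.
  by rewrite dotvZl dotvZr mulrA.
by rewrite (int3Z oA Aa _ n1) mulrA -exprMn mulfV ?gt_eqF // expr1n mul1r.
Qed.

Lemma sqnorm_gradmx_quotient (F G : pt -> mx) : Xh Omega Th F -> Xh Omega Th G ->
  dt ^+ 2 * sqnorm_gradmx Omega (fun x => dt^-1 *: (F x - G x)) =
  \int3_(x in A) (\sum_k ddot (pdm k F x - pdm k G x) (pdm k F x - pdm k G x)).
Proof.
move=> XF XG; have dF := Xh_dirnice oO bO XF; have dG := Xh_dirnice oO bO XG.
have n1 : nice A (fun x => \sum_k ddot (pdm k F x - pdm k G x) (pdm k F x - pdm k G x)).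
  apply: nice_sum => // k _; have nk := mniceB oA (mnice_pdm oA k dF) (mnice_pdm oA k dG).
  exact: nice_ddot.
rewrite /sqnorm_gradmx (int3_cells oO cover).
have -> : \int3_(x in A) (ddotgrad (fun x => dt^-1 *: (F x - G x)) (fun x => dt^-1 *: (F x - G x)) x)
   = \int3_(x in A) (dt^-1 ^+ 2 * \sum_k ddot (pdm k F x - pdm k G x) (pdm k F x - pdm k G x)).
  apply: eq_int3 => x Ax; rewrite /ddotgrad mulr_sumr; apply: eq_bigr => k _.
  have -> : pdm k (fun x => dt^-1 *: (F x - G x)) x = dt^-1 *: (pdm k F x - pdm k G x).
    apply/matrixP => i j; rewrite !mxE -(pdB oA k (dF i j) (dG i j) Ax).
    rewrite -(pdZ _ k (dirniceB oA (dF i j) (dG i j)) Ax).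
    by apply: (eq_pd (A := A)) => // y _; rewrite !mxE.
  by rewrite ddotZl ddotZr mulrA.
by rewrite (int3Z oA Aa _ n1) mulrA -exprMn mulfV ?gt_eqF // expr1n mul1r.
Qed.

(** The energy balance with numbers for integrals: [cv], [gv], [cm] are the transport terms, which
    the momentum equation turns into the viscous dissipation; [mm] and [bm] are the other two
    dissipations, and [i1 + i2] is the tested increment. *)
Lemma dissipation_arith (l t tn q1 q2 nv i1 i2 cv gv cm mm bm : R) :
  nu * nv = cv - gv + cm ->
  i1 + dt * cv - dt * gv + dt * gamma * mm = 0 -> i2 + dt * cm + dt * bm = 0 ->
  t - tn + (1 / 2 * (dt ^+ 2 * q1) + l / 2 * (dt ^+ 2 * q2)) <= i1 + i2 ->
  t + (dt ^+ 2 / 2 * q1 + l * dt ^+ 2 / 2 * q2 + dt * nu * nv + dt * gamma * mm + dt * bm) <= tn.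
Proof.
move=> h1 h2 h3; rewrite -[dt * nu * nv]mulrA h1 => h4.
have -> : dt ^+ 2 / 2 * q1 = 1 / 2 * (dt ^+ 2 * q1) by ring.
have -> : l * dt ^+ 2 / 2 * q2 = l / 2 * (dt ^+ 2 * q2) by ring.
move: (1 / 2 * _) (l / 2 * _) h4 => a1 a2 h4.
lra.
Qed.

Lemma scheme_step_dissipation phin Fn v s F M phi mu :
  Sh Omega Th phin -> Xh Omega Th Fn ->
  scheme_step Omega Th E S b nu gamma dt phin Fn v s F M phi mu ->
  total_energy Omega E phi F
  + (dt ^+ 2 / 2 * sqnorm_grad Omega (fun x => (phi x - phin x) / dt)
     + lambda E * dt ^+ 2 / 2 * sqnorm_gradmx Omega (fun x => dt^-1 *: (F x - Fn x))
     + dt * nu * sqnorm_gradv Omega v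
     + dt * gamma * sqnorm_mx Omega M
     + dt * \int3_(x in Omega) (b (phin x) * dotv (grad mu x) (grad mu x)))
  <= total_energy Omega E phin Fn.
Proof.
move=> Sn Xn [[Vv Rs XF XM [Sp Sm]] H].
have XD : Xh Omega Th (F - Fn) by rewrite -(scaleN1r Fn) addrC; exact: (XhL _ Xn XF).
have SD : Sh Omega Th ((phi : pt -> R^o) - phin).
  by rewrite -(@scaleN1r R (pt -> R^o) phin) addrC; exact: (ShL _ Sn Sp).
(* [M] and [mu] are tested against the increments and conversely, so [e4] and [e6] add up to the
   energy gradient tested with the increment, and [e3], [e5] express that quantity by transport and
   dissipation. *)
have [] := H v s M (F - Fn) mu ((phi : pt -> R^o) - phin); first by split.
rewrite /sqnorm_gradv /sqnorm_mx !(int3_cells oO cover) => e1 e2 e3 e4 [e5 e6].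
rewrite -(source_fst oO bO CS Sn Xn Sp XF XD) in e4.
rewrite -(source_snd oO bO CS Sn Xn Sp XF SD) in e6.
have us := scheme_ucoefs oO bO CS Sn Xn XF Sp.
have sE := U_L oO bO 1 us (wfst_PW XD) (wsnd_PW SD).
have wE : 1 *: wfst (F - Fn) + wsnd ((phi : pt -> R^o) - phin) =
    ((F - Fn, (phi : pt -> R^o) - phin) : Wt R).
  by rewrite scale1r; congr pair; [exact: addr0|exact: add0r].
rewrite wE mul1r -e4 -e6 in sE.
have := source_ge oO bO CS eg0 Sn Xn Sp XF.
rewrite sE -(total_energy_cells Sp XF) -(total_energy_cells Sn Xn).
rewrite -(sqnorm_grad_quotient Sp Sn) -(sqnorm_gradmx_quotient XF Xn).
(* After this rewriting the momentum equation contains literally the transport terms of [e3] and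
   [e5]; the pressure disappears by [e2]. *)
have cE := coupling_dual Omega Th phin Fn ((M, mu) : Wt R) v.
rewrite /coupling /= in cE; rewrite e2 subr0 cE in e1.
have c1 : \int3_(x in A) (ddot (M x) ((F - Fn) x)) = \int3_(x in A) (ddot (F x - Fn x) (M x)).
  by apply: eq_int3 => x _; exact: ddotC.
have c2 : \int3_(x in A) (mu x * ((phi : pt -> R^o) - phin) x) = \int3_(x in A) ((phi x - phin x) * mu x).
  by apply: eq_int3 => x _; exact: mulrC.
rewrite c1 c2.
exact: dissipation_arith e1 e3 e5.
Qed.

End Stability.

Section Conclusion.
Variable R : realType.
Local Notation pt := 'rV[R]_3.
Local Notation mx := 'M[R]_3.

Lemma total_energy_ge (Omega : set pt) (Th : mesh R) (E : energy R) (S : splitting R) (Kd : R) phi F :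
  open Omega -> bounded_set Omega ->
  closure Omega = \bigcup_i hull (cell (m := Th) i) -> convex_splitting E S ->
  (forall r M, - Kd <= psi E r + eh E M + ef E r * eg E M) ->
  Sh Omega Th phi -> Xh Omega Th F ->
  1 / 2 * sqnorm_grad Omega phi + lambda E / 2 * sqnorm_gradmx Omega F <=
  total_energy Omega E phi F + Kd * \int3_(x in Omega) 1.
Proof.
move=> oO bO cover CS dens_ge Sp XF.
have := cell_energy_ge oO bO CS dens_ge Sp XF.
rewrite -(total_energy_cells oO bO cover CS Sp XF) /domain_volume.
rewrite -(int3_cells oO cover (fun x => dotv (grad phi x) (grad phi x))).
rewrite -(int3_cells oO cover (ddotgrad F F)) -(int3_cells oO cover (fun=> 1)).
by rewrite addrC lerBlDr.
Qed.

Lemma telescoping (N : nat) (t D : nat -> R) : (forall n, (n < N)%N -> t n.+1 + D n <= t n) ->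
  forall n, (n <= N)%N -> t n + \sum_(i < n) D i <= t 0.
Proof.
move=> H; elim=> [|n IH] nN; first by rewrite big_ord0 addr0.
by rewrite big_ord_recr /= [X in _ + X]addrC addrA (le_trans _ (IH (ltnW nN))) // lerD2r H.
Qed.

End Conclusion.

Theorem lemma5p1 (R : realType) (Omega : set 'rV[R]_3) (E : energy R) :
  exists C0 : ('rV[R]_3 -> R) -> ('rV[R]_3 -> 'M[R]_3) -> R,
  forall (S : splitting R) (b : R -> R) (p nu gamma T rho beta : R),
  bounded_domain Omega ->
  convex_splitting E S ->
  mobility_assumption b ->
  elastic_assumptions E p ->
  potential_assumptions E S p ->
  0 < lambda E -> 0 < nu -> 0 < gamma -> 0 < T -> 0 < rho -> 0 < beta ->
  exists2 C : R, 0 < C &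
  forall (Th : mesh R) (N : nat) (phi0 phi0h : 'rV[R]_3 -> R)
    (F0 F0h : 'rV[R]_3 -> 'M[R]_3),
  let dt := T / N%:R in
  conforming_decomposition Omega Th ->
  quasi_uniform rho Th ->
  inf_sup Omega Th beta ->
  (0 < N)%N ->
  H1 Omega phi0 -> H1mx Omega F0 ->
  projS Omega Th phi0 phi0h -> projX Omega Th F0 F0h ->
  (forall n, (n < N)%N ->
   forall phin Fn, Sh Omega Th phin -> Xh Omega Th Fn ->
   exists v s F M phi mu,
     scheme_step Omega Th E S b nu gamma dt phin Fn v s F M phi mu) /\
  forall (v : nat -> 'rV[R]_3 -> 'rV[R]_3) (s phi mu : nat -> 'rV[R]_3 -> R)
    (F M : nat -> 'rV[R]_3 -> 'M[R]_3),
  phi 0%N = phi0h -> F 0%N = F0h ->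
  (forall n, (n < N)%N ->
   scheme_step Omega Th E S b nu gamma dt (phi n) (F n)
     (v n.+1) (s n.+1) (F n.+1) (M n.+1) (phi n.+1) (mu n.+1)) ->
  \big[Num.max/0]_(n < N)
      (1 / 2 * sqnorm_grad Omega (phi n.+1)
       + lambda E / 2 * sqnorm_gradmx Omega (F n.+1))
    + dt ^+ 2 / 2 * (\sum_(n < N)
        sqnorm_grad Omega (fun x => (phi n.+1 x - phi n x) / dt))
    + lambda E * dt ^+ 2 / 2 * (\sum_(n < N)
        sqnorm_gradmx Omega (fun x => dt^-1 *: (F n.+1 x - F n x)))
    + dt * nu * (\sum_(n < N) sqnorm_gradv Omega (v n.+1))
    + dt * gamma * (\sum_(n < N) sqnorm_mx Omega (M n.+1))
    + dt * (\sum_(n < N) \int3_(x in Omega)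
        (b (phi n x) * dotv (grad (mu n.+1) x) (grad (mu n.+1) x)))
    <= C0 phi0h F0h + C
  /\ (forall n, (n < N)%N ->
      total_energy Omega E (phi n.+1) (F n.+1)
        <= total_energy Omega E (phi n) (F n)).
Proof.
have arith1 (x y z k : R) : x + y <= z -> 0 <= x + k -> y <= z + k by lra.
have arith2 (x k : R) : x + k + (x + k) <= 2 * x + (2 * k + 1) by lra.
(* The factor 2 appears because the maximum and the sum of the dissipations are each bounded by the
   initial energy plus [K]. *)
exists (fun phi F => 2 * total_energy Omega E phi F).
move=> S b p nu gamma T rho beta [oO cO nO bO] CS [cb [b0 [b1 [b00 bb]]]] EA PA lam0 nu0 gamma0 T0 _ _.
have [_ _ _ _ [[kf1 [kf2 [kf3 [kg [kh1 [kh2 [_ _ _ Hg _]]]]]]] [d1 [d2 [d3 [d4 [[d10 _ _ _] Hw _ _]]]]]]] := EA.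
have eg0 M : 0 <= eg E M by have /andP[] := Hg M.
have [_ [c1 [c2 [l [q [[_ c20] _ _ Hpsi _]]]]]] := PA.
have b_ge0 r : 0 <= b r by apply: le_trans (bb r).1; exact: ltW.
(* Minus the sum of the lower bounds of [psi] and of the elastic density; the energy plus [Kd] times
   the volume is nonnegative. *)
pose Kd := c2 + d1.
have dens_ge r M : - Kd <= psi E r + eh E M + ef E r * eg E M.
  have /andP[w1 _] := Hw r M; have := Hpsi r; move: w1; rewrite /wdens /Kd; lra.
pose K := Kd * \int3_(x in Omega) 1.
have K0 : 0 <= K.
  by apply: mulr_ge0; [rewrite addr_ge0|apply: int3_ge0 => x _; exact: ler01].
(* Fixed before the mesh and [N], since it depends only on these lower bounds and the volume of
   [Omega]. The 1 makes it positive also when [K] is 0. *)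
exists (2 * K + 1); first by lra.
move=> Th N phi0 phi0h F0 F0h dt [cover _ _] _ _ N0 _ _ [S0 _] [X0 _].
have dt0 : 0 < dt by rewrite divr_gt0 // ltr0n.
split=> [n nN phin Fn Sn Xn|v s phi mu F M p0 f0 step].
  exact: (scheme_step_exists oO cO nO bO cover CS cb Sn Xn eg0 lam0 dens_ge b_ge0 nu0 gamma0 dt0).
have spaces n : (n <= N)%N -> Sh Omega Th (phi n) /\ Xh Omega Th (F n).
  case: n => [|n] nN; first by rewrite p0 f0.
  by have [[_ _ ? _ [? _]] _] := step n nN.
pose t n := total_energy Omega E (phi n) (F n).
pose D n := dt ^+ 2 / 2 * sqnorm_grad Omega (fun x => (phi n.+1 x - phi n x) / dt)
     + lambda E * dt ^+ 2 / 2 * sqnorm_gradmx Omega (fun x => dt^-1 *: (F n.+1 x - F n x))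
     + dt * nu * sqnorm_gradv Omega (v n.+1)
     + dt * gamma * sqnorm_mx Omega (M n.+1)
     + dt * \int3_(x in Omega) (b (phi n x) * dotv (grad (mu n.+1) x) (grad (mu n.+1) x)).
have diss n : (n < N)%N -> t n.+1 + D n <= t n.
  move=> nN; have [Sn Xn] := spaces n (ltnW nN).
  exact: (scheme_step_dissipation oO bO cover CS eg0 dt0 Sn Xn (step n nN)).
have grad_ge0 f : 0 <= sqnorm_grad Omega f by apply: int3_ge0 => x _; exact: dotv_ge0.
have gradmx_ge0 G : 0 <= sqnorm_gradmx Omega G.
  by apply: int3_ge0 => x _; apply: sumr_ge0 => k _; exact: ddot_ge0.
have dt_ge0 : 0 <= dt by exact: ltW.
have half_ge0 : 0 <= lambda E / 2 by rewrite divr_ge0 // ltW.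
have D0 n : 0 <= D n.
  apply: addr_ge0; first apply: addr_ge0; first apply: addr_ge0; first apply: addr_ge0.
  - by rewrite mulr_ge0 // divr_ge0 // exprn_ge0.
  - apply: mulr_ge0 => //; apply: divr_ge0 => //.
    by apply: mulr_ge0; [exact: ltW|exact: exprn_ge0].
  - apply: mulr_ge0; first by apply: mulr_ge0 => //; exact: ltW.
    by apply: int3_ge0 => x _; exact: ddot_ge0.
  - apply: mulr_ge0; first by apply: mulr_ge0 => //; exact: ltW.
    by apply: int3_ge0 => x _; exact: ddot_ge0.
  - apply: mulr_ge0 => //; apply: int3_ge0 => x _.
    by apply: mulr_ge0 => //; exact: dotv_ge0.
have tel := telescoping diss.
have tK n : (n <= N)%N -> 1 / 2 * sqnorm_grad Omega (phi n) + lambda E / 2 * sqnorm_gradmx Omega (F n) <= t n + K.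
  by move=> nN; have [Sn Xn] := spaces n nN; exact: (total_energy_ge oO bO cover CS dens_ge Sn Xn).
have sq_ge0 n : 0 <= 1 / 2 * sqnorm_grad Omega (phi n) + lambda E / 2 * sqnorm_gradmx Omega (F n).
  by rewrite addr_ge0 // mulr_ge0.
split; last first.
  by move=> n nN; apply: le_trans (diss n nN); rewrite lerDl.
have -> : total_energy Omega E phi0h F0h = t 0%N by rewrite /t p0 f0.
have t_le n : (n <= N)%N -> t n <= t 0%N.
  move=> nN; apply: le_trans (tel n nN); rewrite lerDl; exact: sumr_ge0.
(* The energy at the last level may be negative, but not below [- K]. *)
have Dsum : \sum_(n < N) D n <= t 0%N + K.
  exact: arith1 (tel N (leqnn N)) (le_trans (sq_ge0 N) (tK N (leqnn N))).
have max_le : \big[Num.max/0]_(n < N) (1 / 2 * sqnorm_grad Omega (phi n.+1)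
       + lambda E / 2 * sqnorm_gradmx Omega (F n.+1)) <= t 0%N + K.
  (* The maximum starts from 0, so the bound itself has to be nonnegative; this is read off at time
     0. *)
  apply: bigmax_le => [|n _]; first exact: le_trans (sq_ge0 0%N) (tK 0%N isT).
  by apply: le_trans (tK n.+1 (ltn_ord n)) _; rewrite lerD2r t_le.
have DE : \sum_(n < N) D n =
    dt ^+ 2 / 2 * (\sum_(n < N) sqnorm_grad Omega (fun x => (phi n.+1 x - phi n x) / dt))
    + lambda E * dt ^+ 2 / 2 * (\sum_(n < N)
        sqnorm_gradmx Omega (fun x => dt^-1 *: (F n.+1 x - F n x)))
    + dt * nu * (\sum_(n < N) sqnorm_gradv Omega (v n.+1))
    + dt * gamma * (\sum_(n < N) sqnorm_mx Omega (M n.+1))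
    + dt * (\sum_(n < N) \int3_(x in Omega)
        (b (phi n x) * dotv (grad (mu n.+1) x) (grad (mu n.+1) x))).
  by rewrite !mulr_sumr -!big_split.
rewrite DE in Dsum.
have := le_trans (lerD max_le Dsum) (arith2 _ _); rewrite !addrA; exact.
Qed.
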